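(* Let $\vec p=(1,p_2)$ and $\vec q=(q_1,q_2)$ satisfy $1<p_2\le q_-\le q_+<\infty$, and let $\vec a,\vec b,\vec c\in\mathbb{R}^2$, $\vec\alpha,\vec\beta\in(-1,\infty)^2$. Then the following are equivalent: (1) $S_{\vec a,\vec b,\vec c}$ is bounded from $L^{\vec p}_{\vec\alpha}(T_B\times T_B)$ to $L^{\vec q}_{\vec\beta}(T_B\times T_B)$; (2) $T_{\vec a,\vec b,\vec c}$ is bounded from $L^{\vec p}_{\vec\alpha}(T_B\times T_B)$ to $L^{\vec q}_{\vec\beta}(T_B\times T_B)$; (3) $\alpha_1<b_1$, $\alpha_2+1<p_2(b_2+1)$, and for each $i\in\{1,2\}$: $-q_ia_i<\beta_i+1$ and $c_i=n+1+a_i+b_i+\lambda_i$, where $\lambda_1=\frac{n+1+\beta_1}{q_1}-(n+1+\alpha_1)$ and $\lambda_2=\frac{n+1+\beta_2}{q_2}-\frac{n+1+\alpha_2}{p_2}$.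
   Context: Let $n$ be a positive integer. For $z=(z_1,\dots,z_n)\in\mathbb{C}^n$ write $z=x+iy$ with $x,y\in\mathbb{R}^n$, $z'=(z_1,\dots,z_{n-1})$, $y'=(y_1,\dots,y_{n-1})$. Let $B=\{y\in\mathbb{R}^n: |y'|^2<y_n\}$ and $T_B=\{x+iy: x\in\mathbb{R}^n, y\in B\}$. For $z\in T_B$ put $\rho(z)=y_n-|y'|^2>0$, and for $z,u\in T_B$ put $\rho(z,u)=\frac14\big(\sum_{j=1}^{n-1}(z_j-\overline{u_j})^2-2i(z_n-\overline{u_n})\big)$; this has positive real part, and complex powers $\rho(z,u)^c$ are taken with the principal branch. $dV$ is Lebesgue measure on $\mathbb{C}^n$ and $dV_\alpha(z)=\rho(z)^\alpha dV(z)$. For $\vec p=(p_1,p_2)\in[1,\infty]^2$ and $\vec\alpha=(\alpha_1,\alpha_2)$, $L^{\vec p}_{\vec\alpha}(T_B\times T_B)$ is the space of measurable $f$ on $T_B\times T_B$ with finite mixed norm $\|f\|_{\vec p,\vec\alpha}=\big\{\int_{T_B}\big(\int_{T_B}|f(z,w)|^{p_1}dV_{\alpha_1}(z)\big)^{p_2/p_1}dV_{\alpha_2}(w)\big\}^{1/p_2}$, with the inner (resp. outer) integral replaced by an essential supremum in $z$ (resp. $w$) when $p_1=\infty$ (resp. $p_2=\infty$); when $\vec p=(\infty,\infty)$ this is $L^\infty(T_B\times T_B)$. Write $p_-=\min\{p_1,p_2\}$, $p_+=\max\{p_1,p_2\}$, and similarly $q_\pm$. For $\vec a=(a_1,a_2),\vec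 b=(b_1,b_2),\vec c=(c_1,c_2)\in\mathbb{R}^2$, $T_{\vec a,\vec b,\vec c}f(z,w)=\rho(z)^{a_1}\rho(w)^{a_2}\int_{T_B}\int_{T_B}\frac{\rho(u)^{b_1}\rho(\eta)^{b_2}}{\rho(z,u)^{c_1}\rho(w,\eta)^{c_2}}f(u,\eta)\,dV(u)\,dV(\eta)$ and $S_{\vec a,\vec b,\vec c}f(z,w)=\rho(z)^{a_1}\rho(w)^{a_2}\int_{T_B}\int_{T_B}\frac{\rho(u)^{b_1}\rho(\eta)^{b_2}}{|\rho(z,u)|^{c_1}|\rho(w,\eta)|^{c_2}}f(u,\eta)\,dV(u)\,dV(\eta)$. An operator is bounded from $X$ to $Y$ if for every $f\in X$ the defining integral converges for a.e. $(z,w)$ and $\|Tf\|_Y\le C\|f\|_X$ with $C$ independent of $f$. *)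

(* Defs.v *)
(* MathComp + MathComp-Analysis (R : realType), with complex numbers
   R[i] from mathcomp-real-closed. *)
From mathcomp Require Import all_boot all_order all_algebra.
From mathcomp Require Import all_classical all_reals all_analysis.
From mathcomp.real_closed Require Import complex.
Set Implicit Arguments. Unset Strict Implicit. Unset Printing Implicit Defensive.
Import Order.TTheory GRing.Theory Num.Theory.
Local Open Scope classical_set_scope.
Local Open Scope ring_scope.
Local Open Scope complex_scope.

Section TubeDomain.
Variable R : realType.
Local Notation Rm := (measurableTypeR R).

(** Lebesgue measure on R^k, realised on k-tuples of reals (with the product
    sigma-algebra of the Borel sigma-algebras) by iterated integration:
    lebT (k+1) A = \int (lebT k) (section of A at the first coordinate) dt. *)
Fixpoint lebT (k : nat) : set (k.-tuple Rm) -> \bar R :=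
  match k return set (k.-tuple Rm) -> \bar R with
  | 0 => fun A => (\1_A [tuple])%:E
  | k'.+1 => fun A =>
      (\int[@lebesgue_measure R]_t @lebT k' [set x | A (cons_tuple t x)])%E
  end.
Arguments lebT : clear implicits.

Variable n : nat.

(** A point z = x + i y of C^n is represented by the pair (x, y) of real
    n-tuples; coordinates are indexed 0 .. n-1, so the paper's z_j is
    index j-1 and z_n is index n.-1. *)
Definition Cn := (n.-tuple Rm * n.-tuple Rm)%type.

(** Lebesgue measure dV on C^n = R^n x R^n. *)
Definition dV : set Cn -> \bar R := (lebT n \x lebT n)%E.

(** Lebesgue measure dV(u) dV(eta) on C^n x C^n. *)
Definition dV2 : set (Cn * Cn) -> \bar R := (dV \x dV)%E.

Definition xc (z : Cn) (j : nat) : R := nth 0 (z.1 : seq R) j.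
Definition yc (z : Cn) (j : nat) : R := nth 0 (z.2 : seq R) j.
Definition zc (z : Cn) (j : nat) : R[i] := (xc z j) +i* (yc z j).

(** B = { y in R^n : |y'|^2 < y_n } and the tube T_B. *)
Definition Bcone : set (n.-tuple Rm) :=
  [set y | \sum_(j < n.-1) (nth 0 (y : seq R) j) ^+ 2 < nth 0 (y : seq R) n.-1].
Definition TB : set Cn := [set z | Bcone z.2].

(** rho(z) = y_n - |y'|^2 *)
Definition rho (z : Cn) : R := yc z n.-1 - \sum_(j < n.-1) (yc z j) ^+ 2.

(** rho(z,u) = 1/4 ( sum_{j<n} (z_j - conj u_j)^2 - 2 i (z_n - conj u_n) ) *)
Definition rho2 (z u : Cn) : R[i] :=
  (\sum_(j < n.-1) (zc z j - (zc u j)^*) ^+ 2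
    - 2%:R * 'i * (zc z n.-1 - (zc u n.-1)^*)) / 4%:R.

(** modulus of a complex number *)
Definition cmod (w : R[i]) : R := Num.sqrt (complex.Re w ^+ 2 + complex.Im w ^+ 2).

(** principal branch of w^c (c real), for complex.Re w > 0:
    w^c = |w|^c (cos (c arg w) + i sin (c arg w)), arg w = atan (complex.Im w / complex.Re w). *)
Definition cpow (w : R[i]) (c : R) : R[i] :=
  let th := atan (complex.Im w / complex.Re w) in
  ((cmod w `^ c) * cos (c * th)) +i* ((cmod w `^ c) * sin (c * th)).

Definition realC (r : R) : R[i] := r +i* 0.

(** Lebesgue integral of a complex-valued function and its convergence. *)
Definition cintegrable {d} {T : measurableType d} (mu : set T -> \bar R)
    (D : set T) (g : T -> R[i]) : Prop :=
  mu.-integrable D (fun x => (complex.Re (g x))%:E) /\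
  mu.-integrable D (fun x => (complex.Im (g x))%:E).

Definition cint {d} {T : measurableType d} (mu : set T -> \bar R)
    (D : set T) (g : T -> R[i]) : R[i] :=
  (fine (\int[mu]_(x in D) (complex.Re (g x))%:E)%E) +i*
  (fine (\int[mu]_(x in D) (complex.Im (g x))%:E)%E).

(** Mixed norm ||f||_{(p1,p2),(al1,al2)} for finite exponents p1, p2. *)
Definition mixnorm (p1 p2 al1 al2 : R) (f : Cn * Cn -> R[i]) : \bar R :=
  ((\int[dV]_(w in TB)
      ((rho w `^ al2)%:E *
       ((\int[dV]_(z in TB) ((rho z `^ al1) * (cmod (f (z, w)) `^ p1))%:E)
          `^ (p2 / p1))))
   `^ p2^-1)%E.

(** f belongs to L^{(p1,p2)}_{(al1,al2)}(T_B x T_B) (finite exponents). *)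
Definition inLmixed (p1 p2 al1 al2 : R) (f : Cn * Cn -> R[i]) : Prop :=
  [/\ measurable_fun (TB `*` TB) (fun v => complex.Re (f v)),
      measurable_fun (TB `*` TB) (fun v => complex.Im (f v)) &
      (mixnorm p1 p2 al1 al2 f < +oo)%E].

(** The integral operator
      f |-> pre(z,w) * \int\int K((z,w),(u,eta)) f(u,eta) dV(u) dV(eta). *)
Definition intop (pre : Cn * Cn -> R[i]) (K : Cn * Cn -> Cn * Cn -> R[i])
    (f : Cn * Cn -> R[i]) (zw : Cn * Cn) : R[i] :=
  pre zw * cint dV2 (TB `*` TB) (fun v => K zw v * f v).

(** Boundedness from L^{(p1,p2)}_{(al1,al2)} to L^{(q1,q2)}_{(be1,be2)}:
    for every f in the source space, the defining integral converges for
    a.e. (z,w) in T_B x T_B, and the norm inequality holds with a constant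
    independent of f. *)
Definition bounded_intop (pre : Cn * Cn -> R[i]) (K : Cn * Cn -> Cn * Cn -> R[i])
    (p1 p2 al1 al2 q1 q2 be1 be2 : R) : Prop :=
  exists C : R, forall f : Cn * Cn -> R[i], inLmixed p1 p2 al1 al2 f ->
    (exists N : set (Cn * Cn), dV2.-negligible N /\
       forall zw, (TB `*` TB) zw -> ~ N zw ->
         cintegrable dV2 (TB `*` TB) (fun v => K zw v * f v)) /\
    (mixnorm q1 q2 be1 be2 (intop pre K f) <= C%:E * mixnorm p1 p2 al1 al2 f)%E.

(** prefactor rho(z)^{a1} rho(w)^{a2} *)
Definition prefac (a1 a2 : R) (zw : Cn * Cn) : R[i] :=
  realC (rho zw.1 `^ a1 * rho zw.2 `^ a2).

(** kernel of T_{a,b,c}: rho(u)^{b1} rho(eta)^{b2} / (rho(z,u)^{c1} rho(w,eta)^{c2}) *)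
Definition Tkernel (b1 b2 c1 c2 : R) (zw ue : Cn * Cn) : R[i] :=
  realC (rho ue.1 `^ b1 * rho ue.2 `^ b2) /
  (cpow (rho2 zw.1 ue.1) c1 * cpow (rho2 zw.2 ue.2) c2).

(** kernel of S_{a,b,c}: rho(u)^{b1} rho(eta)^{b2} / (|rho(z,u)|^{c1} |rho(w,eta)|^{c2}) *)
Definition Skernel (b1 b2 c1 c2 : R) (zw ue : Cn * Cn) : R[i] :=
  realC (rho ue.1 `^ b1 * rho ue.2 `^ b2 /
         (cmod (rho2 zw.1 ue.1) `^ c1 * cmod (rho2 zw.2 ue.2) `^ c2)).

Definition Top (a1 a2 b1 b2 c1 c2 : R) := intop (prefac a1 a2) (Tkernel b1 b2 c1 c2).
Definition Sop (a1 a2 b1 b2 c1 c2 : R) := intop (prefac a1 a2) (Skernel b1 b2 c1 c2).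

End TubeDomain.

(* Main.v *)
Require Import Defs.
From HB Require Import structures.
From mathcomp Require Import all_boot all_order all_algebra.
From mathcomp Require Import all_classical all_reals all_analysis.
From mathcomp.real_closed Require Import complex.
From mathcomp Require Import measurable_realfun ring lra.
Set Implicit Arguments.
Unset Strict Implicit.
Unset Printing Implicit Defensive.
Import Order.TTheory GRing.Theory Num.Theory.
Import numFieldNormedType.Exports.
Local Open Scope classical_set_scope.
Local Open Scope ring_scope.
Local Open Scope complex_scope.

(** Both operators have kernels K with |K| at most the kernel of S, and with Re K at least
    half of it wherever rho(z,u) and rho(w,eta) are close to the positive real axis; the
    equivalence with (3) is proved for every such K.

    Sufficiency. The real part of 4 rho(z,u) is 2 rho(z) + 2 rho(u) + |z'-u'|^2, which yields
    the Forelli-Rudin estimate: the integral of rho(u)^e |rho(z,u)|^(-r) is at most a constant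
    times rho(z)^(n+1+e-r) if e > -1 and r > n+1+e. In the first variable the source exponent
    is 1, so Minkowski's inequality only needs the L^q1 norms of the columns of the kernel. In
    the second one a Schur test with powers of rho works, |rho(w,eta)|^(-c2) being split
    into two factors according to p2 and q2.

    Necessity. The operator is tested on functions phi1(u) phi2(eta) supported on anisotropic
    boxes, on which the kernel is comparable to a power of the scale. Dilating the boxes
    forces the formulas for c_i. Letting the box of z (resp. eta) reach the boundary gives
    -q_i a_i < beta_i + 1 (resp. alpha_2 + 1 < p2 (b2 + 1)), and letting z go to infinity with
    u fixed gives alpha_1 < b1; in each case equality would produce a divergent integral of
    1/s. *)

(** * Jensen and Minkowski inequalities for extended real functions *)

Section nonneg_integral.
Local Open Scope ereal_scope.
Context d (T : measurableType d) (R : realType).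
Implicit Types (D : set T).
Import HBNNSimple.

(** The operator couples the two variables, and each direction has to separate them. For the upper
    bound the norm in z is taken with w fixed; since p1 = 1, what remains is a one-variable operator
    in w acting on the integral of |f| against rho^al1. For the lower bound both mixed norms factor
    on product functions, and freezing one factor leaves an inequality i l^(1/q) <= C s^(1/p) for
    the other variable, so one set of lemmas serves both variables, with p = 1 and p = p2. The
    obstacle there is the oscillation of the kernel of T: the boxes have a small aperture e, which
    keeps the argument of rho(z,u) of order e, and their anisotropy (the square root of the scale in
    z', the scale itself in Re z_n) keeps this true at every scale. Estimates are made on
    nonnegative, possibly infinite functions extended by zero outside T_B; finiteness, hence
    convergence almost everywhere, is deduced at the end. Integrals are compared through their
    definition as suprema over simple functions, so the output of the operator can be bounded by a
    measurable majorant directly. *)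

Lemma ge0_le_integral_nomeas (mu : {measure set T -> \bar R}) D (f g : T -> \bar R) :
  (forall x, D x -> 0 <= f x) -> (forall x, D x -> f x <= g x) ->
  \int[mu]_(x in D) f x <= \int[mu]_(x in D) g x.
Proof.
move=> f0 fg.
rewrite !ge0_integralE//; last by move=> x Dx; exact: le_trans (f0 x Dx) (fg x Dx).
apply: ereal_sup_le => _ [h /= hf <-].
exists h => //= x; apply: (le_trans (hf x)).
by rewrite /patch; case: ifPn => // /set_mem; exact: fg.
Qed.

Lemma ge0_integral_eq0 (mu : {measure set T -> \bar R}) (f : T -> \bar R) :
  measurable_fun setT f -> (forall x, 0 <= f x) ->
  \int[mu]_x f x = 0 -> ae_eq mu setT f (cst 0).
Proof.
move=> mf f0 If; apply/(ae_eq_integral_abs _ _ _).1 => //.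
by rewrite -If; apply: eq_integral => x _; rewrite gee0_abs.
Qed.

(** The convex function x^r lies above its tangent at x = t; solved for x, this bounds x by an
    affine function of x^r. Multiplied by the density y it can be integrated, with t still free. *)
Lemma young_tangent (x y : \bar R) (r t : R) : (1 < r)%R -> (0 < t)%R ->
  0 <= x -> 0 <= y ->
  x * y <= (t `^ (1 - r) / r)%:E * (x `^ r * y) + (t * (1 - r^-1))%:E * y.
Proof.
move=> r1 t0 x0 y0; have r0 : (0 < r)%R by lra.
have k0 : (0 < t `^ (1 - r) / r)%R by rewrite divr_gt0// powR_gt0.
have ri : (r^-1 < 1)%R by rewrite invf_lt1.
have k1 : (0 < t * (1 - r^-1))%R by rewrite mulr_gt0// subr_gt0.
move: x y x0 y0 => [x| |] [y| |] //; rewrite ?lee_fin => x0 y0.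
-
  have q0 : (0 < (1 - r^-1)^-1)%R by rewrite invr_gt0 subr_gt0.
  have := @conjugate_powR R (x / t)%R 1%R r ((1 - r^-1)^-1)%R.
  rewrite invrK mulr1 powR1 mul1r => /(_ (divr_ge0 x0 (ltW t0)) ler01 r0 q0).
  have -> : (r^-1 + (1 - r^-1) = 1)%R by ring.
  move=> /(_ erefl) h.
  rewrite mulrA -mulrDl ler_wpM2r//.
  have : (t * (x / t) <= t * ((x / t) `^ r / r + (1 - r^-1)))%R by rewrite ler_wpM2l// ltW.
  rewrite mulrCA divff ?gt_eqF// mulr1 mulrDr => /le_trans; apply.
  have tx : ((x / t) `^ r = x `^ r * t `^ (- r))%R.
    rewrite powRM//; last by rewrite invr_ge0 ltW.
    by congr *%R; rewrite -powR_inv1 ?ltW// -powRrM mulN1r.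
  rewrite lerD2r tx powRD; last by rewrite (gt_eqF t0) implybT.
  rewrite (powRr1 (ltW t0)) le_eqVlt; apply/orP; left; apply/eqP; field.
  by rewrite gt_eqF.
- have k00 : 0 <= (t `^ (1 - r) / r)%:E * (x%:E `^ r * +oo).
    by apply: mule_ge0; [rewrite lee_fin ltW|apply: mule_ge0 => //; exact: poweR_ge0].
  have -> : (t * (1 - r^-1))%:E * +oo = +oo by rewrite gt0_muley// lte_fin.
  by rewrite addey ?leey// gt_eqF// (lt_le_trans (ltNye 0)).
- move: y0; rewrite le_eqVlt => /predU1P[<-|y0]; first by rewrite !mule0 adde0.
  rewrite poweRyr ?gt_eqF//.
  have -> : +oo * y%:E = +oo by rewrite gt0_mulye// lte_fin.
  by rewrite gt0_muley ?lte_fin// -EFinM addye.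
- rewrite poweRyr ?gt_eqF//.
  have -> : +oo * +oo = +oo :> \bar R by rewrite gt0_mulye.
  by rewrite !gt0_muley ?lte_fin.
Qed.

Lemma poweRDM (x : \bar R) (r : R) : 0 <= x -> (1 <= r)%R -> x * x `^ (r - 1) = x `^ r.
Proof.
move=> x0 r1; rewrite -{1}(poweRe1 x0) -poweRD; first by congr (_ `^ _); ring.
by apply: add_neq0_poweRD_def; rewrite addrC subrK gt_eqF// (lt_le_trans ltr01).
Qed.

Lemma jensen_poweR (mu : {measure set T -> \bar R}) (h g : T -> \bar R) (r : R) :
  (1 <= r)%R -> measurable_fun setT h -> measurable_fun setT g ->
  (forall x, 0 <= h x) -> (forall x, 0 <= g x) ->
  (\int[mu]_x (h x * g x)) `^ r <=
  (\int[mu]_x (h x `^ r * g x)) * (\int[mu]_x g x) `^ (r - 1).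
Proof.
rewrite le_eqVlt => /predU1P[<-|r1] mh mg h0 g0.
  rewrite subrr poweRe0 mule1 poweRe1; last by apply: integral_ge0 => x _; exact: mule_ge0.
  by rewrite le_eqVlt; apply/orP; left; apply/eqP; apply: eq_integral => x _; rewrite poweRe1.
have r0 : (0 < r)%R by lra.
set X := \int[mu]_x (h x * g x); set A := \int[mu]_x (h x `^ r * g x).
set M := \int[mu]_x g x.
have mhg : measurable_fun setT (fun x => h x * g x) by exact: emeasurable_funM.
have mhr : measurable_fun setT (fun x => h x `^ r) by exact: (measurableT_comp (measurable_poweR r)).
have mhrg : measurable_fun setT (fun x => h x `^ r * g x) by exact: emeasurable_funM.
have X0 : 0 <= X by apply: integral_ge0 => x _; exact: mule_ge0.
have A0 : 0 <= A by apply: integral_ge0 => x _; rewrite mule_ge0// poweR_ge0.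
have M0 : 0 <= M by exact: integral_ge0.
(* When A = 0 and M = +oo the right-hand side is 0 * +oo = 0, so X = 0 has to come from h * g
   vanishing almost everywhere; the case M = 0 is handled in the same way. *)
have XA : A = 0 -> X = 0.
  move=> /ge0_integral_eq0 => /(_ mhrg (fun x => mule_ge0 (poweR_ge0 _ _) (g0 x))) h'.
  rewrite /X (ae_eq_integral (cst 0)) ?integral0//.
  apply: filterS h' => x /= /(_ Logic.I) /eqP; rewrite mule_eq0 poweR_eq0// => H _.
  by apply/eqP; rewrite mule_eq0; move: H => /orP[/andP[-> _]//|->]; rewrite orbT.
have XM : M = 0 -> X = 0.
  move=> /ge0_integral_eq0 => /(_ mg g0) h'.
  rewrite /X (ae_eq_integral (cst 0)) ?integral0//.
  by apply: filterS h' => x /= /(_ Logic.I) -> _; rewrite mule0.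
have RH0 : 0 <= A * M `^ (r - 1) by rewrite mule_ge0// poweR_ge0.
have [/eqP/XA->|A1] := boolP (A == 0); first by rewrite poweR0r ?gt_eqF.
have [/eqP/XM->|M1] := boolP (M == 0); first by rewrite poweR0r ?gt_eqF.
have {}A0 : 0 < A by rewrite lt_def A1.
have {}M0 : 0 < M by rewrite lt_def M1.
have rm : (r - 1 != 0)%R by rewrite subr_eq0 gt_eqF.
have [->|] := eqVneq M +oo.
  by rewrite poweRyr// gt0_muley ?leey.
move=> My; have [->|Ay] := eqVneq A +oo.
  by rewrite gt0_mulye ?leey// poweR_gt0.
have Af : A \is a fin_num by rewrite ge0_fin_numE ?ltW// ltey.
have Mf : M \is a fin_num by rewrite ge0_fin_numE ?ltW// ltey.
pose a := fine A; pose m := fine M.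
have a0 : (0 < a)%R by rewrite fine_gt0// A0 ltey.
have m0 : (0 < m)%R by rewrite fine_gt0// M0 ltey.
(* The value of t that minimises the integrated tangent bound: the bound becomes t m, and (t m)^r =
   a m^(r-1). *)
pose t := ((a / m) `^ r^-1)%R.
have t0 : (0 < t)%R by apply: powR_gt0; exact: divr_gt0.
have k0 : (0 < t `^ (1 - r) / r)%R by rewrite divr_gt0// powR_gt0.
have k1 : (0 < t * (1 - r^-1))%R by rewrite mulr_gt0// subr_gt0 invf_lt1.
have XAM : X <= (t `^ (1 - r) / r)%:E * A + (t * (1 - r^-1))%:E * M.
  have -> : (t `^ (1 - r) / r)%:E * A = \int[mu]_x ((t `^ (1 - r) / r)%:E * (h x `^ r * g x)).
    by rewrite ge0_integralZl// => [x _|]; [rewrite mule_ge0// poweR_ge0|rewrite lee_fin ltW].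
  have -> : (t * (1 - r^-1))%:E * M = \int[mu]_x ((t * (1 - r^-1))%:E * g x).
    by rewrite ge0_integralZl// lee_fin ltW.
  rewrite -ge0_integralD//=.
  - by apply: ge0_le_integral_nomeas => x _; [exact: mule_ge0|exact: young_tangent].
  - move=> x _; apply: mule_ge0; first by rewrite lee_fin ltW.
    by rewrite mule_ge0// poweR_ge0.
  - exact: measurable_funeM.
  - by move=> x _; apply: mule_ge0; rewrite // lee_fin ltW.
  - exact: measurable_funeM.
rewrite -(fineK Af) -(fineK Mf) -/a -/m in XAM *.
have Xf : X \is a fin_num.
  by rewrite ge0_fin_numE//; apply: (le_lt_trans XAM); rewrite -!EFinM -EFinD ltey.
rewrite -(fineK Xf) in XAM *.
have x0 : (0 <= fine X)%R by exact: fine_ge0.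
rewrite !poweR_EFin -EFinM lee_fin.
move: XAM; rewrite -!EFinM -EFinD lee_fin => XAM.
have trE : (t `^ r = a / m)%R.
  by rewrite -powRrM mulVf ?gt_eqF// powRr1// ltW// divr_gt0.
have tE : (t `^ (1 - r) * a = t * m)%R.
  rewrite powRD; last by rewrite (gt_eqF t0) implybT.
  rewrite powRr1 ?ltW// powRN trE; field.
  by rewrite !gt_eqF.
have {}XAM : (fine X <= t * m)%R.
  apply: (le_trans XAM); rewrite mulrAC tE.
  by rewrite le_eqVlt; apply/orP; left; apply/eqP; field; rewrite gt_eqF.
apply: (le_trans (ge0_ler_powR (ltW r0) _ _ XAM)).
- by rewrite nnegrE.
- by rewrite nnegrE; apply: mulr_ge0; exact: ltW.
- rewrite (powRM _ (ltW t0) (ltW m0)) trE -(mulr_powRB1 (ltW m0) r0).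
  by rewrite mulrA divfK ?gt_eqF.
Qed.

End nonneg_integral.

Section minkowski_kernel.
Local Open Scope ereal_scope.
Context d1 d2 (X : measurableType d1) (Y : measurableType d2) (R : realType).
Context (m1 : {sigma_finite_measure set X -> \bar R}).
Context (m2 : {sigma_finite_measure set Y -> \bar R}).

(* Jensen with respect to the weight g, then Tonelli; no duality is needed. *)
Lemma minkowski_kernel (H : X * Y -> \bar R) (g : Y -> \bar R) (r : R) (C : \bar R) :
  (1 <= r)%R -> 0 <= C -> measurable_fun setT H -> measurable_fun setT g ->
  (forall x, 0 <= H x) -> (forall y, 0 <= g y) ->
  (forall y, \int[m1]_x (H (x, y) `^ r) <= C) ->
  \int[m1]_x ((\int[m2]_y (H (x, y) * g y)) `^ r) <= C * (\int[m2]_y g y) `^ r.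
Proof.
move=> r1 C0 mH mg H0 g0 HC.
have mHr : measurable_fun setT (fun z : X * Y => H z `^ r) by exact: (measurableT_comp (measurable_poweR r)).
have mF : measurable_fun setT (fun z : X * Y => H z `^ r * g z.2).
  by apply: emeasurable_funM => //; exact: measurableT_comp.
have F0 z : 0 <= H z `^ r * g z.2 by rewrite mule_ge0// poweR_ge0.
set M := \int[m2]_y g y.
have M0 : 0 <= M by exact: integral_ge0.
apply: (@le_trans _ _ (\int[m1]_x ((\int[m2]_y (H (x, y) `^ r * g y)) * M `^ (r - 1)))).
  apply: ge0_le_integral_nomeas => x _; first exact: poweR_ge0.
  apply: jensen_poweR => //.
  by apply: (measurableT_comp mH); exact: measurable_fun_pair.
rewrite ge0_integralZr//; last 3 first.
- exact: (measurable_fun_fubini_tonelli_F _ mF F0).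
- by move=> x _; apply: integral_ge0 => y _; exact: (F0 (x, y)).
- exact: poweR_ge0.
rewrite -(poweRDM M0 r1) muleA lee_wpmul2r ?poweR_ge0//.
rewrite (fubini_tonelli _ mF F0)/=.
rewrite -ge0_integralZl//.
apply: ge0_le_integral_nomeas => y _.
  by apply: integral_ge0 => x _; exact: (F0 (x, y)).
rewrite ge0_integralZr//=.
- by rewrite lee_wpmul2r.
- by apply: (measurableT_comp mHr); exact: measurable_fun_pair.
- by move=> x _; exact: poweR_ge0.
Qed.

End minkowski_kernel.

(** * Lebesgue measure on tuples and on C^n *)

Section tuple_maps.
Context (R : realType).
Local Notation Rm := (measurableTypeR R).

Lemma measurable_cons_tuple d (T : measurableType d) k (f : T -> Rm) (g : T -> k.-tuple Rm) :
  measurable_fun setT f -> measurable_fun setT g ->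
  measurable_fun setT (fun p => cons_tuple (f p) (g p)).
Proof.
by move=> mf mg; exact: (measurable_cons mf mg).
Qed.

Lemma measurable_nth_tuple k (j : nat) :
  measurable_fun setT (fun x : k.-tuple Rm => nth 0 (x : seq R) j : Rm).
Proof.
have [jk|kj] := ltnP j k.
  have := @measurable_tnth _ Rm k (Ordinal jk); congr measurable_fun.
  by apply/funext => x; rewrite (tnth_nth 0).
rewrite (_ : (fun _ => _) = cst 0)//.
by apply/funext => x; rewrite nth_default// size_tuple.
Qed.

Lemma measurable_rcons_tuple d (T : measurableType d) k (f : T -> Rm) (g : T -> k.-tuple Rm) :
  measurable_fun setT f -> measurable_fun setT g ->
  measurable_fun setT (fun p => rcons_tuple (g p) (f p)).
Proof.
move=> mf mg; apply/measurable_fun_tnthP => i.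
rewrite (_ : _ \o _ = fun p => if (i < k)%N then nth 0 (g p : seq R) i else f p); last first.
  apply/funext => p /=; rewrite (tnth_nth 0)/= nth_rcons size_tuple.
  case: ifPn => // ik; rewrite ifT// eqn_leq [(k <= i)%N]leqNgt ik andbT.
  by have := ltn_ord i; rewrite ltnS.
case: (i < k)%N => //.
exact: (measurableT_comp (@measurable_nth_tuple k i) mg).
Qed.

End tuple_maps.

Lemma product_measure1_sigma_finite d1 d2 (T1 : measurableType d1) (T2 : measurableType d2)
    (R : realType) (m1 : {sigma_finite_measure set T1 -> \bar R})
    (m2 : {sigma_finite_measure set T2 -> \bar R}) :
  sigma_finite setT (m1 \x m2)%E.
Proof.
have /sigma_finiteP[F [TF ndF Foo]] := sigma_finiteT m1.
have /sigma_finiteP[G [TG ndG Goo]] := sigma_finiteT m2.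
exists (fun i => F i `*` G i).
  apply/seteqP; split => // -[x y] _.
  have [i _ Fx] : (\bigcup_i F i) x by rewrite -TF.
  have [j _ Gy] : (\bigcup_i G i) y by rewrite -TG.
  exists (maxn i j) => //; split => /=.
  - by move: x Fx; exact/subsetPset/ndF/leq_maxl.
  - by move: y Gy; exact/subsetPset/ndG/leq_maxr.
move=> k; have [mF Fk] := Foo k; have [mG Gk] := Goo k.
split; first exact: measurableX.
by rewrite product_measure1E// lte_mul_pinfty// ge0_fin_numE.
Qed.

Section lebT_measure.
Context (R : realType).
Local Notation Rm := (measurableTypeR R).
Local Open Scope ereal_scope.
Local Notation leb := (@lebesgue_measure R).

Definition uncons_tuple k (x : k.+1.-tuple Rm) : Rm * k.-tuple Rm :=
  (thead x, [tuple of behead x]).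

Lemma measurable_uncons_tuple k : measurable_fun setT (@uncons_tuple k).
Proof.
apply/measurable_fun_pairP; split => /=; last exact: measurable_behead.
exact: (@measurable_tnth _ Rm k.+1 ord0).
Qed.

(** [lebT] is a bare recursive set function. Each step is the image of the product of Lebesgue
    measure and the previous one under [cons_tuple]; the existential lets the induction carry the
    whole measure structure, from which the instances below are extracted. *)
Lemma lebT_sigma_finite_ex k :
  exists M : {sigma_finite_measure set (k.-tuple Rm) -> \bar R}, @lebT R k = M.
Proof.
elim: k => [|k [M IH]].
  by exists (@dirac _ (0.-tuple Rm) [tuple] R); apply/funext => A; rewrite /= /dirac.
pose c := (fun p : Rm * k.-tuple Rm => cons_tuple p.1 p.2).
have mc : measurable_fun setT c by exact: measurable_cons_tuple.
pose P := pushforward (leb \x M) c.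
pose Pm : {measure set _ -> \bar R} :=
  measure_function_pushforward__canonical__measure_function_Measure (leb \x M) mc.
have Psf : sigma_finite setT Pm.
  have [F TF mF] := product_measure1_sigma_finite leb M.
  exists (fun i => @uncons_tuple k @^-1` F i).
    by rewrite -preimage_bigcup -TF preimage_setT.
  move=> i; have [mFi Fi] := mF i; split.
    by rewrite -[X in measurable X]setTI; exact: measurable_uncons_tuple.
  rewrite /Pm/= /P /pushforward.
  rewrite (_ : _ @^-1` _ = F i)//; apply/seteqP; split => -[t x] /=.
    rewrite /uncons_tuple theadE (_ : [tuple of _] = x)//; exact/val_inj.
  by move=> ?; rewrite /uncons_tuple theadE (_ : [tuple of _] = x)//; exact/val_inj.
have mix := Measure_isSigmaFinite.Build _ _ _ Pm Psf.
pose Q : {sigma_finite_measure set (k.+1.-tuple Rm) -> \bar R} :=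
  HB.pack (Measure.sort Pm) mix.
exists Q.
apply/funext => A; rewrite /= IH /P /pushforward /product_measure1/=.
apply: eq_integral => t _ /=; congr (M _).
by apply/seteqP; split => x; rewrite /xsection/= inE.
Qed.

Let lebT0 k : @lebT R k set0 = 0.
Proof. by have [M ->] := lebT_sigma_finite_ex k; rewrite measure0. Qed.

Let lebT_ge0 k A : 0 <= @lebT R k A.
Proof. by have [M ->] := lebT_sigma_finite_ex k; exact: measure_ge0. Qed.

Let lebT_sigma_additive k : semi_sigma_additive (@lebT R k).
Proof. by have [M ->] := lebT_sigma_finite_ex k; exact: measure_semi_sigma_additive. Qed.

HB.instance Definition _ k := isMeasure.Build _ _ _ (@lebT R k)
  (lebT0 k) (@lebT_ge0 k) (@lebT_sigma_additive k).

Let lebT_sigma_finite k : sigma_finite setT (@lebT R k).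
Proof. by have [M ->] := lebT_sigma_finite_ex k; exact: sigma_finiteT. Qed.

HB.instance Definition _ k := Measure_isSigmaFinite.Build _ _ _ (@lebT R k)
  (@lebT_sigma_finite k).

Lemma integral_lebT0 (f : 0.-tuple Rm -> \bar R) : measurable_fun setT f ->
  \int[@lebT R 0]_x f x = f [tuple].
Proof.
move=> mf; rewrite (_ : @lebT R 0 = @dirac _ (0.-tuple Rm) [tuple] R)//.
by rewrite integral_dirac// diracT mul1e.
Qed.

Lemma integral_lebT_cons k (f : k.+1.-tuple Rm -> \bar R) :
  measurable_fun setT f -> (forall x, 0 <= f x) ->
  \int[@lebT R k.+1]_x f x = \int[leb]_t \int[@lebT R k]_x f (cons_tuple t x).
Proof.
move=> mf f0.
pose c := (fun p : Rm * k.-tuple Rm => cons_tuple p.1 p.2).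
have mc : measurable_fun setT c by exact: measurable_cons_tuple.
transitivity (\int[pushforward (leb \x @lebT R k) c]_x f x).
  apply: eq_measure_integral => A mA _.
  rewrite /= /pushforward /product_measure1/=.
  apply: eq_integral => t _ /=; congr (lebT _).
  by apply/seteqP; split => x; rewrite /xsection/= inE.
rewrite ge0_integral_pushforward// preimage_setT fubini_tonelli1//=.
- exact: measurableT_comp.
Qed.

(** The recursion of [lebT] splits off the first coordinate, whereas the domain singles out the last
    one, z_n. *)
Lemma integral_lebT_rcons k (f : k.+1.-tuple Rm -> \bar R) :
  measurable_fun setT f -> (forall x, 0 <= f x) ->
  \int[@lebT R k.+1]_x f x = \int[@lebT R k]_x \int[leb]_t f (rcons_tuple x t).
Proof.
have mr j : measurable_fun setT (fun p : j.-tuple Rm * Rm => rcons_tuple p.1 p.2).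
  exact: measurable_rcons_tuple.
have mG j (g : j.+1.-tuple Rm -> \bar R) : measurable_fun setT g -> (forall x, 0 <= g x) ->
    measurable_fun setT (fun x : j.-tuple Rm => \int[leb]_t g (rcons_tuple x t)).
  move=> mg g0.
  apply: (@measurable_fun_fubini_tonelli_F _ _ _ _ _ leb
     (fun p : j.-tuple Rm * Rm => g (rcons_tuple p.1 p.2))) => //.
  exact: (measurableT_comp mg (mr j)).
elim: k f => [|k IH] f mf f0.
  rewrite integral_lebT_cons// [RHS]integral_lebT0; last exact: mG.
  apply: eq_integral => t _; rewrite integral_lebT0; last first.
    apply: (measurableT_comp mf); exact: measurable_cons_tuple.
  by congr f; exact/val_inj.
rewrite integral_lebT_cons// integral_lebT_cons; last 2 first.
- exact: mG.
- by move=> x; exact: integral_ge0.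
apply: eq_integral => t _; rewrite IH//; last first.
  by apply: (measurableT_comp mf); exact: measurable_cons_tuple.
apply: eq_integral => x _; apply: eq_integral => s _.
by congr f; exact/val_inj.
Qed.

(** The translated measure agrees with Lebesgue measure on half-open intervals, hence everywhere by
    uniqueness. *)
Lemma integral_leb_translate (f : Rm -> \bar R) (c : R) :
  measurable_fun setT f -> (forall x, 0 <= f x) ->
  \int[leb]_t f (t + c)%R = \int[leb]_t f t.
Proof.
move=> mf f0.
pose s := (fun t : Rm => (t + c)%R : Rm).
have ms : measurable_fun setT s by exact: measurable_funD.
rewrite [RHS](_ : _ = \int[pushforward leb s]_t f t); last first.
  apply: eq_measure_integral => A mA _ /=.
  apply: lebesgue_measure_unique => //= _ [[a b]] _ <-.
  rewrite /pushforward (_ : s @^-1` _ = `](a - c)%R, (b - c)%R]%classic); last first.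
    by apply/seteqP; split => x /=; rewrite !in_itv/= /s ltrBlDr lerBrDr.
  by rewrite !lebesgue_measure_itv/= !lte_fin ltrD2r -!EFinB; congr (if _ then _%:E else _); ring.
by rewrite ge0_integral_pushforward// preimage_setT.
Qed.

End lebT_measure.

Section dV_measure.
Context (R : realType) (n : nat).
Local Notation Rm := (measurableTypeR R).
Local Open Scope ereal_scope.
Local Notation leb := (@lebesgue_measure R).

HB.instance Definition _ := Measure.copy (@dV R n) (@lebT R n \x @lebT R n).
HB.instance Definition _ := Measure_isSigmaFinite.Build _ _ _ (@dV R n)
  (product_measure1_sigma_finite (@lebT R n) (@lebT R n)).

HB.instance Definition _ := Measure.copy (@dV2 R n) (@dV R n \x @dV R n).
HB.instance Definition _ := Measure_isSigmaFinite.Build _ _ _ (@dV2 R n)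
  (product_measure1_sigma_finite (@dV R n) (@dV R n)).

Lemma integral_dV (f : Cn R n -> \bar R) : measurable_fun setT f -> (forall z, 0 <= f z) ->
  \int[@dV R n]_z f z = \int[@lebT R n]_x \int[@lebT R n]_y f (x, y).
Proof. by move=> mf f0; rewrite [LHS]fubini_tonelli1. Qed.

Lemma integral_dV2 (f : Cn R n * Cn R n -> \bar R) :
  measurable_fun setT f -> (forall z, 0 <= f z) ->
  \int[@dV2 R n]_z f z = \int[@dV R n]_z \int[@dV R n]_w f (z, w).
Proof. by move=> mf f0; rewrite [LHS]fubini_tonelli1. Qed.

Lemma integral_dV2_swap (f : Cn R n * Cn R n -> \bar R) :
  measurable_fun setT f -> (forall z, 0 <= f z) ->
  \int[@dV2 R n]_z f z = \int[@dV R n]_w \int[@dV R n]_z f (z, w).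
Proof. by move=> mf f0; rewrite [LHS]fubini_tonelli2. Qed.

End dV_measure.

(** * Power integrals on the real line *)

Section real_line_integrals.
Context (R : realType).
Local Notation Rm := (measurableTypeR R).
Local Notation leb := (@lebesgue_measure R).
Implicit Types (a b D e m : R).

Lemma integral_is_derive (f F : R -> R) a b : a < b ->
  {within `[a, b], continuous f} ->
  (forall x, a <= x <= b -> is_derive x 1 F (f x)) ->
  (\int[leb]_(x in `[a, b]) (f x)%:E = (F b - F a)%:E)%E.
Proof.
move=> ab cf dF; rewrite EFinB; apply: continuous_FTC2 => //.
- have dF' x : x \in `[a, b] -> derivable F x 1.
    by rewrite in_itv/= => /dF ?; exact: ex_derive.
  have /continuous_within_itvP := derivable_within_continuous dF'.
  move=> /(_ ab)[_ Fa Fb]; split => //.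
  by move=> x xab; apply: dF'; exact: subset_itv_oo_cc xab.
- move=> x; rewrite in_itv/= => /andP[/ltW ax /ltW xb].
  by rewrite derive1E; have dFx := dF x; rewrite (@derive_val _ _ _ _ _ _ _ (dFx _)) ?ax.
Qed.

Lemma powR_within_continuous e a b : 0 < a -> {within `[a, b], continuous (fun s : R => s `^ e)}.
Proof.
move=> a0; apply: derivable_within_continuous => x; rewrite in_itv/= => /andP[ax _].
by apply: derivable_powR; rewrite in_itv/= (lt_le_trans a0).
Qed.

Lemma integral_powR e a b : 0 < a -> a < b -> e != -1 ->
  (\int[leb]_(s in `[a, b]) (s `^ e)%:E =
   ((b `^ (e + 1) - a `^ (e + 1)) / (e + 1))%:E)%E.
Proof.
move=> a0 ab e1; have e10 : e + 1 != 0 by rewrite addr_eq0.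
have -> : (b `^ (e + 1) - a `^ (e + 1)) / (e + 1) =
    b `^ (e + 1) / (e + 1) - a `^ (e + 1) / (e + 1) by rewrite mulrBl.
apply: (@integral_is_derive _ (fun s => s `^ (e + 1) / (e + 1))) => //.
  exact: powR_within_continuous.
move=> x /andP[ax _]; have x0 : 0 < x by exact: lt_le_trans ax.
have -> : x `^ e = (e + 1)^-1 *: ((e + 1) * x `^ ((e + 1) - 1)).
  by rewrite addrK /GRing.scale/= mulrA mulVf// mul1r.
have -> : (fun s : R => s `^ (e + 1) / (e + 1)) = (e + 1)^-1 \*: (fun s => s `^ (e + 1)).
  by apply/funext => s; rewrite /GRing.scale/= mulrC.
by apply: is_deriveZ; exact: is_derive1_powR.
Qed.

Lemma integral_inv a b : 0 < a -> a < b ->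
  (\int[leb]_(s in `[a, b]) (s `^ (- 1))%:E = (ln b - ln a)%:E)%E.
Proof.
move=> a0 ab; apply: integral_is_derive => //; first exact: powR_within_continuous.
move=> x /andP[ax _]; have x0 : 0 < x by exact: lt_le_trans ax.
by rewrite powR_inv1 ?ltW//; exact: is_derive1_ln.
Qed.

Lemma integral_pos_le (f : Rm -> \bar R) (B : \bar R) : measurable_fun setT f ->
  (forall s, 0 <= f s)%E ->
  (forall a b, 0 < a -> a < b -> (\int[leb]_(s in `[a, b]) f s <= B)%E) ->
  (\int[leb]_(s in `]0%R, +oo[) f s <= B)%E.
Proof.
move=> mf f0 fB.
(* The offset 2 keeps the first interval nondegenerate, as the strict inequality a < b in the
   assumption requires. *)
pose F (i : nat) : set Rm := `[i.+2%:R^-1, i.+2%:R]%classic.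
have mF i : measurable (F i) by exact: measurable_itv.
have ndF : nondecreasing_seq F.
  move=> i j ij; rewrite subsetEset => x; rewrite /F/= !in_itv/= => /andP[ix xi].
  apply/andP; split; last by rewrite (le_trans xi)// ler_nat !ltnS.
  by apply: le_trans ix; rewrite lef_pV2 ?posrE ?ltr0n// ler_nat !ltnS.
have -> : `]0%R, +oo[%classic = \bigcup_i F i.
  apply/seteqP; split => x /=; rewrite in_itv/= ?andbT.
    move=> x0; pose k := maxn (Num.bound x) (Num.bound x^-1).
    have kx y : 0 < y -> (Num.bound y <= k)%N -> y <= k.+2%:R.
      move=> y0 yk; apply: (@le_trans _ _ (Num.bound y)%:R).
        exact/ltW/archi_boundP/ltW.
      by rewrite ler_nat (leq_trans yk)// ltnW.
    exists k => //; rewrite /F/= in_itv/= kx// ?leq_maxl// andbT.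
    rewrite -[leRHS]invrK lef_pV2 ?posrE ?invr_gt0// ?ltr0n//.
    by rewrite kx// ?invr_gt0// leq_maxr.
  move=> [i _]; rewrite /F/= in_itv/= => /andP[ix _].
  by apply: lt_le_trans ix; rewrite invr_gt0.
have cv := @ge0_nondecreasing_set_cvg_integral _ Rm R F f leb ndF mF
  (fun i => measurable_funTS mf) (fun i x _ => f0 x).
rewrite -(cvg_lim _ cv)//; apply: lime_le.
  by apply/cvg_ex; eexists; exact: cv.
near=> i; apply: fB; first by rewrite invr_gt0.
by apply: (@lt_trans _ _ 1); rewrite ?invf_lt1 ?ltr0n// ltr1n.
Unshelve. all: by end_near. Qed.

Lemma measurable_powRD e D m :
  measurable_fun setT (fun s : Rm => (s `^ e * (D + s) `^ (- m))%:E).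
Proof.
apply/measurable_EFinP; apply: measurable_funM; first exact: measurable_powR.
apply: (measurableT_comp (measurable_powR _)).
exact: measurable_funD.
Qed.

(* Split at [s = D]: [(D + s)^(-m)] is at most [D^(-m)] below and [s^(-m)] above. *)
Lemma integral_powR_shift_le e m : -1 < e -> e + 1 < m ->
  exists2 C : R, 0 < C & forall D, 0 < D ->
    (\int[leb]_(s in `]0%R, +oo[) (s `^ e * (D + s) `^ (- m))%:E <=
     (C * D `^ (e + 1 - m))%:E)%E.
Proof.
move=> e1 em; have e10 : 0 < e + 1 by lra.
have me : 0 < m - e - 1 by lra.
have m0 : 0 < m by lra.
exists ((e + 1)^-1 + (m - e - 1)^-1).
  by rewrite addr_gt0// invr_gt0.
move=> D D0; apply: integral_pos_le => [|s|a b a0 ab].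
- exact: measurable_powRD.
- by rewrite lee_fin mulr_ge0// powR_ge0.
(* Enlarging [a, b] makes it straddle D strictly, so both halves of the split are genuine
   intervals. *)
pose a' := Num.min a (D / 2); pose b' := Num.max b (2 * D).
have a'0 : 0 < a' by rewrite lt_min a0 divr_gt0.
have a'D : a' < D by rewrite gt_min ltr_pdivrMr// ltr_pMr// ltr1n orbT.
have Db' : D < b' by rewrite lt_max mulrC ltr_pMr// ltr1n orbT.
have f0 s : (0 <= (s `^ e * (D + s) `^ (- m))%:E)%E by rewrite lee_fin mulr_ge0// powR_ge0.
have mf := @measurable_powRD e D m.
apply: (@le_trans _ _ (\int[leb]_(s in `[a', D] `|` `]D, b']) (s `^ e * (D + s) `^ (- m))%:E)%E).
  apply: ge0_subset_integral => //.
  - exact: measurableU.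
  - exact: measurable_funTS.
  - move=> s /=; rewrite !in_itv/= => /andP[as_ sb].
    have [sD|Ds] := leP s D; [left|right] => //.
      by rewrite andbT ge_min as_.
    by rewrite le_max sb.
rewrite ge0_integral_setU//=; last 2 first.
- exact: measurable_funTS.
- rewrite disj_set2E; apply/eqP/seteqP; split => // s [] /=.
  by rewrite !in_itv/= => /andP[_ sD] /andP[Ds _]; move: Ds; rewrite ltNge sD.
rewrite mulrDl EFinD; apply: leeD.
- apply: (@le_trans _ _ (\int[leb]_(s in `[a', D]) ((D `^ (- m))%:E * (s `^ e)%:E))%E).
    apply: ge0_le_integral_nomeas => // s /=; rewrite in_itv/= => /andP[as_ sD].
    have s0 : 0 < s by exact: lt_le_trans as_.
    rewrite -EFinM lee_fin mulrC ler_wpM2r ?powR_ge0//.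
    rewrite !powRN lef_pV2 ?posrE ?powR_gt0 ?addr_gt0//.
    by apply: ge0_ler_powR; rewrite ?nnegrE ?(ltW m0) ?(ltW D0) ?lerDl ?(ltW s0) ?addr_ge0 ?(ltW D0) ?(ltW s0).
  rewrite ge0_integralZl//; last 3 first.
  - by apply/measurable_EFinP; apply: measurable_funTS; exact: measurable_powR.
  - by move=> s _; rewrite lee_fin powR_ge0.
  - by rewrite lee_fin powR_ge0.
  rewrite integral_powR//; last by rewrite gt_eqF.
  rewrite -EFinM lee_fin mulrCA [X in X <= _]mulrA [X in X <= _]mulrC ler_wpM2l ?invr_ge0 ?(ltW e10)//.
  rewrite [X in X <= _]mulrC mulrBr lerBlDr.
  have -> : D `^ (- m) * D `^ (e + 1) = D `^ (e + 1 - m).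
    by rewrite -powRD ?(gt_eqF D0) ?implybT// addrC.
  by rewrite lerDl mulr_ge0// powR_ge0.
- apply: (@le_trans _ _ (\int[leb]_(s in `[D, b']) ((s `^ (e - m))%:E))%E).
    apply: (@le_trans _ _ (\int[leb]_(s in `[D, b']) (s `^ e * (D + s) `^ (- m))%:E)%E).
      apply: ge0_subset_integral => //; first exact: measurable_funTS.
      exact: subset_itv_oc_cc.
    apply: ge0_le_integral_nomeas => // s /=; rewrite in_itv/= => /andP[Ds sb].
    have s0 : 0 < s by exact: lt_le_trans Ds.
    rewrite lee_fin powRD ?(gt_eqF s0) ?implybT// ler_wpM2l ?powR_ge0//.
    rewrite !powRN lef_pV2 ?posrE ?powR_gt0 ?addr_gt0//.
    by apply: ge0_ler_powR; rewrite ?nnegrE ?(ltW m0) ?(ltW s0) ?lerDr ?(ltW D0) ?addr_ge0 ?(ltW D0) ?(ltW s0).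
  rewrite integral_powR//; last by rewrite lt_eqF// ltrBlDr; lra.
  rewrite lee_fin.
  have -> : e - m + 1 = - (m - e - 1) by ring.
  have -> : e + 1 - m = - (m - e - 1) by ring.
  rewrite invrN mulrN -mulNr opprB mulrC ler_wpM2l ?invr_ge0 ?(ltW me)//.
  by rewrite lerBlDr lerDl powR_ge0.
Qed.

Lemma integral_powR_abs_le r : 1 < r ->
  exists2 C : R, 0 < C & forall D c, 0 < D ->
    (\int[leb]_t ((D + `|t + c|) `^ (- r))%:E <= (C * D `^ (1 - r))%:E)%E.
Proof.
move=> r1; have [||C C0 HC] := @integral_powR_shift_le 0 r; [lra|lra|].
exists (2 * C); first by rewrite mulr_gt0.
move=> D c D0.
have mf : measurable_fun setT (fun t : Rm => ((D + `|t|) `^ (- r))%:E).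
  apply/measurable_EFinP; apply: (measurableT_comp (measurable_powR _)).
  by apply: measurable_funD => //; exact: measurableT_comp.
have f0 (t : Rm) : (0 <= ((D + `|t|) `^ (- r))%:E)%E by rewrite lee_fin powR_ge0.
rewrite (@integral_leb_translate R (fun t => ((D + `|t|) `^ (- r))%:E) c)//.
have -> : [set: Rm] = `]-oo, 0%R] `|` `]0%R, +oo[ :> set Rm.
  apply/seteqP; split => // t _ /=; rewrite !in_itv/= andbT.
  by have [|] := leP t 0; [left|right].
rewrite ge0_integral_setU//=; last 2 first.
- exact: measurable_funTS.
- rewrite disj_set2E; apply/eqP/seteqP; split => // s [] /=.
  by rewrite !in_itv/= andbT => ts st; move: st; rewrite ltNge ts.
have H : (\int[leb]_(t in `]0%R, +oo[) ((D + `|t|) `^ (- r))%:E <= (C * D `^ (1 - r))%:E)%E.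
  rewrite (eq_integral (fun s : Rm => (s `^ 0 * (D + s) `^ (- r))%:E)).
    by have := HC D D0; rewrite add0r.
  move=> s; rewrite inE/= in_itv/= andbT => s0.
  by rewrite powRr0 mul1r gtr0_norm.
have -> : (\int[leb]_(t in `]-oo, 0%R]) ((D + `|t|) `^ (- r))%:E =
           \int[leb]_(t in `]0%R, +oo[) ((D + `|t|) `^ (- r))%:E)%E.
  rewrite integral_itv_obnd_cbnd; last exact: measurable_funTS.
  rewrite ge0_integration_by_substitution0//.
  by apply: eq_integral => t _; rewrite normrN.
by rewrite -mulrA mulr_natl mulr2n EFinD leeD.
Qed.

(** With d = sqrt D, (d + |t|)^2 <= 2 (d^2 + t^2), which reduces the claim to the linear case with
    exponent 2k and costs the factor 2^k. *)
Lemma integral_powR_sqr_le k : 2^-1 < k ->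
  exists2 C : R, 0 < C & forall D c, 0 < D ->
    (\int[leb]_t ((D + (t + c) ^+ 2) `^ (- k))%:E <= (C * D `^ (2^-1 - k))%:E)%E.
Proof.
move=> k1; have [|C C0 HC] := @integral_powR_abs_le (2 * k); first lra.
have k0 : 0 < k by lra.
exists (2 `^ k * C); first by rewrite mulr_gt0// powR_gt0.
move=> D c D0; pose d := Num.sqrt D.
have d0 : 0 < d by rewrite sqrtr_gt0.
have dD : d ^+ 2 = D by rewrite sqr_sqrtr// ltW.
apply: (@le_trans _ _ (\int[leb]_t ((2 `^ k)%:E * ((d + `|t + c|) `^ (- (2 * k)))%:E))%E).
  apply: ge0_le_integral_nomeas => t _; first by rewrite lee_fin powR_ge0.
  have p0 : 0 < D + (t + c) ^+ 2 by rewrite ltr_wpDr// sqr_ge0.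
  have p1 : 0 < d + `|t + c| by rewrite ltr_wpDr.
  rewrite -EFinM lee_fin -mulrN powRrM.
  have -> : (d + `|t + c|) `^ 2 = (d + `|t + c|) ^+ 2 by rewrite -powR_mulrn// ltW.
  rewrite !powRN -[leRHS]invrK invrM ?unitfE ?gt_eqF ?invr_gt0 ?powR_gt0 ?exprn_gt0//.
  rewrite invrK lef_pV2 ?posrE ?mulr_gt0 ?invr_gt0 ?powR_gt0 ?exprn_gt0//.
  rewrite ler_pdivrMr ?powR_gt0// -powRM ?(ltW p0)//.
  apply: ge0_ler_powR; rewrite ?nnegrE ?(ltW k0)//.
  - by rewrite exprn_ge0// ltW.
  - by rewrite mulr_ge0// ltW.
  have -> : (t + c) ^+ 2 = `|t + c| ^+ 2 by rewrite real_normK ?num_real.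
  rewrite -dD; have := sqr_ge0 (d - `|t + c|); nra.
rewrite ge0_integralZl ?lee_fin ?powR_ge0//; last 2 first.
- apply/measurable_EFinP; apply: (measurableT_comp (measurable_powR _)).
  apply: measurable_funD => //; apply: measurableT_comp => //; exact: measurable_funD.
- by move=> t _; rewrite lee_fin powR_ge0.
rewrite -mulrA EFinM; apply: lee_wpmul2l; first by rewrite lee_fin powR_ge0.
apply: le_trans (HC d c d0) _; rewrite lee_fin.
rewrite [X in _ * X <= _](_ : _ = D `^ (2^-1 - k))//.
rewrite -dD -powR_mulrn ?ltW// -powRrM; congr (_ `^ _).
by field.
Qed.

End real_line_integrals.

(** * Coordinates adapted to the height rho *)

Section coordinates.
Context (R : realType) (m : nat).
Local Notation Rm := (measurableTypeR R).
Local Notation leb := (@lebesgue_measure R).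
Local Notation n := m.+1.
Local Notation Cm := (Cn R n).

Definition sqn (y : m.-tuple Rm) : R := \sum_(j < m) (nth 0 (y : seq R) j) ^+ 2.

(** The last imaginary coordinate is sheared by |y'|^2, so that s is the height rho and T_B becomes
    the half-space s > 0. *)
Definition coord (x : m.-tuple Rm) (t : Rm) (y : m.-tuple Rm) (s : Rm) : Cm :=
  (rcons_tuple x t, rcons_tuple y (s + sqn y)).

Lemma measurable_xc j : measurable_fun setT (fun z : Cm => xc z j : Rm).
Proof. exact: (measurableT_comp (@measurable_nth_tuple R n j) measurable_fst). Qed.

Lemma measurable_yc j : measurable_fun setT (fun z : Cm => yc z j : Rm).
Proof. exact: (measurableT_comp (@measurable_nth_tuple R n j) measurable_snd). Qed.

Lemma measurable_rho : measurable_fun setT (fun z : Cm => rho z : Rm).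
Proof.
apply: measurable_funB; first exact: measurable_yc.
by apply: measurable_sum => j; apply: measurable_funX; exact: measurable_yc.
Qed.

Lemma measurable_sqn : measurable_fun setT (sqn : _ -> Rm).
Proof.
by apply: measurable_sum => j; apply: measurable_funX; exact: measurable_nth_tuple.
Qed.

Lemma TBE : @TB R n = [set z | 0 < rho z].
Proof. by apply/seteqP; split => z /=; rewrite /TB /Bcone/= /rho subr_gt0. Qed.

Lemma measurable_TB : measurable (@TB R n).
Proof.
rewrite TBE -[X in measurable X]setTI.
have := measurable_rho measurableT (measurable_itv `]0, +oo[).
by congr measurable; apply/seteqP; split => z /=; rewrite in_itv/= andbT.
Qed.

Lemma measurable_coord d (T : measurableType d) (x y : T -> m.-tuple Rm) (t s : T -> Rm) :
  measurable_fun setT x -> measurable_fun setT t ->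
  measurable_fun setT y -> measurable_fun setT s ->
  measurable_fun setT (fun p => coord (x p) (t p) (y p) (s p)).
Proof.
move=> mx mt my ms; apply/measurable_fun_pairP; split.
  exact: measurable_rcons_tuple.
apply: measurable_rcons_tuple => //; apply: measurable_funD => //.
exact: (measurableT_comp measurable_sqn my).
Qed.

Lemma xc_coord x t y s j : (j < m)%N -> xc (coord x t y s) j = nth 0 (x : seq R) j.
Proof. by move=> jm; rewrite /xc/= nth_rcons size_tuple jm. Qed.

Lemma yc_coord x t y s j : (j < m)%N -> yc (coord x t y s) j = nth 0 (y : seq R) j.
Proof. by move=> jm; rewrite /yc/= nth_rcons size_tuple jm. Qed.

Lemma xc_coord_last x t y s : xc (coord x t y s) m = t.
Proof. by rewrite /xc/= nth_rcons size_tuple ltnn eqxx. Qed.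

Lemma rho_coord x t y s : rho (coord x t y s) = s.
Proof.
rewrite /rho [X in X - _](_ : _ = s + sqn y); last first.
  by rewrite /yc/= nth_rcons size_tuple ltnn eqxx.
rewrite (eq_bigr (fun j : 'I_m => (nth 0 (y : seq R) j) ^+ 2)) ?addrK//.
by move=> j _; rewrite yc_coord.
Qed.

Local Open Scope ereal_scope.

(** For fixed y' the shear is a translation in y_n, hence preserves the measure. The variable t is
    innermost because, once the other variables are fixed, the kernel will be bounded through one
    translated absolute value of t. *)
Lemma integral_dV_coord (f : Cm -> \bar R) :
  measurable_fun setT f -> (forall z, 0 <= f z) ->
  \int[@dV R n]_z f z = \int[@lebT R m]_x \int[@lebT R m]_y \int[leb]_s \int[leb]_t
    f (coord x t y s).
Proof.
move=> mf f0; rewrite integral_dV// integral_lebT_rcons; last 2 first.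
- exact: (@measurable_fun_fubini_tonelli_F _ _ _ _ _ (@lebT R n) f).
- by move=> x; exact: integral_ge0.
apply: eq_integral => x _.
transitivity (\int[leb]_t \int[@lebT R m]_y \int[leb]_s f (coord x t y s)).
  apply: eq_integral => t _; rewrite integral_lebT_rcons//; last first.
    by apply: (measurableT_comp mf); exact: measurable_fun_pair.
  apply: eq_integral => y _.
  rewrite -(@integral_leb_translate R (fun s => f (rcons_tuple x t, rcons_tuple y s)) (sqn y))//.
  apply: (measurableT_comp mf); apply: measurable_fun_pair => //.
  exact: measurable_rcons_tuple.
pose h := fun p : Rm * m.-tuple Rm => \int[leb]_s f (coord x p.1 p.2 s).
have mh : measurable_fun setT h.
  apply: (@measurable_fun_fubini_tonelli_F _ _ _ _ _ leb
    (fun p : (Rm * m.-tuple Rm) * Rm => f (coord x p.1.1 p.1.2 p.2))) => //.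
  apply: (measurableT_comp mf); apply: measurable_coord => //.
  - exact: (measurableT_comp measurable_fst measurable_fst).
  - exact: (measurableT_comp measurable_snd measurable_fst).
have h0 p : 0 <= h p by exact: integral_ge0.
transitivity (\int[@lebT R m]_y \int[leb]_t h (t, y)); first exact: (fubini_tonelli h mh h0).
apply: eq_integral => y _.
pose g := fun p : Rm * Rm => f (coord x p.1 y p.2).
have mg : measurable_fun setT g.
  by apply: (measurableT_comp mf); exact: measurable_coord.
exact: (@fubini_tonelli _ _ _ _ _ leb leb g mg (fun p => f0 _)).
Qed.

End coordinates.

(** * Negative powers of D plus a sum of squares *)

Section quadratic_integral.
Context (R : realType).
Local Notation Rm := (measurableTypeR R).

Definition qsum k (a : nat -> R) (x : k.-tuple Rm) : R :=
  \sum_(j < k) (nth 0 (x : seq R) j + a j) ^+ 2.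

Lemma qsum_ge0 k a (x : k.-tuple Rm) : 0 <= qsum a x.
Proof. by apply: sumr_ge0 => j _; exact: sqr_ge0. Qed.

Lemma measurable_qsum k a : measurable_fun setT (@qsum k a : _ -> Rm).
Proof.
apply: measurable_sum => j; apply: measurable_funX; apply: measurable_funD => //.
exact: measurable_nth_tuple.
Qed.

(** The first coordinate t is split off and D + (t + a 0)^2 plays the role of D in the induction
    hypothesis, which therefore has to be uniform in D and in the shifts [a]. *)
Lemma integral_qsum_le k (e : R) : k%:R / 2 < e ->
  exists2 C : R, 0 < C & forall D (a : nat -> R), 0 < D ->
    (\int[@lebT R k]_x ((D + qsum a x) `^ (- e))%:E <= (C * D `^ (k%:R / 2 - e))%:E)%E.
Proof.
elim: k e => [|k IH] e ke.
  exists 1 => // D a D0; rewrite integral_lebT0; last first.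
    apply/measurable_EFinP; apply: (measurableT_comp (measurable_powR _)).
    by apply: measurable_funD => //; exact: measurable_qsum.
  by rewrite /qsum big_ord0 addr0 mul0r add0r mul1r.
have ke' : k.+1%:R / 2 = k%:R / 2 + 2^-1 :> R by rewrite -natr1 mulrDl mul1r.
have [|C1 C10 H1] := IH e.
  by apply: le_lt_trans ke; rewrite ke' lerDl invr_ge0.
have [|C2 C20 H2] := @integral_powR_sqr_le R (e - k%:R / 2).
  by rewrite ltrBrDr addrC -ke'.
exists (C1 * C2); first exact: mulr_gt0.
move=> D a D0; rewrite integral_lebT_cons; last 2 first.
- apply/measurable_EFinP; apply: (measurableT_comp (measurable_powR _)).
  by apply: measurable_funD => //; exact: measurable_qsum.
- by move=> x; rewrite lee_fin powR_ge0.
apply: (@le_trans _ _ (\int[@lebesgue_measure R]_t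
   (C1%:E * ((D + (t + a 0%N) ^+ 2) `^ (- (e - k%:R / 2)))%:E))%E).
  apply: ge0_le_integral_nomeas => t _.
    by apply: integral_ge0 => x _; rewrite lee_fin powR_ge0.
  have D1 : 0 < D + (t + a 0%N) ^+ 2 by rewrite ltr_wpDr// sqr_ge0.
  rewrite -EFinM opprB; apply: le_trans (H1 _ (fun j => a j.+1) D1).
  apply: ge0_le_integral_nomeas => x _; first by rewrite lee_fin powR_ge0.
  by rewrite /qsum big_ord_recl/= addrA.
rewrite ge0_integralZl ?lee_fin ?(ltW C10)//; last 2 first.
- apply/measurable_EFinP; apply: (measurableT_comp (measurable_powR _)).
  by apply: measurable_funD => //; apply: measurable_funX; exact: measurable_funD.
- by move=> t _; rewrite lee_fin powR_ge0.
rewrite -mulrA EFinM; apply: lee_wpmul2l; first by rewrite lee_fin ltW.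
apply: le_trans (H2 D (a 0%N) D0) _; rewrite lee_fin.
by rewrite ke' opprB addrA [2^-1 + _]addrC.
Qed.

End quadratic_integral.

(** * The kernel rho(z,u) and the Forelli-Rudin estimate *)

Section complex_modulus.
Context (R : realType).
Implicit Types w : R[i].

Lemma sum_complex (I : Type) (r : seq I) (P : pred I) (a b : I -> R) :
  \sum_(i <- r | P i) (a i +i* b i) =
  (\sum_(i <- r | P i) a i) +i* (\sum_(i <- r | P i) b i) :> R[i].
Proof. by elim/big_rec3: _ => // i x y z _ ->. Qed.

Lemma cmod_ge0 w : 0 <= cmod w.
Proof. exact: sqrtr_ge0. Qed.

Lemma cmod_ge_half w : (`|complex.Re w| + `|complex.Im w|) / 2 <= cmod w.
Proof.
rewrite -[leLHS]ger0_norm; last by rewrite divr_ge0// addr_ge0.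
rewrite -sqrtr_sqr ler_wsqrtr// -[complex.Re w ^+ 2]real_normK ?num_real//.
rewrite -[complex.Im w ^+ 2]real_normK ?num_real//.
have := sqr_ge0 (`|complex.Re w| - `|complex.Im w|).
have := sqr_ge0 (`|complex.Re w|); have := sqr_ge0 (`|complex.Im w|).
by rewrite !expr2; lra.
Qed.

Lemma Re_le_cmod w : `|complex.Re w| <= cmod w.
Proof. by rewrite -sqrtr_sqr ler_wsqrtr// lerDl sqr_ge0. Qed.

Lemma Im_le_cmod w : `|complex.Im w| <= cmod w.
Proof. by rewrite -sqrtr_sqr ler_wsqrtr// lerDr sqr_ge0. Qed.

Lemma cmod_le w : cmod w <= `|complex.Re w| + `|complex.Im w|.
Proof.
rewrite -[leRHS]ger0_norm ?addr_ge0// -sqrtr_sqr ler_wsqrtr//.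
rewrite -[complex.Re w ^+ 2]real_normK ?num_real//.
rewrite -[complex.Im w ^+ 2]real_normK ?num_real// sqrrD.
by rewrite lerD2r lerDl mulrn_wge0// mulr_ge0.
Qed.

End complex_modulus.

(** * Real and imaginary parts of rho(z,u) *)

Section rho2_geometry.
Context (R : realType) (m : nat).
Local Notation Rm := (measurableTypeR R).
Local Notation leb := (@lebesgue_measure R).
Local Notation n := m.+1.
Local Notation Cm := (Cn R n).
Implicit Types z u : Cm.

(** The parallelogram law turns 2 (Im z_n + Im u_n) - |Im z' + Im u'|^2 into 2 rho(z) + 2 rho(u) +
    |Im z' - Im u'|^2, a sum of nonnegative terms on T_B. *)
Lemma rho2E z u : rho2 z u =
  ((2 * rho z + 2 * rho u + \sum_(j < m) (xc u j - xc z j) ^+ 2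
     + \sum_(j < m) (yc u j - yc z j) ^+ 2) / 4) +i*
  ((2 * (xc u m - xc z m)
     - 2 * \sum_(j < m) (xc u j - xc z j) * (yc u j + yc z j)) / 4).
Proof.
rewrite /rho2 /= (eq_bigr (fun j : 'I_m =>
   ((xc z j - xc u j) ^+ 2 - (yc z j + yc u j) ^+ 2) +i*
   (2 * ((xc z j - xc u j) * (yc z j + yc u j))))); last first.
  move=> j _; rewrite /zc expr2; simpc; apply/eqP; rewrite eq_complex/=.
  by apply/andP; split; apply/eqP; ring.
rewrite sum_complex -(rmorph_nat (@real_complex R) 4) -(rmorph_nat (@real_complex R) 2).
rewrite /zc; simpc; have -> : 4 / (4 ^+ 2 + 0 ^+ 2) = 4^-1 :> R by field.
have E1 : \sum_(j < m) ((xc z j - xc u j) ^+ 2 - (yc z j + yc u j) ^+ 2) =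
  \sum_(j < m) (xc u j - xc z j) ^+ 2 + \sum_(j < m) (yc u j - yc z j) ^+ 2
  - 2 * \sum_(j < m) yc z j ^+ 2 - 2 * \sum_(j < m) yc u j ^+ 2.
  rewrite !mulr_sumr -!sumrN -!big_split/=; apply: eq_bigr => j _; ring.
have E2 : \sum_(j < m) (2 * ((xc z j - xc u j) * (yc z j + yc u j))) =
  - (2 * \sum_(j < m) (xc u j - xc z j) * (yc u j + yc z j)).
  rewrite mulr_sumr -sumrN; apply: eq_bigr => j _; ring.
apply/eqP; rewrite eq_complex/= E1 E2 /rho/=.
by apply/andP; split; apply/eqP; ring.
Qed.

Lemma measurable_rho2_Re : measurable_fun setT (fun v : Cm * Cm => complex.Re (rho2 v.1 v.2) : Rm).
Proof.
under eq_fun do rewrite rho2E/=.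
have mx1 j : measurable_fun setT (fun v : Cm * Cm => xc v.1 j : Rm).
  exact: (measurableT_comp (measurable_xc j) measurable_fst).
have mx2 j : measurable_fun setT (fun v : Cm * Cm => xc v.2 j : Rm).
  exact: (measurableT_comp (measurable_xc j) measurable_snd).
have my1 j : measurable_fun setT (fun v : Cm * Cm => yc v.1 j : Rm).
  exact: (measurableT_comp (measurable_yc j) measurable_fst).
have my2 j : measurable_fun setT (fun v : Cm * Cm => yc v.2 j : Rm).
  exact: (measurableT_comp (measurable_yc j) measurable_snd).
have mr1 : measurable_fun setT (fun v : Cm * Cm => rho v.1 : Rm).
  exact: (measurableT_comp (@measurable_rho R m) measurable_fst).
have mr2 : measurable_fun setT (fun v : Cm * Cm => rho v.2 : Rm).
  exact: (measurableT_comp (@measurable_rho R m) measurable_snd).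
apply: measurable_funM => //; do ! apply: measurable_funD => //.
- exact: measurable_funM.
- exact: measurable_funM.
- by apply: measurable_sum => j; apply: measurable_funX; apply: measurable_funB;
    [exact: mx2|exact: mx1].
- by apply: measurable_sum => j; apply: measurable_funX; apply: measurable_funB;
    [exact: my2|exact: my1].
Qed.

Lemma measurable_rho2_Im : measurable_fun setT (fun v : Cm * Cm => complex.Im (rho2 v.1 v.2) : Rm).
Proof.
under eq_fun do rewrite rho2E/=.
have mx1 j : measurable_fun setT (fun v : Cm * Cm => xc v.1 j : Rm).
  exact: (measurableT_comp (measurable_xc j) measurable_fst).
have mx2 j : measurable_fun setT (fun v : Cm * Cm => xc v.2 j : Rm).
  exact: (measurableT_comp (measurable_xc j) measurable_snd).
have my1 j : measurable_fun setT (fun v : Cm * Cm => yc v.1 j : Rm).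
  exact: (measurableT_comp (measurable_yc j) measurable_fst).
have my2 j : measurable_fun setT (fun v : Cm * Cm => yc v.2 j : Rm).
  exact: (measurableT_comp (measurable_yc j) measurable_snd).
apply: measurable_funM => //; apply: measurable_funB => //; apply: measurable_funM => //.
- by apply: measurable_funB; [exact: mx2|exact: mx1].
- apply: measurable_sum => j; apply: measurable_funM.
  + by apply: measurable_funB; [exact: mx2|exact: mx1].
  + by apply: measurable_funD; [exact: my2|exact: my1].
Qed.

Definition kmod (z u : Cm) : R := cmod (rho2 z u).

Lemma kmodC z u : kmod z u = kmod u z.
Proof.
rewrite /kmod /cmod !rho2E/=; congr Num.sqrt; congr (_ ^+ 2 + _).
  have -> : \sum_(j < m) (xc u j - xc z j) ^+ 2 = \sum_(j < m) (xc z j - xc u j) ^+ 2.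
    by apply: eq_bigr => j _; rewrite -sqrrN opprB.
  have -> : \sum_(j < m) (yc u j - yc z j) ^+ 2 = \sum_(j < m) (yc z j - yc u j) ^+ 2.
    by apply: eq_bigr => j _; rewrite -sqrrN opprB.
  by rewrite [2 * rho z + _]addrC.
have -> : \sum_(j < m) (xc u j - xc z j) * (yc u j + yc z j) =
    - \sum_(j < m) (xc z j - xc u j) * (yc z j + yc u j).
  by rewrite -sumrN; apply: eq_bigr => j _; ring.
by rewrite -[in RHS]sqrrN; congr (_ ^+ 2); ring.
Qed.

Lemma measurable_kmod : measurable_fun setT (fun v : Cm * Cm => kmod v.1 v.2 : Rm).
Proof.
apply: (measurableT_comp (continuous_measurable_fun (@sqrt_continuous R))).
by apply: measurable_funD; apply: measurable_funX;
  [exact: measurable_rho2_Re|exact: measurable_rho2_Im].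
Qed.

Lemma measurable_kmod_l z : measurable_fun setT (kmod z : _ -> Rm).
Proof.
exact: (measurableT_comp measurable_kmod (pair1_measurable z)).
Qed.

Lemma kmod_gt0 z u : 0 < rho z -> 0 < rho u -> 0 < kmod z u.
Proof.
move=> z0 u0; apply: lt_le_trans (Re_le_cmod _); rewrite rho2E/= normr_gt0 gt_eqF//.
rewrite divr_gt0// !ltr_wpDr// ?sumr_ge0//; try by move=> j _; exact: sqr_ge0.
- by rewrite mulr_ge0// ltW.
- by rewrite mulr_gt0.
Qed.

(** Extending the weight by zero absorbs the domain T_B into the integrand, so that Tonelli, Jensen
    and Minkowski are applied on the whole space. *)
Definition wgt (e : R) (z : Cm) : R := if 0 < rho z then rho z `^ e else 0.

Lemma wgt_pos e z : 0 < rho z -> wgt e z = rho z `^ e.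
Proof. by rewrite /wgt => ->. Qed.

Lemma wgt_ge0 e z : 0 <= wgt e z.
Proof. by rewrite /wgt; case: ifP => // _; exact: powR_ge0. Qed.

Lemma wgt_gt0 e z : 0 < rho z -> 0 < wgt e z.
Proof. by move=> z0; rewrite wgt_pos// powR_gt0. Qed.

Lemma wgtD a b z : wgt (a + b) z = wgt a z * wgt b z.
Proof.
rewrite /wgt; case: ifPn => [z0|_]; last by rewrite mulr0.
by rewrite powRD// (gt_eqF z0) implybT.
Qed.

Lemma wgt_powR a p z : p != 0 -> (wgt a z) `^ p = wgt (a * p) z.
Proof. by move=> p0; rewrite /wgt; case: ifPn => _; [rewrite powRrM|rewrite powR0]. Qed.

Lemma measurable_wgt e : measurable_fun setT (wgt e : _ -> Rm).
Proof.
have -> : wgt e = (fun z => rho z `^ e * \1_(@TB R n) z).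
  apply/funext => z; rewrite /wgt indicE TBE; case: ifPn => z0.
    by rewrite mem_set ?mulr1.
  by rewrite memNset ?mulr0//; exact/negP.
apply: measurable_funM.
  exact: (measurableT_comp (measurable_powR e) (@measurable_rho R m)).
exact: measurable_indic (@measurable_TB R m).
Qed.

(** For fixed x, y, s the imaginary part is affine in t with slope 1/2, and c is the translation
    that centres it. Replacing the modulus by half of |Re| + |Im| gives an additive bracket whose
    variables can be integrated one at a time; 8 is 2 times the 4 in rho(z,u). *)
Lemma kmod_coord_ge w x y s : 0 < rho w -> 0 < s ->
  exists c : R, forall t, (rho w + qsum (fun j => - xc w j) x + qsum (fun j => - yc w j) y + s
                   + `|t + c|) / 8 <= kmod w (coord x t y s).
Proof.
move=> w0 s0; exists (- xc w m - \sum_(j < m) (nth 0 (x : seq R) j - xc w j) *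
    (nth 0 (y : seq R) j + yc w j)) => t.
apply: le_trans (cmod_ge_half _); rewrite rho2E/= rho_coord xc_coord_last.
have -> : \sum_(j < m) (xc (coord x t y s) j - xc w j) ^+ 2 = qsum (fun j => - xc w j) x.
  by apply: eq_bigr => j _; rewrite xc_coord.
have -> : \sum_(j < m) (yc (coord x t y s) j - yc w j) ^+ 2 = qsum (fun j => - yc w j) y.
  by apply: eq_bigr => j _; rewrite yc_coord.
have -> : \sum_(j < m) (xc (coord x t y s) j - xc w j) * (yc (coord x t y s) j + yc w j) =
   \sum_(j < m) (nth 0 (x : seq R) j - xc w j) * (nth 0 (y : seq R) j + yc w j).
  by apply: eq_bigr => j _; rewrite xc_coord// yc_coord.
set A := qsum _ x; set B := qsum _ y; set S := \sum_(j < m) _.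
have A0 : 0 <= A by exact: qsum_ge0.
have B0 : 0 <= B by exact: qsum_ge0.
have -> : (2 * (t - xc w m) - 2 * S) / 4 = (t + (- xc w m - S)) / 2 by field.
have -> : `|(t + (- xc w m - S)) / 2| = `|t + (- xc w m - S)| / 2.
  by rewrite normrM (ger0_norm (_ : 0 <= 2^-1)) ?invr_ge0.
rewrite [X in _ <= (X + _) / 2]ger0_norm; last by rewrite divr_ge0// !addr_ge0// mulr_ge0// ltW.
have := normr_ge0 (t + (- xc w m - S)).
by set N := `|_|; lra.
Qed.

(* Integrating [t] first costs one power of the bracket, [s] costs [e + 1] and each
   of the 2m remaining real variables costs 1/2. *)
Lemma forelli_rudin e r : -1 < e -> n%:R + 1 + e < r ->
  exists2 C : R, 0 < C & forall w, 0 < rho w ->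
    (\int[@dV R n]_u (wgt e u * kmod w u `^ (- r))%:E <= (C * rho w `^ (n%:R + 1 + e - r))%:E)%E.
Proof.
move=> e1 er; have mn : n%:R = m%:R + 1 :> R by rewrite natr1.
have m0 : 0 <= m%:R :> R by [].
have r0 : 0 < r by lra.
have [|C1 C10 H1] := @integral_powR_abs_le R r; first lra.
have [||C2 C20 H2] := @integral_powR_shift_le R e (r - 1); [lra|lra|].
have [|C3 C30 H3] := @integral_qsum_le R m (r - 1 - (e + 1)); first lra.
have [|C4 C40 H4] := @integral_qsum_le R m (r - 1 - (e + 1) - m%:R / 2); first lra.
exists (8 `^ r * C1 * C2 * C3 * C4).
  by rewrite !mulr_gt0// powR_gt0.
move=> w w0.
have mk : measurable_fun setT (fun u => (wgt e u * kmod w u `^ (- r))%:E).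
  apply/measurable_EFinP; apply: measurable_funM; first exact: measurable_wgt.
  apply: (measurableT_comp (measurable_powR _)).
  exact: measurable_kmod_l.
have k0 u : (0 <= (wgt e u * kmod w u `^ (- r))%:E)%E.
  by rewrite lee_fin mulr_ge0 ?wgt_ge0 ?powR_ge0.
rewrite integral_dV_coord//.
(* [B] is what remains of the bracket once t and s are integrated out, [A] what remains once y is
   integrated out too. *)
pose A x := rho w + @qsum R m (fun j => - xc w j) x.
have A0 x : 0 < A x by rewrite ltr_wpDr ?qsum_ge0.
pose B x y := A x + @qsum R m (fun j => - yc w j) y.
have B0 x y : 0 < B x y by rewrite ltr_wpDr ?qsum_ge0 ?A0.
have St x y s : (\int[leb]_t (wgt e (coord x t y s) * kmod w (coord x t y s) `^ (- r))%:E <=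
   ((8 `^ r * C1)%:E * ((fun s : Rm => (s `^ e * (B x y + s) `^ (- (r - 1)))%:E) \_ `]0%R, +oo[) s)%E)%E.
  rewrite /patch; case: ifPn; rewrite mem_setE/= in_itv/= andbT; last first.
    move=> s0; rewrite mule0 integral0_eq// => t _.
    by rewrite /wgt rho_coord (negbTE s0) mul0r.
  move=> s0; have [c Hc] := kmod_coord_ge x y w0 s0.
  have Bs : 0 < B x y + s by rewrite addr_gt0.
  apply: (@le_trans _ _ (\int[leb]_t ((s `^ e * 8 `^ r)%:E *
      ((B x y + s + `|t + c|) `^ (- r))%:E))%E).
    apply: ge0_le_integral_nomeas => t _; first exact: k0.
    have p0 : 0 < B x y + s + `|t + c| by rewrite ltr_wpDr.
    rewrite wgt_pos rho_coord// -EFinM lee_fin -mulrA ler_wpM2l ?powR_ge0//.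
    have -> : 8 `^ r = (8^-1) `^ (- r) by rewrite -powR_inv1// -powRrM mulrNN mul1r.
    rewrite -powRM ?invr_ge0 ?(ltW p0)//.
    rewrite !powRN lef_pV2 ?posrE ?powR_gt0//; last 2 first.
    - by apply: lt_le_trans (Hc t); rewrite divr_gt0.
    - by rewrite mulr_gt0.
    apply: ge0_ler_powR; rewrite ?nnegrE ?(ltW r0)//.
    - by rewrite mulr_ge0// ltW.
    - exact: sqrtr_ge0.
    - by rewrite mulrC; exact: Hc.
  rewrite ge0_integralZl ?lee_fin ?mulr_ge0 ?powR_ge0//; last 2 first.
  - apply/measurable_EFinP; apply: (measurableT_comp (measurable_powR _)).
    apply: measurable_funD => //; apply: measurableT_comp => //; exact: measurable_funD.
  - by move=> t _; rewrite lee_fin powR_ge0.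
  apply: le_trans (lee_wpmul2l _ (H1 _ c Bs)) _; first by rewrite lee_fin mulr_ge0 ?powR_ge0.
  by rewrite -!EFinM lee_fin opprB -subr_ge0 le_eqVlt; apply/orP; left; apply/eqP; ring.
have Ss x y : (\int[leb]_s \int[leb]_t (wgt e (coord x t y s) * kmod w (coord x t y s) `^ (- r))%:E <=
   (8 `^ r * C1 * C2)%:E * (B x y `^ (- (r - 1 - (e + 1))))%:E)%E.
  apply: le_trans.
    apply: ge0_le_integral_nomeas; last by move=> s _; exact: St.
    by move=> s _; apply: integral_ge0 => t _; exact: k0.
  rewrite ge0_integralZl ?lee_fin ?mulr_ge0 ?powR_ge0 ?(ltW C10)//; last 2 first.
  - apply/(measurable_restrictT _ _).1 => //; apply: measurable_funTS; exact: measurable_powRD.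
  - by move=> s _; apply: erestrict_ge0 => {}s _; rewrite lee_fin mulr_ge0 ?powR_ge0.
  rewrite -integral_mkcond.
  apply: le_trans (lee_wpmul2l _ (H2 _ (B0 x y))) _.
    by rewrite lee_fin mulr_ge0 ?powR_ge0 ?(ltW C10).
  by rewrite -!EFinM lee_fin mulrA [in X in _ <= X]opprB.
have Sy x : (\int[@lebT R m]_y \int[leb]_s \int[leb]_t
    (wgt e (coord x t y s) * kmod w (coord x t y s) `^ (- r))%:E <=
   (8 `^ r * C1 * C2 * C3)%:E * (A x `^ (- (r - 1 - (e + 1) - m%:R / 2)))%:E)%E.
  apply: le_trans.
    apply: ge0_le_integral_nomeas; last by move=> y _; exact: Ss.
    by move=> y _; apply: integral_ge0 => s _; apply: integral_ge0 => t _; exact: k0.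
  rewrite ge0_integralZl ?lee_fin ?mulr_ge0 ?powR_ge0 ?(ltW C10) ?(ltW C20)//; last 2 first.
  - apply/measurable_EFinP; apply: (measurableT_comp (measurable_powR _)).
    by apply: measurable_funD => //; exact: measurable_qsum.
  - by move=> y _; rewrite lee_fin powR_ge0.
  apply: le_trans (lee_wpmul2l _ (H3 _ _ (A0 x))) _.
    by rewrite lee_fin !mulr_ge0 ?powR_ge0 ?(ltW C10) ?(ltW C20).
  by rewrite -!EFinM lee_fin mulrA [in X in _ <= X]opprB.
apply: le_trans.
  apply: ge0_le_integral_nomeas; last by move=> x _; exact: Sy.
  move=> x _; apply: integral_ge0 => y _; apply: integral_ge0 => s _.
  by apply: integral_ge0 => t _; exact: k0.
rewrite ge0_integralZl ?lee_fin ?mulr_ge0 ?powR_ge0 ?(ltW C10) ?(ltW C20) ?(ltW C30)//; last 2 first.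
- apply/measurable_EFinP; apply: (measurableT_comp (measurable_powR _)).
  by apply: measurable_funD => //; exact: measurable_qsum.
- by move=> y _; rewrite lee_fin powR_ge0.
apply: le_trans (lee_wpmul2l _ (H4 _ _ w0)) _.
  by rewrite lee_fin !mulr_ge0 ?powR_ge0 ?(ltW C10) ?(ltW C20) ?(ltW C30).
rewrite -!EFinM lee_fin mulrA mn.
by have -> : m%:R / 2 - (r - 1 - (e + 1) - m%:R / 2) = m%:R + 1 + 1 + e - r by field.
Qed.

End rho2_geometry.

(** * Sufficiency *)

Section schur.
Context (R : realType) (m : nat).
Local Notation Rm := (measurableTypeR R).
Local Notation n := m.+1.
Local Notation Cm := (Cn R n).
Local Notation V := (@dV R n).

Lemma wgt0 e (z : Cm) : ~~ (0 < rho z) -> wgt e z = 0.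
Proof. by rewrite /wgt => /negbTE ->. Qed.

Lemma measurable_wgtE e : measurable_fun setT (fun z : Cm => (wgt e z)%:E).
Proof. by apply/measurable_EFinP; exact: measurable_wgt. Qed.

Lemma measurable_kmod_powR (c : R) :
  measurable_fun setT (fun v : Cm * Cm => (kmod v.1 v.2 `^ c)%:E).
Proof.
apply/measurable_EFinP.
exact: (measurableT_comp (measurable_powR c) (@measurable_kmod R m)).
Qed.

Lemma measurable_kmod_l_powR (c : R) z :
  measurable_fun setT (fun u : Cm => (kmod z u `^ c)%:E).
Proof.
apply/measurable_EFinP.
exact: (measurableT_comp (measurable_powR c) (@measurable_kmod_l R m z)).
Qed.

Local Open Scope ereal_scope.

(** The target weight enters the kernel as rho(z)^(be/q). Forelli-Rudin gives a power of rho(u), and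
    d is the exponent that cancels it, which makes the bound uniform in u. *)
Lemma schur_column (q a be c d : R) : (0 < q)%R -> (- 1 < a * q + be)%R ->
  (n%:R + 1 + (a * q + be) < c * q)%R ->
  (d * q = c * q - (n%:R + 1 + (a * q + be)))%R ->
  exists2 C : R, (0 < C)%R & forall u : Cm,
    \int[V]_z ((wgt (a + be / q) z * kmod z u `^ (- c) * wgt d u)%:E `^ q) <= C%:E.
Proof.
move=> q0 e1 ec dE; have q0' : q != 0%R by rewrite gt_eqF.
have [C C0 HC] := @forelli_rudin R m (a * q + be)%R (c * q)%R e1 ec.
exists C => // u.
have E z : (wgt (a + be / q) z * kmod z u `^ (- c) * wgt d u)%:E `^ q =
    (wgt (d * q) u)%:E * (wgt (a * q + be) z * kmod u z `^ (- (c * q)))%:E.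
  rewrite poweR_EFin -EFinM; congr EFin.
  rewrite powRM ?mulr_ge0 ?wgt_ge0 ?powR_ge0// powRM ?wgt_ge0 ?powR_ge0//.
  by rewrite !wgt_powR// mulrDl divfK// -powRrM mulNr kmodC mulrC.
under eq_integral do rewrite E.
rewrite ge0_integralZl ?lee_fin ?wgt_ge0//; last 2 first.
- apply/measurable_EFinP; apply: measurable_funM; first exact: measurable_wgt.
  by apply/measurable_EFinP; exact: measurable_kmod_l_powR.
- by move=> z _; rewrite lee_fin mulr_ge0 ?wgt_ge0 ?powR_ge0.
have [u0|u0] := boolP (0 < rho u)%R; last by rewrite wgt0// mul0e lee_fin ltW.
apply: le_trans (lee_wpmul2l _ (HC u u0)) _; first by rewrite lee_fin wgt_ge0.
rewrite -EFinM lee_fin wgt_pos// mulrCA -powRD; last by rewrite (gt_eqF u0) implybT.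
by rewrite dE addrA subrK subrr powRr0 mulr1.
Qed.

(** Jensen in x with a power weight bounds the p-th power of the inner integral by a power of rho(w)
    times an integral J against Phi^p dV_al. Minkowski with exponent q / p >= 1 then puts the
    remaining norm on the kernel of J, whose columns [schur_column] controls. *)
Lemma schur_one (p q a b c al be : R) : (1 < p)%R -> (p <= q)%R ->
  (0 < a + (be + 1) / q)%R -> (0 < b + 1 - (al + 1) / p)%R ->
  c = (n%:R + 1 + a + b + ((n%:R + 1 + be) / q - (n%:R + 1 + al) / p))%R ->
  exists2 C : R, (0 < C)%R & forall Phi : Cm -> \bar R,
    measurable_fun setT Phi -> (forall x, 0 <= Phi x) ->
    \int[V]_w ((wgt be w)%:E * ((wgt a w)%:E *
       \int[V]_x ((wgt b x * kmod w x `^ (- c))%:E * Phi x)) `^ q) <=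
    C%:E * (\int[V]_x ((wgt al x)%:E * Phi x `^ p)) `^ (q / p).
Proof.
move=> p1 pq A0 B0 cE.
(* A and B measure the room left by the two strict inequalities. *)
set A := (a + (be + 1) / q)%R in A0; set B := (b + 1 - (al + 1) / p)%R in B0.
have AE : A = (a + (be + 1) / q)%R by [].
have BE : B = (b + 1 - (al + 1) / p)%R by [].
clearbody A B.
have p0 : (0 < p)%R by lra.
have q0 : (0 < q)%R by lra.
have [p0' q0'] : p != 0%R /\ q != 0%R by rewrite !gt_eqF.
have pm : (p - 1 != 0)%R by rewrite gt_eqF// subr_gt0.
pose P := (p / (p - 1))%R.
have P0 : (0 < P)%R by rewrite divr_gt0// subr_gt0.
have Pp : (P * (p - 1) = p)%R by rewrite /P divfK.
(* The shift of the Schur weights. Its sign makes both Forelli-Rudin integrals converge at infinity,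
   and |s| < A, |s| < B makes them converge at the boundary. *)
pose s := (- (Num.min A B / 2))%R.
have sn : (s < 0)%R by rewrite oppr_lt0 divr_gt0// lt_min A0.
have sA : (0 < A + s)%R.
  rewrite subr_gt0; apply: (@le_lt_trans _ _ (A / 2)%R); last by lra.
  by rewrite ler_pM2r ?invr_gt0// ge_min lexx.
have sB : (0 < B + s)%R.
  rewrite subr_gt0; apply: (@le_lt_trans _ _ (B / 2)%R); last by lra.
  by rewrite ler_pM2r ?invr_gt0// ge_min lexx orbT.
have m0 : (0 <= n%:R :> R)%R by [].
(* With P the conjugate exponent of p, the formula for c reads c = (n/P + B) + (n/q + A): the first
   summand times P is r1, the second goes to the columns. The choice of e1 gives n + 1 + e1 - r1 = P
   s and leaves rho(x)^(al - p s) in J. *)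
pose e1 := (P * (B + s) - 1)%R; pose r1 := (n%:R + B * P)%R.
have [||C1 C10 H1] := @forelli_rudin R m e1 r1.
- by rewrite /e1 ltrBrDr addNr mulr_gt0.
- have Ps : (P * s < 0)%R by rewrite pmulr_rlt0.
  by rewrite /e1 /r1 mulrDr; lra.
pose a' := (p * (a + s))%R; pose be' := (be * p / q)%R; pose k := (q / p)%R.
have k1 : (1 <= k)%R by rewrite ler_pdivlMr// mul1r.
have k0 : (0 < k)%R by lra.
have k0' : k != 0%R by rewrite gt_eqF.
have ak : (a' * k = q * (a + s))%R by rewrite /a' /k; field.
have Aq : (q * A = q * a + be + 1)%R by rewrite AE; field.
have [||||C2 C20 H2] := @schur_column k a' be (p * (n%:R / q + A))%R (- (p * s))%R.
- by [].
- rewrite ak; have : (0 < q * (A + s))%R by rewrite mulr_gt0.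
  by rewrite !mulrDr Aq; lra.
- have -> : (p * (n%:R / q + A) * k = n%:R + q * A)%R by rewrite /k; field; apply/andP.
  rewrite ak; have : (q * s < 0)%R by rewrite pmulr_rlt0.
  by rewrite !mulrDr Aq; lra.
- have -> : (p * (n%:R / q + A) * k = n%:R + q * A)%R by rewrite /k; field; apply/andP.
  have -> : (- (p * s) * k = - (q * s))%R by rewrite /k; field.
  by rewrite ak !mulrDr Aq; ring.
exists ((C1 `^ (p - 1)) `^ k * C2)%R.
  by rewrite mulr_gt0// !powR_gt0.
move=> Phi mPhi Phi0.
pose J w := \int[V]_x ((wgt (- (p * s)) x * kmod w x `^ (- (p * (n%:R / q + A))))%:E *
   ((wgt al x)%:E * Phi x `^ p)).
have PhiP x : 0 <= (wgt al x)%:E * Phi x `^ p by rewrite mule_ge0 ?lee_fin ?wgt_ge0 ?poweR_ge0.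
have mPhiP : measurable_fun setT (fun x => (wgt al x)%:E * Phi x `^ p).
  apply: emeasurable_funM; first exact: measurable_wgtE.
  exact: (measurableT_comp (measurable_poweR p)).
pose Xi w := \int[V]_x ((wgt b x * kmod w x `^ (- c))%:E * Phi x).
have Xi0 w : 0 <= Xi w.
  by apply: integral_ge0 => x _; rewrite mule_ge0// lee_fin mulr_ge0 ?wgt_ge0 ?powR_ge0.
have J0 w : 0 <= J w.
  by apply: integral_ge0 => x _; rewrite mule_ge0// lee_fin mulr_ge0 ?wgt_ge0 ?powR_ge0.
have XJ w : (0 < rho w)%R -> Xi w `^ p <= (C1 `^ (p - 1) * wgt (p * s) w)%:E * J w.
  move=> w0.
  pose g x := (wgt e1 x * kmod w x `^ (- r1))%:E.
  pose h x := (wgt (b - e1) x * kmod w x `^ (r1 - c))%:E * Phi x.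
  have g0 x : 0 <= g x by rewrite lee_fin mulr_ge0 ?wgt_ge0 ?powR_ge0.
  have h0 x : 0 <= h x by rewrite mule_ge0// lee_fin mulr_ge0 ?wgt_ge0 ?powR_ge0.
  have mg : measurable_fun setT g.
    apply/measurable_EFinP; apply: measurable_funM; first exact: measurable_wgt.
    by apply/measurable_EFinP; exact: measurable_kmod_l_powR.
  have mh : measurable_fun setT h.
    apply: emeasurable_funM => //.
    apply/measurable_EFinP; apply: measurable_funM; first exact: measurable_wgt.
    by apply/measurable_EFinP; exact: measurable_kmod_l_powR.
  have := @jensen_poweR _ _ R V h g p (ltW p1) mh mg h0 g0.
  have -> : \int[V]_x (h x * g x) = Xi w.
    apply: eq_integral => x _; rewrite /h /g muleAC -EFinM; congr (_%:E * _).
    have [x0|x0] := boolP (0 < rho x)%R; last by rewrite !wgt0// !mul0r.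
    rewrite mulrACA -wgtD subrK; congr (_ * _)%R.
    by rewrite -powRD ?(gt_eqF (kmod_gt0 w0 x0)) ?implybT//; congr (_ `^ _)%R; ring.
  have -> : \int[V]_x (h x `^ p * g x) = J w.
    apply: eq_integral => x _; rewrite /h /g.
    rewrite poweRM ?lee_fin ?mulr_ge0 ?wgt_ge0 ?powR_ge0// poweR_EFin.
    rewrite muleAC -EFinM muleA -EFinM; congr (_%:E * _).
    have [x0|x0] := boolP (0 < rho x)%R; last by rewrite !wgt0// !(mul0r, mulr0).
    rewrite powRM ?wgt_ge0 ?powR_ge0// wgt_powR// -powRrM.
    rewrite mulrACA -wgtD mulrAC -wgtD; congr (wgt _ _ * _)%R.
      have -> : ((b - e1) * p + e1 = b * p - (p - 1) * e1)%R by ring.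
      rewrite /e1 mulrBr mulrA [(_ * P)%R]mulrC Pp BE; field.
      by [].
    rewrite -powRD ?(gt_eqF (kmod_gt0 w0 x0)) ?implybT//; congr (_ `^ _)%R.
    have -> : ((r1 - c) * p + - r1 = (p - 1) * r1 - c * p)%R by ring.
    rewrite /r1 mulrDr [(B * P)%R]mulrC mulrA [((p - 1) * P)%R]mulrC Pp cE AE BE; field.
    by apply/andP.
  move=> /le_trans; apply; rewrite muleC lee_wpmul2r//.
  have Ig : \int[V]_x g x <= (C1 * rho w `^ (P * s))%:E.
    apply: le_trans (H1 w w0) _; rewrite lee_fin.
    have -> : (n%:R + 1 + e1 - r1 = P * s)%R by rewrite /e1 /r1; ring.
    by [].
  apply: le_trans (gt0_ler_poweR _ _ _ Ig) _.
  - by rewrite subr_ge0 ltW.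
  - by rewrite in_itv/= leey andbT; exact: integral_ge0.
  - by rewrite in_itv/= leey andbT lee_fin mulr_ge0 ?powR_ge0// ltW.
  rewrite poweR_EFin lee_fin powRM ?powR_ge0 ?(ltW C10)// wgt_pos//.
  by rewrite -powRrM mulrAC Pp.
have kE : k = (q / p)%R by [].
apply: (@le_trans _ _ (\int[V]_w ((C1 `^ (p - 1) `^ k)%:E *
   (\int[V]_x ((wgt (a' + be / k) w * kmod w x `^ (- (p * (n%:R / q + A))) * wgt (- (p * s)) x)%:E *
   ((wgt al x)%:E * Phi x `^ p))) `^ k))).
  apply: ge0_le_integral_nomeas => w _.
    by rewrite mule_ge0 ?lee_fin ?wgt_ge0 ?poweR_ge0.
  have [w0|w0] := boolP (0 < rho w)%R; last first.
    by rewrite wgt0// mul0e mule_ge0 ?lee_fin ?powR_ge0 ?poweR_ge0.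
  have -> : \int[V]_x ((wgt (a' + be / k) w * kmod w x `^ (- (p * (n%:R / q + A))) *
       wgt (- (p * s)) x)%:E * ((wgt al x)%:E * Phi x `^ p)) = (wgt (a' + be / k) w)%:E * J w.
    rewrite -ge0_integralZl ?lee_fin ?wgt_ge0//; last 2 first.
    - apply: emeasurable_funM => //; apply/measurable_EFinP.
      apply: measurable_funM; first exact: measurable_wgt.
      by apply/measurable_EFinP; exact: measurable_kmod_l_powR.
    - by move=> x _; rewrite mule_ge0// lee_fin mulr_ge0 ?wgt_ge0 ?powR_ge0.
    by apply: eq_integral => x _; rewrite [RHS]muleA -EFinM -mulrA [(kmod _ _ `^ _ * _)%R]mulrC.
  rewrite -/(Xi w) poweRM ?lee_fin ?wgt_ge0// poweRM ?lee_fin ?wgt_ge0//.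
  have -> : Xi w `^ q = (Xi w `^ p) `^ k by rewrite -poweRrM /k mulrCA divff// mulr1.
  have := XJ w w0 => /(gt0_ler_poweR (ltW k0)) => /(_ _ _) XJk.
  rewrite !poweR_EFin !wgt_powR// [leLHS]muleA -EFinM -wgtD.
  apply: le_trans (lee_wpmul2l _ (XJk _ _)) _.
  - by rewrite lee_fin wgt_ge0.
  - by rewrite in_itv/= leey andbT poweR_ge0.
  - by rewrite in_itv/= leey andbT mule_ge0// lee_fin mulr_ge0 ?wgt_ge0 ?powR_ge0.
  rewrite poweRM ?lee_fin ?mulr_ge0 ?wgt_ge0 ?powR_ge0// poweR_EFin powRM ?wgt_ge0 ?powR_ge0//.
  rewrite wgt_powR// !muleA -!EFinM; apply: lee_wpmul2r; first exact: poweR_ge0.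
  rewrite lee_fin mulrCA -wgtD ler_wpM2l ?powR_ge0//.
  suff -> : (be + a * q + p * s * k = (a' + be / k) * k)%R by [].
  by rewrite mulrDl divfK// ak kE; field.
rewrite ge0_integralZl ?lee_fin ?powR_ge0//; last 2 first.
- apply: (measurableT_comp (measurable_poweR k)).
  apply: (@measurable_fun_fubini_tonelli_F _ _ _ _ _ V
    (fun v : Cm * Cm => ((wgt (a' + be / k) v.1 * kmod v.1 v.2 `^ (- (p * (n%:R / q + A))) *
      wgt (- (p * s)) v.2)%:E * ((wgt al v.2)%:E * Phi v.2 `^ p)))).
    apply: emeasurable_funM; last exact: (measurableT_comp mPhiP measurable_snd).
    apply/measurable_EFinP; apply: measurable_funM.
      apply: measurable_funM; first exact: (measurableT_comp (@measurable_wgt R m _) measurable_fst).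
      by apply/measurable_EFinP; exact: measurable_kmod_powR.
    exact: (measurableT_comp (@measurable_wgt R m _) measurable_snd).
  by move=> v; rewrite mule_ge0// lee_fin !mulr_ge0 ?wgt_ge0 ?powR_ge0.
- by move=> w _; exact: poweR_ge0.
rewrite EFinM -muleA lee_wpmul2l ?lee_fin ?powR_ge0//.
apply: (@minkowski_kernel _ _ _ _ _ V V
  (fun v : Cm * Cm => (wgt (a' + be / k) v.1 * kmod v.1 v.2 `^ (- (p * (n%:R / q + A))) *
      wgt (- (p * s)) v.2)%:E)) => //.
- by rewrite lee_fin ltW.
- apply/measurable_EFinP; apply: measurable_funM.
    apply: measurable_funM; first exact: (measurableT_comp (@measurable_wgt R m _) measurable_fst).
    by apply/measurable_EFinP; exact: measurable_kmod_powR.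
  exact: (measurableT_comp (@measurable_wgt R m _) measurable_snd).
- by move=> v; rewrite lee_fin !mulr_ge0 ?wgt_ge0 ?powR_ge0.
Qed.

End schur.

(** * The mixed norm estimate for the positive operator *)

Section mixed_bound.
Context (R : realType) (m : nat).
Local Notation Rm := (measurableTypeR R).
Local Notation n := m.+1.
Local Notation Cm := (Cn R n).
Local Notation V := (@dV R n).
Local Notation V2 := (@dV2 R n).

(** The kernel of S as a real number, extended by zero in v outside the domain and written as a
    product of factors in separate variables. *)
Definition Kn (b1 b2 c1 c2 : R) (zw v : Cm * Cm) : R :=
  wgt b1 v.1 * wgt b2 v.2 * (kmod zw.1 v.1 `^ (- c1) * kmod zw.2 v.2 `^ (- c2)).

Lemma Kn_ge0 b1 b2 c1 c2 zw v : 0 <= Kn b1 b2 c1 c2 zw v.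
Proof. by rewrite !mulr_ge0 ?wgt_ge0 ?powR_ge0. Qed.

Lemma measurable_wgt_comp d (T : measurableType d) e (f : T -> Cm) :
  measurable_fun setT f -> measurable_fun setT (fun t => wgt e (f t) : Rm).
Proof. by move=> mf; exact: (measurableT_comp (@measurable_wgt R m e) mf). Qed.

Lemma measurable_kmod_comp d (T : measurableType d) c (f g : T -> Cm) :
  measurable_fun setT f -> measurable_fun setT g ->
  measurable_fun setT (fun t => kmod (f t) (g t) `^ c : Rm).
Proof.
move=> mf mg; apply: (measurableT_comp (measurable_powR c)).
exact: (measurableT_comp (@measurable_kmod R m) (measurable_fun_pair mf mg)).
Qed.

Lemma measurable_Kn b1 b2 c1 c2 :
  measurable_fun setT (fun t : (Cm * Cm) * (Cm * Cm) => Kn b1 b2 c1 c2 t.1 t.2 : Rm).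
Proof.
have m11 : measurable_fun setT (fun t : (Cm * Cm) * (Cm * Cm) => t.1.1).
  exact: (measurableT_comp measurable_fst measurable_fst).
have m12 : measurable_fun setT (fun t : (Cm * Cm) * (Cm * Cm) => t.1.2).
  exact: (measurableT_comp measurable_snd measurable_fst).
have m21 : measurable_fun setT (fun t : (Cm * Cm) * (Cm * Cm) => t.2.1).
  exact: (measurableT_comp measurable_fst measurable_snd).
have m22 : measurable_fun setT (fun t : (Cm * Cm) * (Cm * Cm) => t.2.2).
  exact: (measurableT_comp measurable_snd measurable_snd).
apply: measurable_funM; apply: measurable_funM.
- exact: measurable_wgt_comp.
- exact: measurable_wgt_comp.
- exact: measurable_kmod_comp.
- exact: measurable_kmod_comp.
Qed.

Lemma measurable_Kn_l b1 b2 c1 c2 zw :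
  measurable_fun setT (Kn b1 b2 c1 c2 zw : _ -> Rm).
Proof. exact: (measurableT_comp (@measurable_Kn b1 b2 c1 c2) (pair1_measurable zw)). Qed.

Local Open Scope ereal_scope.

Definition Gop (b1 b2 c1 c2 : R) (F : Cm * Cm -> \bar R) (zw : Cm * Cm) : \bar R :=
  \int[V2]_v ((Kn b1 b2 c1 c2 zw v)%:E * F v).

(** The p2-th power of the mixed norm. It takes extended real functions because the positive
    operator may be +oo at some points. *)
Definition mixint (p1 p2 al1 al2 : R) (F : Cm * Cm -> \bar R) : \bar R :=
  \int[V]_w ((wgt al2 w)%:E * (\int[V]_z ((wgt al1 z)%:E * F (z, w) `^ p1)) `^ (p2 / p1)).

Lemma Gop_ge0 b1 b2 c1 c2 F zw : (forall v, 0 <= F v) -> 0 <= Gop b1 b2 c1 c2 F zw.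
Proof. by move=> F0; apply: integral_ge0 => v _; rewrite mule_ge0 ?lee_fin ?Kn_ge0. Qed.

Lemma measurable_Gop b1 b2 c1 c2 F : measurable_fun setT F -> (forall v, 0 <= F v) ->
  measurable_fun setT (Gop b1 b2 c1 c2 F).
Proof.
move=> mF F0.
apply: (@measurable_fun_fubini_tonelli_F _ _ _ _ _ V2
  (fun t : (Cm * Cm) * (Cm * Cm) => (Kn b1 b2 c1 c2 t.1 t.2)%:E * F t.2)).
  apply: emeasurable_funM; first by apply/measurable_EFinP; exact: measurable_Kn.
  exact: (measurableT_comp mF measurable_snd).
by move=> t; rewrite mule_ge0 ?lee_fin ?Kn_ge0.
Qed.

Lemma measurable_mixint_inner (p1 al1 : R) (F : Cm * Cm -> \bar R) :
  measurable_fun setT F -> (forall v, 0 <= F v) ->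
  measurable_fun setT (fun w : Cm => \int[V]_z ((wgt al1 z)%:E * F (z, w) `^ p1)).
Proof.
move=> mF F0.
apply: (@measurable_fun_fubini_tonelli_G _ _ _ _ _ V
  (fun v : Cm * Cm => (wgt al1 v.1)%:E * F v `^ p1)).
  apply: emeasurable_funM; last exact: (measurableT_comp (measurable_poweR p1)).
  by apply/measurable_EFinP; exact: measurable_wgt_comp.
by move=> v; rewrite mule_ge0 ?lee_fin ?wgt_ge0 ?poweR_ge0.
Qed.

Lemma mixint_ge0 p1 p2 al1 al2 F : 0 <= mixint p1 p2 al1 al2 F.
Proof. by apply: integral_ge0 => w _; rewrite mule_ge0 ?lee_fin ?wgt_ge0 ?poweR_ge0. Qed.

Lemma mixintZ (p1 p2 al1 al2 k : R) (F : Cm * Cm -> \bar R) : (0 < k)%R -> (0 < p1)%R ->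
  measurable_fun setT F -> (forall v, 0 <= F v) ->
  mixint p1 p2 al1 al2 (fun v => k%:E * F v) = (k `^ p2)%:E * mixint p1 p2 al1 al2 F.
Proof.
move=> k0 p10 mF F0; rewrite /mixint -ge0_integralZl ?lee_fin ?powR_ge0//; last 2 first.
- apply: emeasurable_funM; first exact: measurable_wgtE.
  by apply: (measurableT_comp (measurable_poweR _)); exact: measurable_mixint_inner.
- by move=> w _; rewrite mule_ge0 ?lee_fin ?wgt_ge0 ?poweR_ge0.
apply: eq_integral => w _; rewrite muleCA; congr (_ * _).
have -> : \int[V]_z ((wgt al1 z)%:E * (k%:E * F (z, w)) `^ p1) =
   (k `^ p1)%:E * \int[V]_z ((wgt al1 z)%:E * F (z, w) `^ p1).
  rewrite -ge0_integralZl ?lee_fin ?powR_ge0//; last 2 first.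
  - apply: emeasurable_funM; first exact: measurable_wgtE.
    apply: (measurableT_comp (measurable_poweR p1)).
    exact: (measurableT_comp mF (pair2_measurable w)).
  - by move=> z _; rewrite mule_ge0 ?lee_fin ?wgt_ge0 ?poweR_ge0.
  by apply: eq_integral => z _; rewrite poweRM ?lee_fin ?(ltW k0)// poweR_EFin muleCA.
rewrite poweRM ?lee_fin ?powR_ge0//.
  by rewrite poweR_EFin -powRrM mulrCA divff ?gt_eqF// mulr1.
by apply: integral_ge0 => z _; rewrite mule_ge0 ?lee_fin ?wgt_ge0 ?poweR_ge0.
Qed.

(** For fixed w, Minkowski over the joint variable (u, eta) takes the L^q1 norm in z inside the
    integral, at the price of a constant uniform in u. Then F enters only through [Phi], its
    integral against rho^al1 in the first variable, and [schur_one] applies to [Phi]. *)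
Lemma mixed_bound (p2 q1 q2 a1 a2 b1 b2 c1 c2 al1 al2 be1 be2 : R) :
  (1 < p2)%R -> (p2 <= q1)%R -> (p2 <= q2)%R ->
  (al1 < b1)%R -> (al2 + 1 < p2 * (b2 + 1))%R ->
  (- q1 * a1 < be1 + 1)%R -> (- q2 * a2 < be2 + 1)%R ->
  c1 = (n%:R + 1 + a1 + b1 + ((n%:R + 1 + be1) / q1 - (n%:R + 1 + al1)))%R ->
  c2 = (n%:R + 1 + a2 + b2 + ((n%:R + 1 + be2) / q2 - (n%:R + 1 + al2) / p2))%R ->
  exists2 C : R, (0 < C)%R & forall F : Cm * Cm -> \bar R,
    measurable_fun setT F -> (forall v, 0 <= F v) ->
    mixint q1 q2 be1 be2 (fun zw => (wgt a1 zw.1 * wgt a2 zw.2)%:E * Gop b1 b2 c1 c2 F zw)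
    <= C%:E * mixint 1 p2 al1 al2 F `^ (q2 / p2).
Proof.
move=> p1 pq1 pq2 ab1 ab2 qa1 qa2 c1E c2E.
have [q10 q20] : (0 < q1)%R /\ (0 < q2)%R by split; lra.
have p0 : (0 < p2)%R by lra.
have [q1n q2n p2n] : [/\ q1 != 0, q2 != 0 & p2 != 0]%R by rewrite !gt_eqF.
have c1q : (c1 * q1 = (a1 + b1 - al1) * q1 + n%:R + 1 + be1)%R by rewrite c1E; field.
(* With d = b1 - al1, the formula for c1 is the exponent balance of [schur_column] and al1 < b1 is
   its convergence condition. *)
have [||||C1 C10 H1] := @schur_column R m q1 a1 be1 c1 (b1 - al1)%R.
- by [].
- by lra.
- rewrite c1q; have : (0 < (b1 - al1) * q1)%R by rewrite mulr_gt0// subr_gt0.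
  by rewrite !mulrDl !mulNr; lra.
- by rewrite c1q; ring.
have [|||C2 C20 H2] := @schur_one R m p2 q2 a2 b2 c2 al2 be2 p1 pq2.
- have -> : (a2 + (be2 + 1) / q2 = (q2 * a2 + be2 + 1) / q2)%R by field.
  by rewrite divr_gt0//; lra.
- by rewrite subr_gt0 ltr_pdivrMr// mulrC.
- by [].
exists (C1 `^ (q2 / q1) * C2)%R; first by rewrite mulr_gt0// powR_gt0.
move=> F mF F0.
pose Phi x := \int[V]_u ((wgt al1 u)%:E * F (u, x)).
have mPhi : measurable_fun setT Phi.
  apply: (@measurable_fun_fubini_tonelli_G _ _ _ _ _ V
    (fun v : Cm * Cm => (wgt al1 v.1)%:E * F v)).
    apply: emeasurable_funM => //.
    by apply/measurable_EFinP; exact: measurable_wgt_comp.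
  by move=> v; rewrite mule_ge0 ?lee_fin ?wgt_ge0.
have Phi0 x : 0 <= Phi x by apply: integral_ge0 => u _; rewrite mule_ge0 ?lee_fin ?wgt_ge0.
have -> : mixint 1 p2 al1 al2 F = \int[V]_x ((wgt al2 x)%:E * Phi x `^ p2).
  apply: eq_integral => x _; rewrite divr1; congr (_ * _ `^ _).
  by apply: eq_integral => u _; rewrite poweRe1.
rewrite EFinM -muleA.
have {}H2 := H2 Phi mPhi Phi0.
apply: le_trans (lee_wpmul2l _ H2); last by rewrite lee_fin powR_ge0.
pose X (w : Cm) := (wgt a2 w)%:E * \int[V]_x ((wgt b2 x * kmod w x `^ (- c2))%:E * Phi x).
have mX : measurable_fun setT X.
  apply: emeasurable_funM; first exact: measurable_wgtE.
  apply: (@measurable_fun_fubini_tonelli_F _ _ _ _ _ V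
    (fun v : Cm * Cm => (wgt b2 v.2 * kmod v.1 v.2 `^ (- c2))%:E * Phi v.2)).
    apply: emeasurable_funM; last exact: (measurableT_comp mPhi measurable_snd).
    apply/measurable_EFinP; apply: measurable_funM; first exact: measurable_wgt_comp.
    exact: measurable_kmod_comp.
  by move=> v; rewrite mule_ge0// lee_fin mulr_ge0 ?wgt_ge0 ?powR_ge0.
have X0 w : 0 <= X w.
  rewrite mule_ge0 ?lee_fin ?wgt_ge0//; apply: integral_ge0 => x _.
  by rewrite mule_ge0// lee_fin mulr_ge0 ?wgt_ge0 ?powR_ge0.
rewrite -ge0_integralZl ?lee_fin ?powR_ge0//; last 2 first.
- apply: emeasurable_funM; first exact: measurable_wgtE.
  exact: (measurableT_comp (measurable_poweR q2)).
- by move=> w _; rewrite mule_ge0 ?lee_fin ?wgt_ge0 ?poweR_ge0.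
apply: ge0_le_integral_nomeas => w _.
  by rewrite mule_ge0 ?lee_fin ?wgt_ge0 ?poweR_ge0.
rewrite -/(X w) [leRHS]muleCA; apply: lee_wpmul2l; first by rewrite lee_fin wgt_ge0.
(* The factor rho(u)^b1 is split: rho(u)^al1 stays in the density g and builds [Phi], while
   rho(u)^(b1 - al1) joins the z-kernel [H]. *)
pose g (v : Cm * Cm) := (wgt a2 w)%:E * ((wgt b2 v.2 * kmod w v.2 `^ (- c2))%:E *
  ((wgt al1 v.1)%:E * F v)).
have mwF : measurable_fun setT (fun v : Cm * Cm => (wgt al1 v.1)%:E * F v).
  by apply: emeasurable_funM => //; apply/measurable_EFinP; exact: measurable_wgt_comp.
have mg : measurable_fun setT g.
  apply: measurable_funeM; apply: emeasurable_funM => //.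
  apply/measurable_EFinP; apply: measurable_funM; first exact: measurable_wgt_comp.
  by apply: measurable_kmod_comp.
have g0 v : 0 <= g v.
  by rewrite !mule_ge0 ?lee_fin ?mulr_ge0 ?wgt_ge0 ?powR_ge0.
have Ig : \int[V2]_v g v = X w.
  rewrite integral_dV2_swap// /X -ge0_integralZl ?lee_fin ?wgt_ge0//; last 2 first.
  - apply: emeasurable_funM => //; apply/measurable_EFinP; apply: measurable_funM.
      exact: measurable_wgt.
    by apply/measurable_EFinP; exact: measurable_kmod_l_powR.
  - by move=> x _; rewrite mule_ge0// lee_fin mulr_ge0 ?wgt_ge0 ?powR_ge0.
  apply: eq_integral => x _; rewrite /g/=.
  have mx : measurable_fun setT (fun z : Cm => (wgt al1 z)%:E * F (z, x)).
    exact: (measurableT_comp mwF (pair2_measurable x)).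
  have px z : 0 <= (wgt al1 z)%:E * F (z, x) by rewrite mule_ge0 ?lee_fin ?wgt_ge0.
  rewrite ge0_integralZl ?lee_fin ?wgt_ge0//; last 2 first.
  - exact: measurable_funeM.
  - by move=> z _; rewrite mule_ge0// lee_fin mulr_ge0 ?wgt_ge0 ?powR_ge0.
  by rewrite ge0_integralZl ?lee_fin ?mulr_ge0 ?wgt_ge0 ?powR_ge0.
pose H (t : Cm * (Cm * Cm)) : \bar R :=
  (wgt (a1 + be1 / q1) t.1 * kmod t.1 t.2.1 `^ (- c1) * wgt (b1 - al1) t.2.1)%:E.
have mH : measurable_fun setT H.
  have m21 : measurable_fun setT (fun t : Cm * (Cm * Cm) => t.2.1).
    exact: (measurableT_comp measurable_fst measurable_snd).
  apply/measurable_EFinP; apply: measurable_funM; last exact: measurable_wgt_comp.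
  apply: measurable_funM; first exact: measurable_wgt_comp.
  exact: measurable_kmod_comp.
have H0 t : 0 <= H t by rewrite lee_fin !mulr_ge0 ?wgt_ge0 ?powR_ge0.
have q11 : (1 <= q1)%R by lra.
have MK := @minkowski_kernel _ _ Cm _ R V V2 H g q1 C1%:E q11 (ltW C10) mH mg H0 g0
  (fun v => H1 v.1).
rewrite Ig in MK.
have E z : (wgt be1 z)%:E * ((wgt a1 z * wgt a2 w)%:E * Gop b1 b2 c1 c2 F (z, w)) `^ q1 =
    (\int[V2]_v (H (z, v) * g v)) `^ q1.
  have -> : \int[V2]_v (H (z, v) * g v) =
      (wgt (be1 / q1) z)%:E * ((wgt a1 z * wgt a2 w)%:E * Gop b1 b2 c1 c2 F (z, w)).
    rewrite muleA -EFinM /Gop -ge0_integralZl ?lee_fin ?mulr_ge0 ?wgt_ge0//; last 2 first.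
    - by apply: emeasurable_funM => //; apply/measurable_EFinP; exact: measurable_Kn_l.
    - by move=> v _; rewrite mule_ge0 ?lee_fin ?Kn_ge0.
    apply: eq_integral => v _; rewrite /H /g /Kn/=.
    rewrite !muleA -!EFinM; congr (_%:E * _).
    rewrite wgtD -[in RHS](subrK al1 b1) [wgt (b1 - al1 + al1) _]wgtD; ring.
  rewrite [in RHS]poweRM ?lee_fin ?wgt_ge0// ?mule_ge0 ?Gop_ge0 ?lee_fin ?mulr_ge0 ?wgt_ge0//.
  by rewrite poweR_EFin wgt_powR// divfK.
under eq_integral do rewrite /= E.
have Xq : C1%:E * X w `^ q1 \in `[0, +oo].
  by rewrite in_itv/= leey andbT mule_ge0 ?poweR_ge0// lee_fin ltW.
have qq : (0 <= q2 / q1)%R by rewrite divr_ge0// ltW.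
apply: le_trans (gt0_ler_poweR qq _ Xq MK) _.
  by rewrite in_itv/= leey andbT; apply: integral_ge0 => z _; exact: poweR_ge0.
by rewrite poweRM ?poweR_ge0 ?lee_fin ?(ltW C10)// poweR_EFin -poweRrM mulrCA divff// mulr1.
Qed.

End mixed_bound.

(** * From the positive operator to the complex integral operators *)

Section sufficiency.
Context (R : realType) (m : nat).
Local Notation Rm := (measurableTypeR R).
Local Notation n := m.+1.
Local Notation Cm := (Cn R n).
Local Notation V := (@dV R n).
Local Notation V2 := (@dV2 R n).
Local Notation TB2 := (@TB R n `*` @TB R n).

Lemma cmodM (w1 w2 : R[i]) : cmod (w1 * w2) = cmod w1 * cmod w2.
Proof.
case: w1 w2 => [a b] [c d]; rewrite /cmod/= -sqrtrM ?addr_ge0 ?sqr_ge0//.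
by congr Num.sqrt; ring.
Qed.

Lemma cmod_realC (r : R) : 0 <= r -> cmod (realC r) = r.
Proof. by move=> r0; rewrite /cmod/= expr0n addr0 sqrtr_sqr ger0_norm. Qed.

Lemma TB2P zw : TB2 zw <-> 0 < rho zw.1 /\ 0 < rho zw.2.
Proof. by rewrite TBE. Qed.

Lemma measurable_TB2 : measurable TB2.
Proof. by apply: measurableX; exact: measurable_TB. Qed.

Lemma measurable_fun_cmod d (T : measurableType d) (D : set T) (f : T -> R[i]) :
  measurable_fun D (fun v => complex.Re (f v) : Rm) ->
  measurable_fun D (fun v => complex.Im (f v) : Rm) ->
  measurable_fun D (fun v => cmod (f v) : Rm).
Proof.
move=> mr mi; apply: (measurableT_comp (continuous_measurable_fun (@sqrt_continuous R))).
by apply: measurable_funD; apply: measurable_funX.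
Qed.

Definition cmodT (f : Cm * Cm -> R[i]) : Cm * Cm -> \bar R :=
  (fun v => (cmod (f v))%:E) \_ TB2.

Lemma cmodT_ge0 f v : (0 <= cmodT f v)%E.
Proof. by apply: erestrict_ge0 => x _; rewrite lee_fin cmod_ge0. Qed.

Lemma cmodT_in f z w : 0 < rho z -> 0 < rho w -> cmodT f (z, w) = (cmod (f (z, w)))%:E.
Proof. by move=> z0 w0; rewrite /cmodT /patch mem_set//; exact/TB2P. Qed.

Lemma mixnormE (p1 p2 al1 al2 : R) (f : Cm * Cm -> R[i]) :
  mixnorm p1 p2 al1 al2 f = (mixint p1 p2 al1 al2 (cmodT f) `^ p2^-1)%E.
Proof.
rewrite /mixnorm /mixint; congr (_ `^ _)%E.
rewrite integral_mkcond; apply: eq_integral => w _; rewrite /patch.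
have [w0|w0] := boolP (0 < rho w); last first.
  by rewrite wgt0// mul0e memNset//; rewrite TBE/=; exact/negP.
rewrite mem_set ?wgt_pos ?TBE//; congr (_ * _ `^ _)%E.
rewrite integral_mkcond; apply: eq_integral => z _; rewrite /patch.
have [z0|z0] := boolP (0 < rho z); last first.
  by rewrite wgt0// mul0e memNset//; exact/negP.
by rewrite mem_set ?wgt_pos // cmodT_in// poweR_EFin -EFinM.
Qed.

Local Open Scope ereal_scope.

Lemma mixint_le (p1 p2 al1 al2 : R) (F F' : Cm * Cm -> \bar R) : (0 < p1)%R -> (0 < p2)%R ->
  (forall v, 0 <= F v) -> (forall v, F v <= F' v) ->
  mixint p1 p2 al1 al2 F <= mixint p1 p2 al1 al2 F'.
Proof.
move=> p10 p20 F0 FF; have F'0 v : 0 <= F' v by exact: le_trans (FF v).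
apply: ge0_le_integral_nomeas => w _; first by rewrite mule_ge0 ?lee_fin ?wgt_ge0 ?poweR_ge0.
apply: lee_wpmul2l; first by rewrite lee_fin wgt_ge0.
have I0 (H : Cm * Cm -> \bar R) : (forall v, 0 <= H v) ->
    \int[V]_z ((wgt al1 z)%:E * H (z, w) `^ p1) \in `[0, +oo].
  move=> H0; rewrite in_itv/= leey andbT; apply: integral_ge0 => z _.
  by rewrite mule_ge0 ?lee_fin ?wgt_ge0 ?poweR_ge0.
apply: gt0_ler_poweR; rewrite ?I0 ?divr_ge0 ?(ltW p10) ?(ltW p20)//.
apply: ge0_le_integral_nomeas => z _; first by rewrite mule_ge0 ?lee_fin ?wgt_ge0 ?poweR_ge0.
apply: lee_wpmul2l; first by rewrite lee_fin wgt_ge0.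
by apply: gt0_ler_poweR; rewrite ?(ltW p10) ?in_itv/= ?leey ?andbT.
Qed.

Lemma GopZ b1 b2 c1 c2 k F zw : (0 <= k)%R -> measurable_fun setT F -> (forall v, 0 <= F v) ->
  @Gop R m b1 b2 c1 c2 (fun v => k%:E * F v) zw = k%:E * Gop b1 b2 c1 c2 F zw.
Proof.
move=> k0 mF F0; rewrite /Gop -ge0_integralZl//; last 2 first.
- by apply: emeasurable_funM => //; apply/measurable_EFinP; exact: measurable_Kn_l.
- by move=> v _; rewrite mule_ge0 ?lee_fin ?Kn_ge0.
by apply: eq_integral => v _; rewrite muleCA.
Qed.

Definition kernel_dominated (b1 b2 c1 c2 : R) (K : Cm * Cm -> Cm * Cm -> R[i]) :=
  forall zw, TB2 zw -> [/\ measurable_fun TB2 (fun v => complex.Re (K zw v) : Rm),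
    measurable_fun TB2 (fun v => complex.Im (K zw v) : Rm) &
    forall v, TB2 v -> (cmod (K zw v) <= Kn b1 b2 c1 c2 zw v)%R].

Section kernel.
Variables (b1 b2 c1 c2 : R) (K : Cm * Cm -> Cm * Cm -> R[i]).
Hypothesis domK : kernel_dominated b1 b2 c1 c2 K.
Variable f : Cm * Cm -> R[i].
Hypothesis mfr : measurable_fun TB2 (fun v => complex.Re (f v) : Rm).
Hypothesis mfi : measurable_fun TB2 (fun v => complex.Im (f v) : Rm).

Lemma measurable_cmodT : measurable_fun setT (cmodT f).
Proof.
apply/(measurable_restrictT _ _).1; first exact: measurable_TB2.
by apply/measurable_EFinP; exact: measurable_fun_cmod.
Qed.

Lemma kernel_measurable zw : TB2 zw ->
  measurable_fun TB2 (fun v => (complex.Re (K zw v * f v)%R)%:E) /\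
  measurable_fun TB2 (fun v => (complex.Im (K zw v * f v)%R)%:E).
Proof.
move=> /domK[mKr mKi _]; split; apply/measurable_EFinP.
  rewrite (_ : (fun _ => _) = (fun v => complex.Re (K zw v) * complex.Re (f v) -
      complex.Im (K zw v) * complex.Im (f v))%R); last first.
    by apply/funext => v; case: (K zw v) => ? ?; case: (f v).
  by apply: measurable_funB; exact: measurable_funM.
rewrite (_ : (fun _ => _) = (fun v => complex.Re (K zw v) * complex.Im (f v) +
    complex.Im (K zw v) * complex.Re (f v))%R); last first.
  by apply/funext => v; case: (K zw v) => ? ?; case: (f v).
by apply: measurable_funD; exact: measurable_funM.
Qed.

Lemma kernel_int_le zw : TB2 zw ->
  \int[V2]_(v in TB2) (cmod (K zw v * f v)%R)%:E <= Gop b1 b2 c1 c2 (cmodT f) zw.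
Proof.
move=> zwT; rewrite integral_mkcond; apply: ge0_le_integral_nomeas => v _.
  by apply: erestrict_ge0 => x _; rewrite lee_fin cmod_ge0.
rewrite /cmodT /patch; case: ifPn => [/set_mem vT|_]; last by rewrite mule0.
rewrite -EFinM lee_fin cmodM ler_wpM2r ?cmod_ge0//.
by have [_ _ /(_ v vT)] := domK zwT.
Qed.

Lemma kernel_abs_le zw : TB2 zw ->
  \int[V2]_(v in TB2) `|(complex.Re (K zw v * f v)%R)%:E| <= Gop b1 b2 c1 c2 (cmodT f) zw /\
  \int[V2]_(v in TB2) `|(complex.Im (K zw v * f v)%R)%:E| <= Gop b1 b2 c1 c2 (cmodT f) zw.
Proof.
move=> zwT; split; (apply: le_trans (kernel_int_le zwT); apply: ge0_le_integral_nomeas => v _ //).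
- by rewrite abse_EFin lee_fin Re_le_cmod.
- by rewrite abse_EFin lee_fin Im_le_cmod.
Qed.

Lemma kernel_cintegrable zw : TB2 zw -> Gop b1 b2 c1 c2 (cmodT f) zw < +oo ->
  cintegrable V2 TB2 (fun v => K zw v * f v)%R.
Proof.
move=> zwT Gf; have [Hr Hi] := kernel_abs_le zwT; have [mr mi] := kernel_measurable zwT.
by split; apply/integrableP; split => //; exact: le_lt_trans Gf.
Qed.

(** [fine] sends both infinities to 0, so the bound also covers divergent integrals and [intop_le]
    holds at every point of the domain. *)
Lemma abs_fine_le (x : \bar R) : (`|fine x|%R)%:E <= `|x|.
Proof. by case: x => [r| |] //=; rewrite ?normr0 ?leey. Qed.

(** The real and imaginary parts of the integral are each bounded by the integral of the modulus,
    whence the 2; placed inside [Gop], it makes the right-hand side an instance of [mixed_bound]. *)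
Lemma intop_le a1 a2 zw : TB2 zw ->
  (cmod (intop (prefac a1 a2) K f zw))%:E <=
  (wgt a1 zw.1 * wgt a2 zw.2)%:E * Gop b1 b2 c1 c2 (fun v => 2%:E * cmodT f v) zw.
Proof.
move=> zwT; have [/= z0 w0] := (TB2P zw).1 zwT.
rewrite /intop cmodM /prefac cmod_realC ?mulr_ge0 ?powR_ge0// EFinM !wgt_pos//.
apply: lee_wpmul2l; first by rewrite lee_fin mulr_ge0 ?powR_ge0.
rewrite GopZ//; [|exact: measurable_cmodT|exact: cmodT_ge0].
apply: (@le_trans _ _ ((`|complex.Re (cint V2 TB2 (fun v => K zw v * f v)%R)| +
   `|complex.Im (cint V2 TB2 (fun v => K zw v * f v)%R)|)%R)%:E).
  by rewrite lee_fin cmod_le.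
have [Hr Hi] := kernel_abs_le zwT; have [mr mi] := kernel_measurable zwT.
have -> : 2%:E * Gop b1 b2 c1 c2 (cmodT f) zw =
    Gop b1 b2 c1 c2 (cmodT f) zw + Gop b1 b2 c1 c2 (cmodT f) zw.
  by rewrite -[2%R]/(1 + 1)%R EFinD ge0_muleDl// !mul1e.
rewrite EFinD; apply: leeD.
- apply: le_trans Hr; apply: le_trans (abs_fine_le _) _; exact: le_abse_integral measurable_TB2 mr.
- apply: le_trans Hi; apply: le_trans (abs_fine_le _) _; exact: le_abse_integral measurable_TB2 mi.
Qed.

End kernel.

(* Multiplying the indicator of the exceptional set by [+oo] keeps it below the integrand,
   so a finite mixed integral forces the exceptional set to be null. *)
Lemma mixint_fin_negligible (q1 q2 be1 be2 a1 a2 : R) (G : Cm * Cm -> \bar R) :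
  (0 < q1)%R -> (0 < q2)%R -> measurable_fun setT G -> (forall v, 0 <= G v) ->
  mixint q1 q2 be1 be2 (fun zw => (wgt a1 zw.1 * wgt a2 zw.2)%:E * G zw) < +oo ->
  V2.-negligible (TB2 `&` [set zw | G zw = +oo]).
Proof.
move=> q10 q20 mG G0 Mfin; set N := _ `&` _.
have mN : measurable N.
  apply: measurableI; first exact: measurable_TB2.
  rewrite (_ : [set zw | _] = setT `&` G @^-1` [set +oo]); last by rewrite setTI.
  exact: mG.
exists N; split => //.
pose i zw : \bar R := (\1_N zw)%:E.
have mi : measurable_fun setT i by apply/measurable_EFinP; exact: measurable_indic.
have i0 zw : 0 <= i zw by rewrite lee_fin indicE.
have VN : V2 N = \int[V]_w \int[V]_z i (z, w).
  have <- := integral_dV2_swap mi i0.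
  by have := @integral_indic _ _ R V2 setT measurableT N mN; rewrite setIT => <-.
apply/eqP; rewrite eq_le measure_ge0 andbT; apply/negPn/negP; rewrite -ltNge => VN0.
have : +oo * V2 N < +oo; last by rewrite gt0_mulye// ltxx.
have mI : measurable_fun setT (fun w => \int[V]_z i (z, w)).
  exact: (@measurable_fun_fubini_tonelli_G _ _ _ _ _ V i).
have I0 w : 0 <= \int[V]_z i (z, w) by exact: integral_ge0.
rewrite VN -ge0_integralZl//; apply: le_lt_trans Mfin.
apply: ge0_le_integral_nomeas => w _; first by rewrite mule_ge0.
have [w0|w0] := boolP (0 < rho w)%R; last first.
  rewrite [X in +oo * X](_ : _ = 0) ?mule0 ?mule_ge0 ?lee_fin ?wgt_ge0 ?poweR_ge0//.
  apply: integral0_eq => z _; rewrite /i indicE memNset// => -[/TB2P[_ /=]].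
  by rewrite (negbTE w0).
have [I1|I1] := eqVneq (\int[V]_z i (z, w)) 0.
  by rewrite I1 mule0 mule_ge0 ?lee_fin ?wgt_ge0 ?poweR_ge0.
suff -> : \int[V]_z ((wgt be1 z)%:E * ((wgt a1 z * wgt a2 w)%:E * G (z, w)) `^ q1) = +oo.
  by rewrite poweRyr ?gt_eqF ?divr_gt0// gt0_muley ?leey// lte_fin wgt_gt0.
apply/eqP; rewrite -leye_eq; apply: (@le_trans _ _ (+oo * \int[V]_z i (z, w))).
  by rewrite gt0_mulye// lt_def I1 I0.
have mz : measurable_fun setT (fun z => i (z, w)).
  exact: (measurableT_comp mi (pair2_measurable w)).
rewrite -ge0_integralZl//; apply: ge0_le_integral_nomeas => z _; first by rewrite mule_ge0.
rewrite /i indicE; case: (boolP (_ \in _)) => [/set_mem[/TB2P[/= z0 _] Gy]|_]; last first.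
  by rewrite mule0 mule_ge0 ?lee_fin ?wgt_ge0 ?poweR_ge0.
rewrite /= in Gy; rewrite Gy mule1 gt0_muley; last by rewrite lte_fin mulr_gt0 ?wgt_gt0.
by rewrite poweRyr ?gt_eqF// gt0_muley// lte_fin wgt_gt0.
Qed.

(** [mixed_bound] for |f| is used twice: its finiteness gives absolute convergence off a null set,
    and, applied to 2|f|, its value gives the norm inequality. Taking the q2-th root restores the
    homogeneity of degree one. *)
Theorem bounded_of_conditions (p2 q1 q2 a1 a2 b1 b2 c1 c2 al1 al2 be1 be2 : R)
    (K : Cm * Cm -> Cm * Cm -> R[i]) : kernel_dominated b1 b2 c1 c2 K ->
  (1 < p2)%R -> (p2 <= q1)%R -> (p2 <= q2)%R ->
  (al1 < b1)%R -> (al2 + 1 < p2 * (b2 + 1))%R ->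
  (- q1 * a1 < be1 + 1)%R -> (- q2 * a2 < be2 + 1)%R ->
  c1 = (n%:R + 1 + a1 + b1 + ((n%:R + 1 + be1) / q1 - (n%:R + 1 + al1)))%R ->
  c2 = (n%:R + 1 + a2 + b2 + ((n%:R + 1 + be2) / q2 - (n%:R + 1 + al2) / p2))%R ->
  bounded_intop (prefac a1 a2) K 1 p2 al1 al2 q1 q2 be1 be2.
Proof.
move=> domK p1 pq1 pq2 ab1 ab2 qa1 qa2 c1E c2E.
have [q10 q20] : (0 < q1)%R /\ (0 < q2)%R by split; lra.
have p0 : (0 < p2)%R by lra.
have [C C0 HC] := @mixed_bound R m p2 q1 q2 a1 a2 b1 b2 c1 c2 al1 al2 be1 be2
  p1 pq1 pq2 ab1 ab2 qa1 qa2 c1E c2E.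
exists (C `^ q2^-1 * 2)%R => f [mfr mfi ffin].
have mF := measurable_cmodT mfr mfi.
have F0 := @cmodT_ge0 f.
rewrite mixnormE in ffin.
have pV : (p2^-1 != 0)%R by rewrite invr_eq0 gt_eqF.
have M1 : mixint 1 p2 al1 al2 (cmodT f) < +oo by exact: lty_poweRy ffin.
split.
  exists (TB2 `&` [set zw | Gop b1 b2 c1 c2 (cmodT f) zw = +oo]); split.
    apply: (@mixint_fin_negligible q1 q2 be1 be2 a1 a2 (Gop b1 b2 c1 c2 (cmodT f)) q10 q20).
    - exact: measurable_Gop.
    - by move=> v; exact: Gop_ge0.
    apply: le_lt_trans (HC _ mF F0) _.
    rewrite lte_mul_pinfty ?lee_fin ?(ltW C0)//; exact: poweR_lty.
  move=> zw zwT Nzw; apply: (kernel_cintegrable domK) => //.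
  by rewrite ltey; apply/eqP => Gy; exact: Nzw.
rewrite !mixnormE.
have m2F : measurable_fun setT (fun v => 2%:E * cmodT f v) by exact: measurable_funeM.
have F20 v : 0 <= 2%:E * cmodT f v by rewrite mule_ge0 ?lee_fin.
have H := HC _ m2F F20; rewrite mixintZ// in H.
have {}H : mixint q1 q2 be1 be2 (cmodT (intop (prefac a1 a2) K f)) <=
    C%:E * ((2 `^ p2)%:E * mixint 1 p2 al1 al2 (cmodT f)) `^ (q2 / p2).
  apply: le_trans H; apply: mixint_le => //.
    exact: cmodT_ge0.
  move=> v; rewrite {1}/cmodT /patch; case: ifPn => [/set_mem vT|_].
    exact: (intop_le domK).
  by rewrite mule_ge0 ?lee_fin ?mulr_ge0 ?wgt_ge0// Gop_ge0.
have qV : (0 <= q2^-1)%R by rewrite invr_ge0 ltW.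
apply: le_trans (gt0_ler_poweR qV _ _ H) _.
- by rewrite in_itv/= leey andbT mixint_ge0.
- by rewrite in_itv/= leey andbT mule_ge0 ?poweR_ge0// lee_fin ltW.
have M0 := @mixint_ge0 R m 1 p2 al1 al2 (cmodT f).
rewrite poweRM ?poweR_ge0 ?lee_fin ?(ltW C0)// poweR_EFin -poweRrM mulrAC divff ?gt_eqF// mul1r.
rewrite poweRM ?lee_fin ?powR_ge0// poweR_EFin -powRrM divff ?gt_eqF// powRr1//.
by rewrite muleA -EFinM.
Qed.

End sufficiency.

(** * Necessity *)

Section box_integral.
Context (R : realType) (m : nat).
Local Notation Rm := (measurableTypeR R).
Local Notation leb := (@lebesgue_measure R).
Local Notation n := m.+1.
Local Notation Cm := (Cn R n).
Local Notation V := (@dV R n).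
Local Open Scope ereal_scope.

(** The height comes outermost because the size of the test boxes depends on it. *)
Lemma integral_dV_coord_outer (f : Cm -> \bar R) :
  measurable_fun setT f -> (forall z, 0 <= f z) ->
  \int[V]_z f z = \int[leb]_s \int[@lebT R m]_x \int[@lebT R m]_y \int[leb]_t
    f (coord x t y s).
Proof.
move=> mf f0; rewrite integral_dV_coord//.
pose T4 := (((m.-tuple Rm * m.-tuple Rm) * Rm) * Rm)%type.
have m4 : measurable_fun setT (fun p : T4 => f (coord p.1.1.1 p.2 p.1.1.2 p.1.2)).
  apply: (measurableT_comp mf); apply: measurable_coord => //.
  - exact: (measurableT_comp measurable_fst (measurableT_comp measurable_fst measurable_fst)).
  - exact: (measurableT_comp measurable_snd (measurableT_comp measurable_fst measurable_fst)).
  - exact: (measurableT_comp measurable_snd measurable_fst).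
pose h (p : (m.-tuple Rm * m.-tuple Rm) * Rm) := \int[leb]_t f (coord p.1.1 t p.1.2 p.2).
have mh : measurable_fun setT h.
  exact: (@measurable_fun_fubini_tonelli_F _ _ _ _ _ leb _ m4).
have h0 p : 0 <= h p by exact: integral_ge0.
transitivity (\int[@lebT R m]_x \int[leb]_s \int[@lebT R m]_y h ((x, y), s)).
  apply: eq_integral => x _.
  pose hx (p : m.-tuple Rm * Rm) := h ((x, p.1), p.2).
  have mhx : measurable_fun setT hx.
    apply: (measurableT_comp mh); apply: measurable_fun_pair => //.
    exact: measurable_fun_pair.
  exact: (fubini_tonelli hx mhx (fun p => h0 _)).
pose k (p : m.-tuple Rm * Rm) := \int[@lebT R m]_y h ((p.1, y), p.2).
have mk : measurable_fun setT k.
  apply: (@measurable_fun_fubini_tonelli_F _ _ _ _ _ (@lebT R m)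
    (fun q : (m.-tuple Rm * Rm) * m.-tuple Rm => h ((q.1.1, q.2), q.1.2))) => //.
  apply: (measurableT_comp mh); apply: measurable_fun_pair.
    apply: measurable_fun_pair => //.
    exact: (measurableT_comp measurable_fst measurable_fst).
  exact: (measurableT_comp measurable_snd measurable_fst).
have k0 p : 0 <= k p by exact: integral_ge0.
exact: (fubini_tonelli k mk k0).
Qed.

Definition le01 (a b : R) : R := ((a <= b)%R)%:R%R.

Lemma le01_ge0 a b : (0 <= le01 a b)%R.
Proof. by rewrite ler0n. Qed.

Definition cube k (r : R) (x : k.-tuple Rm) : R :=
  (\prod_(j < k) le01 `|nth 0 (x : seq R) j| r)%R.

Lemma measurable_abs_le d (T : measurableType d) (f g : T -> Rm) :
  measurable_fun setT f -> measurable_fun setT g ->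
  measurable_fun setT (fun x => le01 `|f x| (g x) : Rm).
Proof.
move=> mf mg.
have mD : measurable [set x | (`|f x| <= g x)%R].
  have -> : [set x | (`|f x| <= g x)%R] = setT `&` [set x | (`|f x| - g x <= 0)%R].
    by apply/seteqP; split => x /=; rewrite subr_le0 // => -[].
  apply: (@measurable_fun_le _ _ R _ (fun x => `|f x| - g x)%R (cst 0%R)) => //.
  by apply: measurable_funB => //; exact: measurableT_comp.
rewrite (_ : (fun _ => _) = \1_[set x | (`|f x| <= g x)%R]); first exact: measurable_indic.
by apply/funext => x; rewrite indicE mem_setE /le01.
Qed.

Lemma cube_ge0 k r x : (0 <= @cube k r x)%R.
Proof. by apply: prodr_ge0 => j _; exact: le01_ge0. Qed.

Lemma measurable_cube k r : measurable_fun setT (@cube k r : _ -> Rm).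
Proof.
apply: measurable_prod => j _; apply: measurable_abs_le => //.
exact: measurable_nth_tuple.
Qed.

Lemma integral_abs_le (r : R) : (0 <= r)%R ->
  \int[leb]_t (le01 `|t| r)%:E = (2 * r)%:E.
Proof.
move=> r0.
transitivity (\int[leb]_t (\1_(`[(- r)%R, r]%classic : set Rm) t)%:E).
  by apply: eq_integral => t _; rewrite indicE mem_setE/= in_itv/= /le01 ler_norml.
rewrite integral_indic// setIT.
have := @lebesgue_measure_itv R `[(- r)%R, r] => /= ->; rewrite lte_fin.
case: ltP => [_|rr]; first by rewrite -EFinB opprK mulr_natl mulr2n.
by have -> : r = 0%R; [lra|rewrite mulr0].
Qed.

Lemma integral_cube k (r : R) : (0 <= r)%R ->
  \int[@lebT R k]_x (cube r x)%:E = ((2 * r) ^+ k)%:E.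
Proof.
move=> r0; elim: k => [|k IH].
  rewrite integral_lebT0; first by rewrite /cube big_ord0 expr0.
  by apply/measurable_EFinP; exact: measurable_cube.
rewrite integral_lebT_cons; last 2 first.
- by apply/measurable_EFinP; exact: measurable_cube.
- by move=> x; rewrite lee_fin cube_ge0.
transitivity (\int[leb]_t ((le01 `|t| r)%:E * ((2 * r) ^+ k)%:E)).
  apply: eq_integral => t _; rewrite -IH -ge0_integralZl ?lee_fin ?le01_ge0//; last 2 first.
  - by apply/measurable_EFinP; exact: measurable_cube.
  - by move=> x _; rewrite lee_fin cube_ge0.
  by apply: eq_integral => x _; rewrite /cube big_ord_recl/= EFinM.
have mt : measurable_fun setT (fun t : Rm => (le01 `|t| r)%:E).
  by apply/measurable_EFinP; apply: measurable_abs_le.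
have t0 (t : Rm) : setT t -> 0 <= (le01 `|t| r)%:E by rewrite lee_fin le01_ge0.
have r1 : 0 <= ((2 * r) ^+ k)%:E by rewrite lee_fin exprn_ge0// mulr_ge0.
by rewrite (ge0_integralZr _ measurableT mt t0 r1) integral_abs_le// -EFinM exprS.
Qed.

(* [bxg e g lo hi] is the indicator of a box whose size at height [s = rho z] is
   [e * sqrt (g s)] in the first m complex directions and [e * g s] in the last real one,
   matching the anisotropic dilations of the tube domain. *)
Definition bxg (e : R) (g : R -> R) (lo hi : R) (z : Cm) : R :=
  ((\prod_(j < m) le01 `|xc z j| (e * Num.sqrt (g (rho z)))) *
   (\prod_(j < m) le01 `|yc z j| (e * Num.sqrt (g (rho z)))) *
   le01 `|xc z m| (e * g (rho z)) * (lo <= rho z <= hi)%R%:R)%R.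

Lemma bxg_ge0 e g lo hi z : (0 <= bxg e g lo hi z)%R.
Proof. by rewrite !mulr_ge0 ?le01_ge0 ?ler0n ?prodr_ge0//; move=> j _; rewrite le01_ge0. Qed.

Lemma bxg_neq0 e g lo hi z : bxg e g lo hi z != 0%R ->
  [/\ bxg e g lo hi z = 1%R, (lo <= rho z <= hi)%R, (`|xc z m| <= e * g (rho z))%R,
   (forall j : 'I_m, `|xc z j| <= e * Num.sqrt (g (rho z)))%R &
   (forall j : 'I_m, `|yc z j| <= e * Num.sqrt (g (rho z)))%R].
Proof.
rewrite /bxg {3}/le01 !mulf_eq0 !negb_or !pnatr_eq0 !eqb0 !negbK => /andP[/andP[/andP[px py] xm] lh].
have hx (j : 'I_m) : (`|xc z j| <= e * Num.sqrt (g (rho z)))%R.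
  by apply: contraNT px => h; apply/eqP; rewrite (bigD1 j)//= /le01 (negbTE h) mul0r.
have hy (j : 'I_m) : (`|yc z j| <= e * Num.sqrt (g (rho z)))%R.
  by apply: contraNT py => h; apply/eqP; rewrite (bigD1 j)//= /le01 (negbTE h) mul0r.
split => //; rewrite {3}/le01 xm lh !mulr1 !big1 ?mulr1// => j _; rewrite /le01.
- by rewrite hy.
- by rewrite hx.
Qed.

Lemma bxg_powR e g lo hi z (p : R) : (p != 0)%R -> (bxg e g lo hi z `^ p = bxg e g lo hi z)%R.
Proof.
move=> p0; have [->|/bxg_neq0[-> _ _ _ _]] := eqVneq (bxg e g lo hi z) 0%R.
  by rewrite powR0.
by rewrite powR1.
Qed.

Lemma measurable_bxg e g lo hi : measurable_fun setT (g : Rm -> Rm) ->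
  measurable_fun setT (bxg e g lo hi : _ -> Rm).
Proof.
move=> mg.
have mgr : measurable_fun setT (fun z : Cm => g (rho z) : Rm).
  exact: (measurableT_comp mg (@measurable_rho R m)).
have msg : measurable_fun setT (fun z : Cm => e * Num.sqrt (g (rho z)) : Rm)%R.
  apply: measurable_funM => //.
  exact: (measurableT_comp (continuous_measurable_fun (@sqrt_continuous R)) mgr).
apply: measurable_funM; first apply: measurable_funM; first apply: measurable_funM.
- by apply: measurable_prod => j _; apply: measurable_abs_le => //; exact: measurable_xc.
- by apply: measurable_prod => j _; apply: measurable_abs_le => //; exact: measurable_yc.
- by apply: measurable_abs_le; [exact: measurable_xc|exact: measurable_funM].
- rewrite (_ : (fun _ => _) = (\1_(`[lo, hi]%classic : set Rm) \o (fun z : Cm => rho z))); last first.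
    by apply/funext => z; rewrite /= indicE mem_setE/= in_itv.
  apply: measurableT_comp; [exact: measurable_indic|exact: measurable_rho].
Qed.

(** A slice at height s has m + n = 2m + 1 real directions: 2m of half-width e sqrt(g s) and one of
    half-width e g s, hence volume (2e)^(m+n) (g s)^n. *)
Lemma integral_bxg e g lo hi (h : R -> R) : (0 < e)%R ->
  measurable_fun setT (g : Rm -> Rm) -> measurable_fun setT (h : Rm -> Rm) ->
  (forall s, 0 <= h s)%R -> (forall s, lo <= s <= hi -> 0 <= g s)%R ->
  \int[V]_z (bxg e g lo hi z * h (rho z))%:E =
  ((2 * e) ^+ (m + n))%:E * \int[leb]_(s in `[lo, hi]) (h s * g s ^+ n)%:E.
Proof.
move=> e0 mg mh h0 g0.
have mb := @measurable_bxg e g lo hi mg.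
have mhr : measurable_fun setT (fun z : Cm => h (rho z) : Rm).
  exact: (measurableT_comp mh (@measurable_rho R m)).
rewrite integral_dV_coord_outer; last 2 first.
- by apply/measurable_EFinP; exact: measurable_funM.
- by move=> z; rewrite lee_fin mulr_ge0 ?bxg_ge0.
rewrite [in RHS]integral_mkcond -[RHS]ge0_integralZl//; last 3 first.
- apply/(measurable_restrictT _ _).1 => //; apply/measurable_EFinP; apply: measurable_funTS.
  by apply: measurable_funM => //; exact: measurable_funX.
- move=> s _; apply: erestrict_ge0 => {}s /=; rewrite in_itv/= => /g0 gs.
  by rewrite lee_fin mulr_ge0 ?exprn_ge0.
- by rewrite lee_fin exprn_ge0// mulr_ge0// ltW.
apply: eq_integral => s _; rewrite /patch mem_setE/= in_itv/=.
have E x y t : bxg e g lo hi (coord x t y s) =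
  (cube (e * Num.sqrt (g s)) x * cube (e * Num.sqrt (g s)) y *
   le01 `|t| (e * g s) * (lo <= s <= hi)%R%:R)%R.
  rewrite /bxg rho_coord xc_coord_last /cube; congr (_ * _ * _ * _)%R.
  - by apply: eq_bigr => j _; rewrite xc_coord.
  - by apply: eq_bigr => j _; rewrite yc_coord.
case: ifPn => lh; last first.
  rewrite mule0; apply: integral0_eq => x _; apply: integral0_eq => y _.
  by apply: integral0_eq => t _; rewrite E (negbTE lh) mulr0 mul0r.
have gs := g0 s lh; set r := (e * Num.sqrt (g s))%R in E.
have r0 : (0 <= r)%R by rewrite mulr_ge0 ?sqrtr_ge0 ?ltW.
have eg0 : (0 <= e * g s)%R by rewrite mulr_ge0// ltW.
have It x y : \int[leb]_t (bxg e g lo hi (coord x t y s) * h (rho (coord x t y s)))%:E =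
    (cube r x)%:E * ((2 * (e * g s) * h s)%:E * (cube r y)%:E).
  transitivity (\int[leb]_t ((cube r x * cube r y * h s)%:E * (le01 `|t| (e * g s))%:E)).
    apply: eq_integral => t _; rewrite E lh rho_coord mulr1 -EFinM; congr EFin; ring.
  rewrite ge0_integralZl ?lee_fin ?mulr_ge0 ?cube_ge0//; last 2 first.
  - by apply/measurable_EFinP; exact: measurable_abs_le.
  - by move=> t _; rewrite lee_fin le01_ge0.
  by rewrite integral_abs_le// -!EFinM; congr EFin; ring.
have Iy x : \int[@lebT R m]_y \int[leb]_t
    (bxg e g lo hi (coord x t y s) * h (rho (coord x t y s)))%:E =
    ((2 * (e * g s) * h s) * (2 * r) ^+ m)%:E * (cube r x)%:E.
  under eq_integral do rewrite It.
  have mc : measurable_fun setT (fun y : m.-tuple Rm => (cube r y)%:E).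
    by apply/measurable_EFinP; exact: measurable_cube.
  rewrite ge0_integralZl ?lee_fin ?cube_ge0//; last 2 first.
  - exact: measurable_funeM.
  - by move=> y _; rewrite -EFinM lee_fin !mulr_ge0 ?cube_ge0 ?(ltW e0).
  rewrite ge0_integralZl ?lee_fin ?mulr_ge0 ?(ltW e0)//; last first.
    by move=> y _; rewrite lee_fin cube_ge0.
  by rewrite integral_cube// -EFinM muleC.
under eq_integral do rewrite Iy.
rewrite ge0_integralZl ?lee_fin ?mulr_ge0 ?exprn_ge0 ?mulr_ge0 ?(ltW e0)//; last 2 first.
- by apply/measurable_EFinP; exact: measurable_cube.
- by move=> x _; rewrite lee_fin cube_ge0.
rewrite integral_cube// -!EFinM; congr EFin.
have -> : ((2 * r) ^+ m = (2 * e) ^+ m * Num.sqrt (g s) ^+ m)%R by rewrite -exprMn /r mulrA.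
have sg : (Num.sqrt (g s) ^+ m * Num.sqrt (g s) ^+ m = g s ^+ m)%R.
  by rewrite -exprMn -expr2 sqr_sqrtr.
rewrite exprD !exprS -sg; ring.
Qed.

End box_integral.

(** * The test inequality on product functions *)

Section testing.
Context (R : realType) (m : nat).
Local Notation Rm := (measurableTypeR R).
Local Notation n := m.+1.
Local Notation Cm := (Cn R n).
Local Notation V := (@dV R n).
Local Notation V2 := (@dV2 R n).
Local Notation TB2 := (@TB R n `*` @TB R n).

Lemma sum_ord_le (F : 'I_m -> R) (B : R) : (forall j, F j <= B) ->
  \sum_(j < m) F j <= m%:R * B.
Proof.
move=> FB; apply: (@le_trans _ _ (\sum_(j < m) B)); first exact: ler_sum.
by rewrite sumr_const card_ord mulr_natl.
Qed.

(** In the real part the heights contribute between r/2 and 2r. Every other term of rho(z,u) is at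
    most a constant times e r: squares of differences because half-widths are e sqrt r and e^2 <= e,
    and Re z_n - Re u_n because its half-width is e r. So the modulus is of size r and the argument
    of order e. *)
Lemma kmod_box (e r : R) (z u : Cm) : 0 < e -> e <= 1 -> 0 < r ->
  0 < rho z -> 0 < rho u ->
  (forall j : 'I_m, `|xc z j| <= e * Num.sqrt r) ->
  (forall j : 'I_m, `|yc z j| <= e * Num.sqrt r) ->
  (forall j : 'I_m, `|xc u j| <= e * Num.sqrt r) ->
  (forall j : 'I_m, `|yc u j| <= e * Num.sqrt r) ->
  `|xc z m| <= e * r -> `|xc u m| <= e * r ->
  r <= rho z + rho u -> rho z + rho u <= 4 * r ->
  [/\ 2^-1 * r <= kmod z u, kmod z u <= (3 + 4 * m%:R) * r &
    `|complex.Im (rho2 z u)| <= (2 + 4 * m%:R) * e * complex.Re (rho2 z u)].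
Proof.
move=> e0 e1 r0 z0 u0 xz yz xu yu xzm xum lo hi.
have m0 : 0 <= m%:R :> R by [].
have sr : Num.sqrt r * Num.sqrt r = r by rewrite -expr2 sqr_sqrtr// ltW.
have d2 (a b : R) : `|a| <= e * Num.sqrt r -> `|b| <= e * Num.sqrt r ->
    `|a + b| <= 2 * (e * Num.sqrt r).
  by move=> ha hb; apply: le_trans (ler_normD _ _) _; rewrite mulr_natl mulr2n lerD.
have e2 : e * e <= e by rewrite ler_piMl// ltW.
have sq (a b : R) : `|a| <= 2 * (e * Num.sqrt r) -> `|b| <= 2 * (e * Num.sqrt r) ->
    `|a * b| <= 4 * e * r.
  move=> ha hb; rewrite normrM.
  apply: (@le_trans _ _ (2 * (e * Num.sqrt r) * (2 * (e * Num.sqrt r)))); first exact: ler_pM.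
  have -> : 2 * (e * Num.sqrt r) * (2 * (e * Num.sqrt r)) =
    4 * (e * e) * (Num.sqrt r * Num.sqrt r) by ring.
  by rewrite sr ler_wpM2r ?(ltW r0)// ler_wpM2l.
have er : e * r <= r by rewrite ler_piMl// ltW.
have er0 : 0 < e * r by rewrite mulr_gt0.
set X := \sum_(j < m) (xc u j - xc z j) ^+ 2.
set Y := \sum_(j < m) (yc u j - yc z j) ^+ 2.
set S := \sum_(j < m) (xc u j - xc z j) * (yc u j + yc z j).
have X0 : 0 <= X by apply: sumr_ge0 => j _; exact: sqr_ge0.
have Y0 : 0 <= Y by apply: sumr_ge0 => j _; exact: sqr_ge0.
have XB : X <= m%:R * (4 * e * r).
  apply: sum_ord_le => j; rewrite expr2; apply: le_trans (ler_norm _) _.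
  by apply: sq; apply: d2; rewrite ?normrN.
have YB : Y <= m%:R * (4 * e * r).
  apply: sum_ord_le => j; rewrite expr2; apply: le_trans (ler_norm _) _.
  by apply: sq; apply: d2; rewrite ?normrN.
have SB : `|S| <= m%:R * (4 * e * r).
  apply: le_trans (ler_norm_sum _ _ _) _; apply: sum_ord_le => j.
  by apply: sq; apply: d2; rewrite ?normrN.
have TB : `|xc u m - xc z m| <= 2 * (e * r).
  by apply: le_trans (ler_normB _ _) _; rewrite mulr_natl mulr2n lerD.
have Er : complex.Re (rho2 z u) = (2 * (rho z + rho u) + X + Y) / 4.
  by rewrite rho2E/= -/X -/Y; field.
have Ei : complex.Im (rho2 z u) = (2 * (xc u m - xc z m) - 2 * S) / 4 by rewrite rho2E.
have mer : m%:R * (e * r) <= m%:R * r by rewrite ler_wpM2l.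
have XB' : X <= 4 * (m%:R * (e * r)) by apply: le_trans XB _; rewrite le_eqVlt; apply/orP; left; apply/eqP; ring.
have YB' : Y <= 4 * (m%:R * (e * r)) by apply: le_trans YB _; rewrite le_eqVlt; apply/orP; left; apply/eqP; ring.
have SB' : `|S| <= 4 * (m%:R * (e * r)) by apply: le_trans SB _; rewrite le_eqVlt; apply/orP; left; apply/eqP; ring.
have Re_ge : 2^-1 * r <= complex.Re (rho2 z u) by rewrite Er; lra.
have Re_le : complex.Re (rho2 z u) <= 2 * r + 2 * (m%:R * r) by rewrite Er; lra.
have Im_le : `|complex.Im (rho2 z u)| <= e * r + 2 * (m%:R * (e * r)).
  rewrite Ei; move: SB' TB; rewrite !ler_norml => /andP[? ?] /andP[? ?].
  by apply/andP; split; lra.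
have Re0 : 0 <= complex.Re (rho2 z u) by apply: le_trans Re_ge; rewrite mulr_ge0// ltW.
split.
- by apply: le_trans (Re_le_cmod _); apply: le_trans (ler_norm _).
- apply: le_trans (cmod_le _) _; rewrite (ger0_norm Re0).
  have -> : (3 + 4 * m%:R) * r = 3 * r + 4 * (m%:R * r) by ring.
  by lra.
- apply: le_trans Im_le _.
  have -> : e * r + 2 * (m%:R * (e * r)) = (2 + 4 * m%:R) * e * (2^-1 * r) by field.
  by rewrite ler_wpM2l// mulr_ge0 ?(ltW e0)//; lra.
Qed.

Lemma KnM b1 b2 c1 c2 (zw v : Cm * Cm) (x y : R) : Kn b1 b2 c1 c2 zw v * (x * y) =
  (kmod zw.1 v.1 `^ (- c1) * kmod zw.2 v.2 `^ (- c2)) * ((wgt b1 v.1 * x) * (wgt b2 v.2 * y)).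
Proof. by rewrite /Kn [RHS]mulrC [LHS]mulrAC; congr (_ * _); exact: mulrACA. Qed.

Lemma powR_between (a b x e : R) : 0 < a -> a <= x -> x <= b ->
  Num.min (a `^ e) (b `^ e) <= x `^ e <= Num.max (a `^ e) (b `^ e).
Proof.
move=> a0 ax xb; have x0 : 0 < x by exact: lt_le_trans ax.
have b0 : 0 < b by exact: lt_le_trans xb.
have [e0|e0] := leP 0 e.
  have H y y' : 0 < y -> y <= y' -> y `^ e <= y' `^ e.
    move=> y0 yy; apply: ge0_ler_powR; rewrite ?nnegrE ?(ltW y0)//.
    exact: le_trans (ltW y0) yy.
  by rewrite ge_min le_max (H x b)// (H a x)// orbT.
have E y : y `^ e = (y `^ (- e))^-1 by rewrite -powRN opprK.
have H y y' : 0 < y -> y <= y' -> y' `^ e <= y `^ e.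
  move=> y0 yy; have y'0 : 0 < y' by exact: lt_le_trans yy.
  rewrite !(E _) lef_pV2 ?posrE ?powR_gt0//.
  by apply: ge0_ler_powR; rewrite ?nnegrE ?(ltW y0) ?(ltW y'0)// oppr_ge0 ltW.
by rewrite ge_min le_max (H x b)// (H a x)// orbT.
Qed.

(** A lower bound on the real part is all the tests need: inside the sector it prevents cancellation
    against a nonnegative density, and d is free because the boxes can be made as thin as
    required. *)
Definition kernel_sector (d b1 b2 c1 c2 : R) (K : Cm * Cm -> Cm * Cm -> R[i]) :=
  forall zw v, TB2 zw -> TB2 v ->
    `|complex.Im (rho2 zw.1 v.1)| <= d * complex.Re (rho2 zw.1 v.1) ->
    `|complex.Im (rho2 zw.2 v.2)| <= d * complex.Re (rho2 zw.2 v.2) ->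
    Kn b1 b2 c1 c2 zw v / 2 <= complex.Re (K zw v).

(* [k z] bounds the kernel from below, up to a constant factor [M] sharply, for z in the
   support of [k] and u in the support of [phi], where moreover the kernel is nearly real. *)
Record admissible (d c M : R) (phi k : Cm -> R) : Prop := {
  adm_mphi : measurable_fun setT (phi : _ -> Rm);
  adm_mk : measurable_fun setT (k : _ -> Rm);
  adm_phi0 : forall u, 0 <= phi u;
  adm_k0 : forall z, 0 <= k z;
  adm_phiT : forall u, phi u != 0 -> 0 < rho u;
  adm_kT : forall z, k z != 0 -> 0 < rho z;
  adm_ker : forall z u, k z != 0 -> phi u != 0 ->
    [/\ `|complex.Im (rho2 z u)| <= d * complex.Re (rho2 z u),
      k z <= kmod z u `^ (- c) & kmod z u `^ (- c) <= M * k z] }.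

Local Open Scope ereal_scope.

Lemma integral_dV2_prod (A B : Cm -> R) :
  measurable_fun setT (A : _ -> Rm) -> measurable_fun setT (B : _ -> Rm) ->
  (forall z, 0 <= A z)%R -> (forall z, 0 <= B z)%R ->
  \int[V2]_v (A v.1 * B v.2)%:E = (\int[V]_z (A z)%:E) * (\int[V]_z (B z)%:E).
Proof.
move=> mA mB A0 B0.
have mAB : measurable_fun setT (fun v : Cm * Cm => (A v.1 * B v.2)%:E).
  apply/measurable_EFinP; apply: measurable_funM.
    exact: (measurableT_comp mA measurable_fst).
  exact: (measurableT_comp mB measurable_snd).
have AB0 (v : Cm * Cm) : 0 <= (A v.1 * B v.2)%:E by rewrite lee_fin mulr_ge0.
rewrite (integral_dV2 mAB AB0)/=.
have mAE : measurable_fun setT (fun z => (A z)%:E) by exact/measurable_EFinP.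
have mBE : measurable_fun setT (fun z => (B z)%:E) by exact/measurable_EFinP.
rewrite -ge0_integralZr//.
- apply: eq_integral => z _; rewrite -ge0_integralZl ?lee_fin//.
  by move=> w _; rewrite lee_fin.
- by move=> z _; rewrite lee_fin.
- by apply: integral_ge0 => z _; rewrite lee_fin.
Qed.

(** The exponent p2 / p1 on the inner integral turns B(w)^p1 into B(w)^p2, so the mixed integral
    separates. *)
Lemma mixint_prod (p1 p2 al1 al2 : R) (A B : Cm -> R) : (0 < p1)%R -> (0 < p2)%R ->
  measurable_fun setT (A : _ -> Rm) -> measurable_fun setT (B : _ -> Rm) ->
  (forall z, 0 <= A z)%R -> (forall z, 0 <= B z)%R ->
  mixint p1 p2 al1 al2 (fun v => (A v.1 * B v.2)%:E) =
  (\int[V]_z (wgt al1 z * A z `^ p1)%:E) `^ (p2 / p1) * \int[V]_w (wgt al2 w * B w `^ p2)%:E.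
Proof.
move=> p10 p20 mA mB A0 B0; rewrite /mixint/=.
have mw (F : Cm -> R) al p : measurable_fun setT (F : _ -> Rm) ->
    measurable_fun setT (fun z => (wgt al z * F z `^ p)%:E).
  move=> mF; apply/measurable_EFinP; apply: measurable_funM; first exact: measurable_wgt.
  exact: (measurableT_comp (measurable_powR p) mF).
have w0 (F : Cm -> R) al p z : 0 <= (wgt al z * F z `^ p)%:E.
  by rewrite lee_fin mulr_ge0 ?wgt_ge0 ?powR_ge0.
set LA := \int[V]_z (wgt al1 z * A z `^ p1)%:E.
have LA0 : 0 <= LA by apply: integral_ge0 => z _; exact: w0.
rewrite -ge0_integralZl ?poweR_ge0//; last exact: mw.
apply: eq_integral => w _.
have -> : \int[V]_z ((wgt al1 z)%:E * (A z * B w)%:E `^ p1) = (B w `^ p1)%:E * LA.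
  rewrite -ge0_integralZl ?lee_fin ?powR_ge0//; last exact: mw.
  apply: eq_integral => z _; rewrite poweR_EFin -!EFinM powRM//; congr EFin; ring.
rewrite poweRM ?lee_fin ?powR_ge0// poweR_EFin -powRrM.
have -> : (p1 * (p2 / p1) = p2)%R by rewrite mulrCA divff ?gt_eqF// mulr1.
by rewrite muleA -EFinM muleC.
Qed.

Section test_inequality.
Variables (p2 q1 q2 a1 a2 b1 b2 c1 c2 al1 al2 be1 be2 d : R).
Variable K : Cm * Cm -> Cm * Cm -> R[i].
Hypotheses (domK : kernel_dominated b1 b2 c1 c2 K) (secK : kernel_sector d b1 b2 c1 c2 K).
Hypotheses (p20 : (0 < p2)%R) (q10 : (0 < q1)%R) (q20 : (0 < q2)%R).
Variables (M1 M2 : R) (phi1 k1 phi2 k2 : Cm -> R).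
Hypotheses (adm1 : admissible d c1 M1 phi1 k1) (adm2 : admissible d c2 M2 phi2 k2).
Variables (i1 i2 : R).
Hypotheses (I1 : \int[V]_u (wgt b1 u * phi1 u)%:E = i1%:E).
Hypotheses (I2 : \int[V]_u (wgt b2 u * phi2 u)%:E = i2%:E).

Let f (v : Cm * Cm) : R[i] := realC (phi1 v.1 * phi2 v.2)%R.

Let f_ge0 (v : Cm * Cm) : (0 <= phi1 v.1 * phi2 v.2)%R.
Proof. by rewrite mulr_ge0//; [exact: adm_phi0 adm1 _|exact: adm_phi0 adm2 _]. Qed.

Let cmodTf v : cmodT f v = (phi1 v.1 * phi2 v.2)%:E.
Proof.
rewrite /cmodT /patch; case: ifPn => [_|vT]; first by rewrite cmod_realC.
have [->|h1] := eqVneq (phi1 v.1) 0%R; first by rewrite mul0r.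
have [->|h2] := eqVneq (phi2 v.2) 0%R; first by rewrite mulr0.
move/negP : vT; case; apply/mem_set/TB2P.
by split; [exact: adm_phiT adm1 _ h1|exact: adm_phiT adm2 _ h2].
Qed.

Let mphi1 := adm_mphi adm1.
Let mphi2 := adm_mphi adm2.

Let mf : measurable_fun setT (fun v : Cm * Cm => phi1 v.1 * phi2 v.2 : Rm)%R.
Proof.
apply: measurable_funM.
  exact: (measurableT_comp mphi1 measurable_fst).
exact: (measurableT_comp mphi2 measurable_snd).
Qed.

Let mfr : measurable_fun TB2 (fun v => complex.Re (f v) : Rm).
Proof. by apply: measurable_funTS; exact: mf. Qed.

Let mfi : measurable_fun TB2 (fun v => complex.Im (f v) : Rm).
Proof. exact: measurable_cst. Qed.

Let prodI (k : R) : (0 <= k)%R ->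
  \int[V2]_v (k * ((wgt b1 v.1 * phi1 v.1) * (wgt b2 v.2 * phi2 v.2)))%:E = (k * (i1 * i2))%:E.
Proof.
move=> k0.
have mw (F : Cm -> R) b : measurable_fun setT (F : _ -> Rm) ->
    measurable_fun setT (fun z => wgt b z * F z : Rm)%R.
  by move=> mF; apply: measurable_funM => //; exact: measurable_wgt.
have p1 z : (0 <= wgt b1 z * phi1 z)%R by rewrite mulr_ge0 ?wgt_ge0//; exact: adm_phi0 adm1 _.
have p2' z : (0 <= wgt b2 z * phi2 z)%R by rewrite mulr_ge0 ?wgt_ge0//; exact: adm_phi0 adm2 _.
under eq_integral do rewrite EFinM.
rewrite ge0_integralZl ?lee_fin//; last 2 first.
- apply/measurable_EFinP; apply: measurable_funM.
    exact: (measurableT_comp (mw _ b1 mphi1) measurable_fst).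
  exact: (measurableT_comp (mw _ b2 mphi2) measurable_snd).
- by move=> v _; rewrite lee_fin mulr_ge0.
rewrite (integral_dV2_prod (mw _ b1 mphi1) (mw _ b2 mphi2) p1 p2') I1 I2.
by rewrite -!EFinM.
Qed.

(** On the supports both factors are nearly real, so Re K is at least half of k1 k2 times the
    weights in (u, eta), and the integral of the test density separates into i1 i2. *)
Let intop_ge zw : ((wgt a1 zw.1 * k1 zw.1) * (wgt a2 zw.2 * k2 zw.2) * (i1 * i2 / 2))%:E <=
  cmodT (intop (prefac a1 a2) K f) zw.
Proof.
have [h1|h1] := eqVneq (k1 zw.1) 0%R; first by rewrite h1 !(mulr0, mul0r) cmodT_ge0.
have [h2|h2] := eqVneq (k2 zw.2) 0%R; first by rewrite h2 !(mulr0, mul0r) cmodT_ge0.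
have z0 := adm_kT adm1 h1; have w0 := adm_kT adm2 h2.
have zwT : TB2 zw by apply/TB2P.
have k10 := adm_k0 adm1 zw.1; have k20 := adm_k0 adm2 zw.2.
have phi10 := adm_phi0 adm1; have phi20 := adm_phi0 adm2.
(* [cint] goes through [fine], so a lower bound is meaningful only once the integral is known to be
   finite; the upper half of [adm_ker] provides this. The absolute values are there because
   [admissible] records no sign for M. *)
have ker v : (Kn b1 b2 c1 c2 zw v * (phi1 v.1 * phi2 v.2) <=
    `|M1| * k1 zw.1 * (`|M2| * k2 zw.2) * ((wgt b1 v.1 * phi1 v.1) * (wgt b2 v.2 * phi2 v.2)))%R.
  have [g1|g1] := eqVneq (phi1 v.1) 0%R; first by rewrite g1 !(mul0r, mulr0).
  have [g2|g2] := eqVneq (phi2 v.2) 0%R; first by rewrite g2 !(mul0r, mulr0).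
  have [_ _ u1] := adm_ker adm1 h1 g1; have [_ _ u2] := adm_ker adm2 h2 g2.
  have -> : (Kn b1 b2 c1 c2 zw v * (phi1 v.1 * phi2 v.2) =
    (kmod zw.1 v.1 `^ (- c1) * kmod zw.2 v.2 `^ (- c2)) *
    ((wgt b1 v.1 * phi1 v.1) * (wgt b2 v.2 * phi2 v.2)))%R by rewrite KnM.
  rewrite ler_wpM2r ?mulr_ge0 ?wgt_ge0//; apply: ler_pM; rewrite ?powR_ge0//.
  - by apply: le_trans u1 _; rewrite ler_wpM2r// ler_norm.
  - by apply: le_trans u2 _; rewrite ler_wpM2r// ler_norm.
have Gfin : Gop b1 b2 c1 c2 (cmodT f) zw < +oo.
  apply: (@le_lt_trans _ _ (\int[V2]_v (`|M1| * k1 zw.1 * (`|M2| * k2 zw.2) *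
     ((wgt b1 v.1 * phi1 v.1) * (wgt b2 v.2 * phi2 v.2)))%:E)); last first.
    by rewrite prodI ?ltry// !mulr_ge0.
  apply: ge0_le_integral_nomeas => v _.
    by rewrite mule_ge0 ?cmodT_ge0// lee_fin Kn_ge0.
  by rewrite cmodTf -EFinM lee_fin.
have [Hr _] := kernel_cintegrable domK mfr mfi zwT Gfin.
have fr := integrable_fin_num (@measurable_TB2 R m) Hr.
rewrite /cmodT /patch mem_set// /intop cmodM /prefac cmod_realC ?mulr_ge0 ?powR_ge0//.
rewrite !wgt_pos//.
apply: (@le_trans _ _ ((rho zw.1 `^ a1 * rho zw.2 `^ a2)%:E *
   (fine (\int[V2]_(v in TB2) (complex.Re (K zw v * f v)%R)%:E))%:E)); last first.
  rewrite -EFinM lee_fin ler_wpM2l ?mulr_ge0 ?powR_ge0//.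
  exact: le_trans (ler_norm _) (Re_le_cmod (cint V2 TB2 (fun v => K zw v * f v)%R)).
rewrite fineK//.
have -> : ((rho zw.1 `^ a1 * k1 zw.1) * (rho zw.2 `^ a2 * k2 zw.2) * (i1 * i2 / 2))%:E =
   (rho zw.1 `^ a1 * rho zw.2 `^ a2)%:E * ((k1 zw.1 * k2 zw.2 / 2) * (i1 * i2))%:E.
  by rewrite -EFinM; congr EFin; ring.
apply: lee_wpmul2l; first by rewrite lee_fin mulr_ge0 ?powR_ge0.
rewrite -prodI ?divr_ge0 ?mulr_ge0// [leRHS]integral_mkcond.
apply: ge0_le_integral_nomeas => v _.
  by rewrite lee_fin !mulr_ge0 ?invr_ge0 ?wgt_ge0.
rewrite /patch; case: ifPn => [/set_mem vT|vT]; last first.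
  suff -> : (wgt b1 v.1 * phi1 v.1 * (wgt b2 v.2 * phi2 v.2) = 0)%R by rewrite mulr0.
  have [v1|v1] := boolP (0 < rho v.1)%R; last by rewrite wgt0// !mul0r.
  have [v2|v2] := boolP (0 < rho v.2)%R; last by rewrite [wgt b2 _]wgt0// !(mul0r, mulr0).
  by move/negP : vT; case; apply/mem_set/TB2P.
have -> : complex.Re (K zw v * f v)%R = (complex.Re (K zw v) * (phi1 v.1 * phi2 v.2))%R.
  by rewrite /f; case: (K zw v) => x y /=; rewrite mulr0 subr0.
rewrite lee_fin.
have [g1|g1] := eqVneq (phi1 v.1) 0%R; first by rewrite g1 !(mul0r, mulr0).
have [g2|g2] := eqVneq (phi2 v.2) 0%R; first by rewrite g2 !(mul0r, mulr0).
have [s1 u1 _] := adm_ker adm1 h1 g1; have [s2 u2 _] := adm_ker adm2 h2 g2.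
apply: (@le_trans _ _ (Kn b1 b2 c1 c2 zw v / 2 * (phi1 v.1 * phi2 v.2))%R); last first.
  by rewrite ler_wpM2r ?mulr_ge0//; exact: secK.
have -> : (Kn b1 b2 c1 c2 zw v / 2 * (phi1 v.1 * phi2 v.2) =
  (kmod zw.1 v.1 `^ (- c1) * kmod zw.2 v.2 `^ (- c2)) / 2 *
  ((wgt b1 v.1 * phi1 v.1) * (wgt b2 v.2 * phi2 v.2)))%R by rewrite mulrAC KnM mulrAC.
rewrite ler_wpM2r ?mulr_ge0 ?wgt_ge0// ler_wpM2r ?invr_ge0//.
exact: (ler_pM k10 k20 u1 u2).
Qed.

(** Both sides of the boundedness inequality factor, so it becomes a relation between six numbers,
    three for each variable. *)
Lemma test_inequality (s1 s2 l1 l2 : R) (C : R) : (0 < i1)%R -> (0 < i2)%R ->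
  \int[V]_u (wgt al1 u * phi1 u)%:E = s1%:E ->
  \int[V]_u (wgt al2 u * phi2 u `^ p2)%:E = s2%:E ->
  \int[V]_z (wgt be1 z * (wgt a1 z * k1 z) `^ q1)%:E = l1%:E ->
  \int[V]_z (wgt be2 z * (wgt a2 z * k2 z) `^ q2)%:E = l2%:E ->
  (forall g, inLmixed 1 p2 al1 al2 g ->
    mixnorm q1 q2 be1 be2 (intop (prefac a1 a2) K g) <= C%:E * mixnorm 1 p2 al1 al2 g) ->
  (i1 * i2 / 2 * (l1 `^ q1^-1 * l2 `^ q2^-1) <= C * (s1 * s2 `^ p2^-1))%R.
Proof.
move=> i10 i20 S1 S2 L1 L2 bdd.
have phi10 := adm_phi0 adm1; have phi20 := adm_phi0 adm2.
have s10 : (0 <= s1)%R.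
  by rewrite -lee_fin -S1; apply: integral_ge0 => u _; rewrite lee_fin mulr_ge0 ?wgt_ge0.
have s20 : (0 <= s2)%R.
  by rewrite -lee_fin -S2; apply: integral_ge0 => u _; rewrite lee_fin mulr_ge0 ?wgt_ge0 ?powR_ge0.
have l10 : (0 <= l1)%R.
  by rewrite -lee_fin -L1; apply: integral_ge0 => u _; rewrite lee_fin mulr_ge0 ?wgt_ge0 ?powR_ge0.
have l20 : (0 <= l2)%R.
  by rewrite -lee_fin -L2; apply: integral_ge0 => u _; rewrite lee_fin mulr_ge0 ?wgt_ge0 ?powR_ge0.
have nf : mixnorm 1 p2 al1 al2 f = (s1 * s2 `^ p2^-1)%:E.
  rewrite mixnormE.
  have -> : cmodT f = (fun v => (phi1 v.1 * phi2 v.2)%:E) by apply/funext => v; exact: cmodTf.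
  rewrite mixint_prod// S2.
  have -> : \int[V]_z (wgt al1 z * phi1 z `^ 1)%:E = s1%:E.
    by rewrite -S1; apply: eq_integral => z _; rewrite powRr1.
  rewrite divr1 poweR_EFin -EFinM poweR_EFin; congr EFin.
  by rewrite powRM ?powR_ge0// -powRrM divff ?gt_eqF// powRr1.
have inf : inLmixed 1 p2 al1 al2 f by split => //; rewrite nf ltry.
rewrite -lee_fin [leRHS]EFinM -nf; apply: le_trans (bdd f inf); rewrite mixnormE.
have mA (k : Cm -> R) a : measurable_fun setT (k : _ -> Rm) ->
    measurable_fun setT (fun z => wgt a z * k z : Rm)%R.
  by move=> mk; apply: measurable_funM => //; exact: measurable_wgt.
have A10 z : (0 <= wgt a1 z * k1 z)%R by rewrite mulr_ge0 ?wgt_ge0//; exact: adm_k0 adm1 _.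
have A20 z : (0 <= wgt a2 z * k2 z)%R by rewrite mulr_ge0 ?wgt_ge0//; exact: adm_k0 adm2 _.
have kap0 : (0 < i1 * i2 / 2)%R by rewrite divr_gt0 ?mulr_gt0.
have mA1 := mA _ a1 (adm_mk adm1); have mA2 := mA _ a2 (adm_mk adm2).
pose F (v : Cm * Cm) := ((wgt a1 v.1 * k1 v.1) * (wgt a2 v.2 * k2 v.2))%:E.
have mF : measurable_fun setT F.
  apply/measurable_EFinP; apply: measurable_funM.
    exact: (measurableT_comp mA1 measurable_fst).
  exact: (measurableT_comp mA2 measurable_snd).
have F0 v : 0 <= F v by rewrite lee_fin mulr_ge0.
have le : mixint q1 q2 be1 be2 (fun v => (i1 * i2 / 2)%:E * F v) <=
    mixint q1 q2 be1 be2 (cmodT (intop (prefac a1 a2) K f)).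
  apply: mixint_le => //.
    by move=> v; rewrite mule_ge0// lee_fin ltW.
  by move=> v; apply: le_trans (intop_ge v); rewrite /F -EFinM lee_fin mulrC.
have qV : (0 <= q2^-1)%R by rewrite invr_ge0 ltW.
apply: le_trans (gt0_ler_poweR qV _ _ le); last 2 first.
- by rewrite in_itv/= leey andbT mixint_ge0.
- by rewrite in_itv/= leey andbT mixint_ge0.
set kap := (i1 * i2 / 2)%R in kap0 le *; clearbody kap.
have FE : mixint q1 q2 be1 be2 F = _ := mixint_prod be1 be2 q10 q20 mA1 mA2 A10 A20.
rewrite mixintZ// FE L1 L2 poweR_EFin -!EFinM poweR_EFin lee_fin.
rewrite powRM ?mulr_ge0 ?powR_ge0// powRM ?powR_ge0// -!powRrM.
rewrite divff ?gt_eqF// powRr1 ?(ltW kap0)//.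
by rewrite [(q2 / q1 * _)%R]mulrAC divff ?gt_eqF// mul1r.
Qed.

End test_inequality.

End testing.

(** * Test data on boxes *)

Section necessity.
Context (R : realType) (m : nat).
Local Notation Rm := (measurableTypeR R).
Local Notation leb := (@lebesgue_measure R).
Local Notation n := m.+1.
Local Notation Cm := (Cn R n).
Local Notation V := (@dV R n).

Definition powint (e lo hi : R) : R := fine (\int[leb]_(s in `[lo, hi]) (s `^ e)%:E)%E.

Lemma powintP (e lo hi : R) : 0 < lo -> lo < hi ->
  [/\ (\int[leb]_(s in `[lo, hi]) (s `^ e)%:E = (powint e lo hi)%:E)%E,
    (hi - lo) * Num.min (lo `^ e) (hi `^ e) <= powint e lo hi &
    powint e lo hi <= (hi - lo) * Num.max (lo `^ e) (hi `^ e)].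
Proof.
move=> lo0 lh.
have E : (\int[leb]_(s in `[lo, hi]) (s `^ e)%:E = (powint e lo hi)%:E)%E.
  rewrite fineK//; have [->|e1] := eqVneq e (-1); first by rewrite integral_inv.
  by rewrite integral_powR.
have cst_int (k : R) : (\int[leb]_(s in `[lo, hi]) (cst k%:E s) = ((hi - lo) * k)%:E)%E.
  rewrite integral_cst//; have := @lebesgue_measure_itv R `[lo, hi] => /= ->.
  by rewrite lte_fin lh -EFinB -EFinM mulrC.
split => //; rewrite -lee_fin -E -cst_int; apply: ge0_le_integral_nomeas => s /=.
- by rewrite lee_fin le_min !powR_ge0.
- by rewrite in_itv/= => /andP[ls sh]; rewrite lee_fin; have /andP[] := @powR_between R _ _ _ e lo0 ls sh.
- by rewrite lee_fin powR_ge0.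
- by rewrite in_itv/= => /andP[ls sh]; rewrite lee_fin; have /andP[] := @powR_between R _ _ _ e lo0 ls sh.
Qed.

Lemma powint_gt0 e lo hi : 0 < lo -> lo < hi -> 0 < powint e lo hi.
Proof.
move=> lo0 lh; have [_ + _] := powintP e lo0 lh; apply: lt_le_trans.
by rewrite mulr_gt0 ?subr_gt0// lt_min !powR_gt0// (lt_trans lo0).
Qed.

Lemma powint_inv lo hi : 0 < lo -> lo < hi -> powint (-1) lo hi = ln hi - ln lo.
Proof. by move=> lo0 lh; rewrite /powint integral_inv. Qed.

Lemma powint_le (e e' lo hi : R) : 0 < lo -> lo < hi ->
  (forall s, lo <= s <= hi -> s `^ e <= s `^ e') -> powint e lo hi <= powint e' lo hi.
Proof.
move=> lo0 lh ee; have [E _ _] := powintP e lo0 lh; have [E' _ _] := powintP e' lo0 lh.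
rewrite -lee_fin -E -E'; apply: ge0_le_integral_nomeas => s /=; first by rewrite lee_fin powR_ge0.
by rewrite in_itv/= lee_fin; exact: ee.
Qed.

Lemma powint_dilate (e r : R) : 0 < r ->
  r `^ (e + 1) * Num.min 1 (2 `^ e) <= powint e r (2 * r) <= r `^ (e + 1) * Num.max 1 (2 `^ e).
Proof.
move=> r0; have rr : r < 2 * r by rewrite mulrC ltr_pMr// ltr1n.
have [_ lo hi] := powintP e r0 rr.
have E : 2 * r - r = r by ring.
have rE : r `^ (e + 1) = r * r `^ e.
  by rewrite powRD ?(gt_eqF r0) ?implybT// powRr1 ?ltW// mulrC.
have H : (2 * r) `^ e = r `^ e * 2 `^ e by rewrite powRM ?(ltW r0)// mulrC.
rewrite E H in lo hi; rewrite !rE -!mulrA.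
have -> : r `^ e * Num.min 1 (2 `^ e) = Num.min (r `^ e) (r `^ e * 2 `^ e).
  by rewrite minr_pMr ?powR_ge0// mulr1.
have -> : r `^ e * Num.max 1 (2 `^ e) = Num.max (r `^ e) (r `^ e * 2 `^ e).
  by rewrite maxr_pMr ?powR_ge0// mulr1.
by rewrite lo hi.
Qed.

(** By [kmod_box] the ratio of |rho(z,u)| to the scale lies in [1/2, 3 + 4m]; [lowc] and [highc] are
    the extreme values of its power -c. *)
Definition lowc (c : R) : R := Num.min ((2^-1) `^ (- c)) ((3 + 4 * m%:R) `^ (- c)).
Definition highc (c : R) : R := Num.max ((2^-1) `^ (- c)) ((3 + 4 * m%:R) `^ (- c)).

Lemma lowc_gt0 c : 0 < lowc c.
Proof. by rewrite lt_min !powR_gt0 ?invr_gt0// ltr_wpDr// mulr_ge0. Qed.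

Section data.
Variables (e d : R).
Hypotheses (e0 : 0 < e) (e1 : e <= 1) (ed : (2 + 4 * m%:R) * e <= d).

(** The scale of a pair is G(rho z): it exceeds the size g of the u-box and is comparable to the sum
    of the heights, as [kmod_box] requires. Two size functions are kept so that the z-box can grow
    while the u-box stays fixed. *)
Lemma admissible_box (c tau lo1 hi1 lo2 hi2 : R) (g G : R -> R) :
  measurable_fun setT (g : Rm -> Rm) -> measurable_fun setT (G : Rm -> Rm) ->
  0 < lo1 -> 0 < lo2 ->
  (forall s s', lo1 <= s <= hi1 -> lo2 <= s' <= hi2 ->
    [/\ 0 < G s', g s <= G s', G s' <= s + s' & s + s' <= 4 * G s']) ->
  admissible d c (highc c / lowc c) (fun u : Cm => bxg e g lo1 hi1 u * rho u `^ tau)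
    (fun z : Cm => bxg e G lo2 hi2 z * (lowc c * G (rho z) `^ (- c))).
Proof.
move=> mg mG lo10 lo20 gG; have lc0 := lowc_gt0 c.
split.
- apply: measurable_funM; first exact: measurable_bxg.
  exact: (measurableT_comp (measurable_powR tau) (@measurable_rho R m)).
- apply: measurable_funM; first exact: measurable_bxg.
  apply: measurable_funM => //; apply: (measurableT_comp (measurable_powR (- c))).
  exact: (measurableT_comp mG (@measurable_rho R m)).
- by move=> u; rewrite mulr_ge0 ?bxg_ge0 ?powR_ge0.
- by move=> z; rewrite mulr_ge0 ?bxg_ge0// mulr_ge0 ?powR_ge0// ltW.
- move=> u; rewrite mulf_eq0 negb_or => /andP[/bxg_neq0[_ /andP[lu _] _ _ _] _].
  exact: lt_le_trans lu.
- move=> z; rewrite mulf_eq0 negb_or => /andP[/bxg_neq0[_ /andP[lz _] _ _ _] _].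
  exact: lt_le_trans lz.
- move=> z u; rewrite mulf_eq0 negb_or => /andP[/bxg_neq0[-> lz xzm xz yz] _].
  rewrite mulf_eq0 negb_or => /andP[/bxg_neq0[_ lu xum xu yu] _].
  have [G0 gr Gs s4] := gG _ _ lu lz.
  have z0 : 0 < rho z by move: lz => /andP[+ _]; exact: lt_le_trans.
  have u0 : 0 < rho u by move: lu => /andP[+ _]; exact: lt_le_trans.
  set r := G (rho z) in G0 gr Gs s4 xzm xz yz *.
  have sg : e * Num.sqrt (g (rho u)) <= e * Num.sqrt r.
    by rewrite ler_wpM2l ?(ltW e0)// ler_wsqrtr.
  have [|||||klo khi kIm] := @kmod_box R m e r z u e0 e1 G0 z0 u0 xz yz _ _ xzm.
  - by move=> j; exact: le_trans (xu j) sg.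
  - by move=> j; exact: le_trans (yu j) sg.
  - by apply: le_trans xum _; rewrite ler_wpM2l// ltW.
  - by rewrite addrC.
  - by rewrite addrC.
  have m0 : 0 <= m%:R :> R by [].
  have Re0 : 0 <= complex.Re (rho2 z u).
    by have := le_trans (normr_ge0 _) kIm; rewrite pmulr_rge0// mulr_gt0//; lra.
  have /andP[xlo xhi] : lowc c <= (kmod z u / r) `^ (- c) <= highc c.
    by apply: powR_between; rewrite ?invr_gt0// ?ler_pdivlMr ?ler_pdivrMr.
  have kE : kmod z u `^ (- c) = (kmod z u / r) `^ (- c) * r `^ (- c).
    by rewrite -powRM ?divfK ?gt_eqF ?(ltW G0)// divr_ge0 ?(ltW G0)//; exact: cmod_ge0.
  rewrite mul1r kE; split.
  - by apply: le_trans kIm _; rewrite ler_wpM2r.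
  - by rewrite ler_wpM2r ?powR_ge0.
  - by rewrite mulrA divfK ?gt_eqF// ler_wpM2r ?powR_ge0.
Qed.

Local Open Scope ereal_scope.

Lemma integral_wgt_box (b tau p lo hi : R) (g : R -> R) : (0 < p)%R ->
  measurable_fun setT (g : Rm -> Rm) -> (0 < lo)%R -> (forall s, lo <= s <= hi -> 0 <= g s)%R ->
  \int[V]_u (wgt b u * (bxg e g lo hi u * rho u `^ tau) `^ p)%:E =
  ((2 * e) ^+ (m + n))%:E * \int[leb]_(s in `[lo, hi]) (s `^ (b + tau * p) * g s ^+ n)%:E.
Proof.
move=> p0 mg lo0 g0.
rewrite -(@integral_bxg R m e g lo hi (fun s => s `^ (b + tau * p))%R)//; last first.
  by move=> s; exact: powR_ge0.
apply: eq_integral => u _; congr EFin.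
rewrite powRM ?bxg_ge0 ?powR_ge0// bxg_powR ?gt_eqF// mulrCA.
have [->|/bxg_neq0[_ /andP[lu _] _ _ _]] := eqVneq (bxg e g lo hi u) 0%R; first by rewrite !mul0r.
have u0 : (0 < rho u)%R by exact: lt_le_trans lu.
by rewrite wgt_pos// -powRrM -powRD// (gt_eqF u0) implybT.
Qed.

Lemma integral_wgt_low (a be c q lo hi : R) (G : R -> R) : (0 < q)%R ->
  measurable_fun setT (G : Rm -> Rm) -> (0 < lo)%R -> (forall s, lo <= s <= hi -> 0 <= G s)%R ->
  \int[V]_z (wgt be z * (wgt a z * (bxg e G lo hi z * (lowc c * G (rho z) `^ (- c)))) `^ q)%:E =
  ((2 * e) ^+ (m + n))%:E * \int[leb]_(s in `[lo, hi])
     ((s `^ (be + a * q) * (lowc c `^ q * G s `^ (- c * q))) * G s ^+ n)%:E.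
Proof.
move=> q0 mG lo0 G0; have lc0 := lowc_gt0 c.
rewrite -(@integral_bxg R m e G lo hi
  (fun s => s `^ (be + a * q) * (lowc c `^ q * G s `^ (- c * q)))%R)//; last 2 first.
- apply: measurable_funM; first exact: measurable_powR.
  by apply: measurable_funM => //; exact: (measurableT_comp (measurable_powR _) mG).
- by move=> s; rewrite !mulr_ge0 ?powR_ge0.
apply: eq_integral => z _; congr EFin.
have lG0 : (0 <= lowc c * G (rho z) `^ (- c))%R by rewrite mulr_ge0 ?powR_ge0// ltW.
have b0 := @bxg_ge0 R m e G lo hi z.
rewrite (powRM _ (wgt_ge0 _ _) (mulr_ge0 b0 lG0)) (powRM _ b0 lG0) bxg_powR ?gt_eqF//.
have [->|/bxg_neq0[-> /andP[lz _] _ _ _]] := eqVneq (bxg e G lo hi z) 0%R.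
  by rewrite !(mul0r, mulr0).
have z0 : (0 < rho z)%R by exact: lt_le_trans lz.
by rewrite !mul1r !wgt_pos// powRM ?powR_ge0 ?(ltW lc0)// -!powRrM mulrA -powRD ?(gt_eqF z0) ?implybT.
Qed.

(* [datum] records one test: i, s, l are the three integrals that the test inequality
   relates, for a density phi and a lower bound k of the kernel. *)
Definition datum (b c al p a be q i s l : R) := exists M phi k,
  [/\ @admissible R m d c M phi k,
    \int[V]_u (wgt b u * phi u)%:E = i%:E,
    \int[V]_u (wgt al u * phi u `^ p)%:E = s%:E &
    \int[V]_z (wgt be z * (wgt a z * k z) `^ q)%:E = l%:E].

Let kap : R := ((2 * e) ^+ (m + n))%R.

(** Both boxes have the same scale r, so only the ranges of heights vary. The factor rho^tau in the
    density allows the source exponent al + tau p to be tuned to -1. *)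
Lemma datum_cst (b c al p a be q r tau lo1 hi1 lo2 hi2 : R) : (0 < p)%R -> (0 < q)%R ->
  (0 < r)%R -> (0 < lo1)%R -> (lo1 < hi1)%R -> (0 < lo2)%R -> (lo2 < hi2)%R ->
  (r <= lo1 + lo2)%R -> (hi1 + hi2 <= 4 * r)%R ->
  datum b c al p a be q
    (kap * (r ^+ n * powint (b + tau) lo1 hi1))
    (kap * (r ^+ n * powint (al + tau * p) lo1 hi1))
    (kap * (lowc c `^ q * r `^ (- c * q) * r ^+ n * powint (be + a * q) lo2 hi2)).
Proof.
move=> p0 q0 r0 lo10 lh1 lo20 lh2 rl hr.
have J (x y lo hi : R) : (0 < lo)%R -> (lo < hi)%R -> (0 <= y)%R ->
    \int[leb]_(s in `[lo, hi]) (s `^ x * y)%:E = (y * powint x lo hi)%:E.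
  move=> lo0 lh y0; have [E _ _] := powintP x lo0 lh.
  under eq_integral do rewrite mulrC EFinM.
  rewrite ge0_integralZl ?lee_fin//; last 2 first.
  - by apply/measurable_EFinP; apply: measurable_funTS; exact: measurable_powR.
  - by move=> s _; rewrite lee_fin powR_ge0.
  by rewrite E -EFinM.
have rn : (0 <= r ^+ n)%R by rewrite exprn_ge0// ltW.
have r0' (lo hi : R) s : (lo <= s <= hi -> 0 <= cst r s)%R by move=> _; exact: ltW.
exists (highc c / lowc c)%R, (fun u : Cm => bxg e (cst r) lo1 hi1 u * rho u `^ tau)%R,
  (fun z : Cm => bxg e (cst r) lo2 hi2 z * (lowc c * cst r (rho z) `^ (- c)))%R; split.
- apply: admissible_box => // s s' /andP[ls sh] /andP[ls' sh'].
  by split => //=; [apply: le_trans rl _; exact: lerD|apply: le_trans hr; exact: lerD].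
- have := @integral_wgt_box b tau 1 lo1 hi1 (cst r) ltr01 (measurable_cst _) lo10 (r0' _ _).
  rewrite /= J// mulr1 -EFinM => <-; apply: eq_integral => u _.
  by rewrite powRr1// mulr_ge0 ?bxg_ge0 ?powR_ge0.
- have -> := @integral_wgt_box al tau p lo1 hi1 (cst r) p0 (measurable_cst _) lo10 (r0' _ _).
  by rewrite /= J// -EFinM.
- have -> := @integral_wgt_low a be c q lo2 hi2 (cst r) q0 (measurable_cst _) lo20 (r0' _ _).
  under eq_integral do rewrite /= -mulrA.
  by rewrite J ?mulr_ge0 ?powR_ge0// -EFinM.
Qed.

(** With u near height 1 and a z-box whose size equals its height, |rho(z,u)| is comparable to
    rho(z) and a slice has volume of order s^n, which explains the exponent be + a q - c q + n. *)
Lemma datum_id (b c al p a be q X : R) : (0 < p)%R -> (0 < q)%R -> (2 < X)%R ->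
  datum b c al p a be q
    (kap * powint b 1 2) (kap * powint al 1 2)
    (kap * (lowc c `^ q * powint (be + a * q - c * q + n%:R) 2 X)).
Proof.
move=> p0 q0 X2.
have lt12 : (1 < 2 :> R)%R by rewrite ltr1n.
have lt02 : (0 < 2 :> R)%R by [].
exists (highc c / lowc c)%R, (fun u : Cm => bxg e (cst 1) 1 2 u * rho u `^ 0)%R,
  (fun z : Cm => bxg e id 2 X z * (lowc c * id (rho z) `^ (- c)))%R.
have g0 (s : R) : (1 <= s <= 2 -> 0 <= cst (1 : R) s)%R by [].
split.
- apply: admissible_box => // s s' /andP[ls sh] /andP[ls' sh'].
  by split => //=; lra.
- have := @integral_wgt_box b 0%R 1%R 1%R 2%R (cst 1%R) ltr01 (measurable_cst _) ltr01 g0.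
  have [E _ _] := powintP b ltr01 lt12.
  under [in X in _ = X -> _]eq_integral do rewrite /= expr1n mulr1 mul0r addr0.
  rewrite E -EFinM => <-; apply: eq_integral => u _.
  by rewrite powRr1// mulr_ge0 ?bxg_ge0 ?powR_ge0.
- rewrite (@integral_wgt_box al 0%R p 1%R 2%R (cst 1%R))//.
  have [E _ _] := powintP al ltr01 lt12.
  under eq_integral do rewrite /= expr1n mulr1 mul0r addr0.
  by rewrite E -EFinM.
- rewrite (@integral_wgt_low a be c q 2%R X id)//; last first.
    by move=> s /andP[+ _]; apply: le_trans.
  have [E _ _] := powintP (be + a * q - c * q + n%:R)%R lt02 X2.
  rewrite (eq_integral (fun s : Rm => (lowc c `^ q)%:E * (s `^ (be + a * q - c * q + n%:R))%:E)).
    rewrite ge0_integralZl ?lee_fin ?powR_ge0//; last 2 first.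
    - by apply/measurable_EFinP; apply: measurable_funTS; exact: measurable_powR.
    - by move=> s _; rewrite lee_fin powR_ge0.
    by rewrite E -!EFinM.
  move=> s; rewrite inE/= in_itv/= => /andP[s2 _].
  have s0 : (0 < s)%R by exact: lt_le_trans s2.
  rewrite -EFinM; congr EFin; rewrite mulNr !powRD ?(gt_eqF s0) ?implybT//.
  by rewrite powR_mulrn ?(ltW s0)//; ring.
Qed.

End data.
End necessity.

(** * Necessary conditions in one variable *)

Section one_variable_necessity.
Context (R : realType) (m : nat).
Local Notation n := m.+1.
Local Notation Cm := (Cn R n).

Lemma powR_growth_absurd (i al q B : R) : 0 < i -> 0 < al -> 0 < q ->
  (forall Y, 0 < Y -> i * (al * Y) `^ q^-1 <= B) -> False.
Proof.
move=> i0 al0 q0 H; pose x := (`|B| + 1) / i.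
have x0 : 0 < x by rewrite divr_gt0// ltr_wpDl.
have Y0 : 0 < x `^ q / al by rewrite divr_gt0// powR_gt0.
have := H _ Y0; have -> : al * (x `^ q / al) = x `^ q by rewrite mulrCA divff ?mulr1 ?gt_eqF.
rewrite -powRrM divff ?gt_eqF// powRr1 ?(ltW x0)//.
have -> : i * x = `|B| + 1 by rewrite /x mulrCA divff ?mulr1 ?gt_eqF.
by have := ler_norm B; lra.
Qed.

Lemma powR_superlinear_absurd (i al p B : R) : 0 < i -> 0 < al -> 1 < p ->
  (forall Y, 0 < Y -> i * (al * Y) <= B * (al * Y) `^ p^-1) -> False.
Proof.
move=> i0 al0 p1 H; have p0 : 0 < p by lra.
have pV : 0 < 1 - p^-1 by rewrite subr_gt0 invf_lt1.
(* y solves y = x y^(1/p), and x is large enough that i x exceeds B. *)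
pose x := (`|B| + 1) / i; pose y := x `^ (1 - p^-1)^-1.
have x0 : 0 < x by rewrite divr_gt0// ltr_wpDl.
have y0 : 0 < y by rewrite powR_gt0.
have := H (y / al) (divr_gt0 y0 al0).
have -> : al * (y / al) = y by rewrite mulrCA divff ?mulr1 ?gt_eqF.
have yE : y = x * y `^ p^-1.
  rewrite -[LHS](powRr1 (ltW y0)) -{1}(subrK p^-1 1) powRD ?(gt_eqF y0) ?implybT//.
  by rewrite {1}/y -powRrM mulVf ?gt_eqF// powRr1 ?(ltW x0).
rewrite {1}yE mulrA ler_pM2r ?powR_gt0//.
have -> : i * x = `|B| + 1 by rewrite /x mulrCA divff ?mulr1 ?gt_eqF.
by have := ler_norm B; lra.
Qed.

Lemma powR_bounded_exp0 (ga B : R) : (forall r, 0 < r -> r `^ ga <= B) -> ga = 0.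
Proof.
move=> H; apply/eqP; apply/negPn/negP => g0.
have B0 : 0 < `|B| + 1 by rewrite ltr_wpDl.
have := H _ (powR_gt0 ga^-1 B0).
rewrite -powRrM mulVf// powRr1 ?(ltW B0)//.
by have := ler_norm B; lra.
Qed.

Variables (e d : R).
Hypotheses (e0 : 0 < e) (e1 : e <= 1) (ed : (2 + 4 * m%:R) * e <= d).
Variables (b c al p a be q C : R).
Hypotheses (p0 : 0 < p) (q0 : 0 < q).
Hypothesis H : forall i s l, datum m d b c al p a be q i s l -> 0 < i ->
  i * l `^ q^-1 <= C * s `^ p^-1.

Let kap : R := (2 * e) ^+ (m + n).
Let kap0 : 0 < kap. Proof. by rewrite exprn_gt0// mulr_gt0. Qed.
Let lt12 : 1 < 2 :> R. Proof. by rewrite ltr1n. Qed.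
Let lc0 : 0 < lowc m c. Proof. exact: lowc_gt0. Qed.

(** The z-box reaches down to height t = exp(-Y) with everything else fixed. If the exponent were at
    most -1, the target integral would dominate that of 1/s over [t, 1], which is Y. *)
Lemma nec_target_integrable : -1 < be + a * q.
Proof.
rewrite ltNge; apply/negP => h.
have i0 : 0 < kap * (1 ^+ n * powint (b + 0) 1 2).
  by rewrite mulr_gt0// mulr_gt0 ?exprn_gt0// powint_gt0.
have al0 : 0 < kap * lowc m c `^ q by rewrite mulr_gt0// powR_gt0.
apply: (powR_growth_absurd i0 al0 q0) => Y Y0.
pose t := expR (- Y); have t0 : 0 < t by exact: expR_gt0.
have t1 : t < 1 by rewrite expR_lt1 oppr_lt0.
have D := @datum_cst R m e d e0 e1 ed b c al p a be q 1 0 1 2 t 1 p0 q0 ltr01 ltr01 lt12 t0 t1.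
apply: le_trans (H (D _ _) i0); [|lra|lra].
rewrite ler_wpM2l ?(ltW i0)//; apply: ge0_ler_powR; rewrite ?invr_ge0 ?nnegrE ?(ltW q0)//.
- by rewrite mulr_ge0 ?(ltW al0) ?(ltW Y0).
- by rewrite !mulr_ge0 ?powR_ge0 ?(ltW kap0)// ltW// powint_gt0.
rewrite powR1 expr1n !mulr1 -mulrA ler_wpM2l ?(ltW kap0)// ler_wpM2l ?powR_ge0//.
have <- : powint (-1) t 1 = Y by rewrite powint_inv// ln1 expRK sub0r opprK.
apply: powint_le => // s /andP[ts s1]; apply: ger_powR => //.
by rewrite (lt_le_trans t0).
Qed.

(** The z-box of [datum_id] extends to height 2 exp(Y); an exponent at least -1 would make the
    target integral dominate that of 1/s over [2, 2 exp(Y)], again Y. Combined with the formula for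
    c and p = 1, this is the condition al1 < b1. *)
Lemma nec_infinity : be + a * q - c * q + n%:R < -1.
Proof.
rewrite ltNge; apply/negP => h.
have i0 : 0 < kap * powint b 1 2 by rewrite mulr_gt0// powint_gt0.
have al0 : 0 < kap * lowc m c `^ q by rewrite mulr_gt0// powR_gt0.
apply: (powR_growth_absurd i0 al0 q0) => Y Y0.
have X2 : 2 < 2 * expR Y by rewrite ltr_pMr// expR_gt1.
have D := @datum_id R m e d e0 e1 ed b c al p a be q _ p0 q0 X2.
apply: le_trans (H D i0); rewrite ler_wpM2l ?(ltW i0)//.
apply: ge0_ler_powR; rewrite ?invr_ge0 ?nnegrE ?(ltW q0)//.
- by rewrite mulr_ge0 ?(ltW al0) ?(ltW Y0).
- by rewrite !mulr_ge0 ?powR_ge0 ?(ltW kap0)// ltW// powint_gt0.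
rewrite -mulrA ler_wpM2l ?(ltW kap0)// ler_wpM2l ?powR_ge0//.
have YE : powint (-1) 2 (2 * expR Y) = Y.
  by rewrite powint_inv// lnM ?posrE ?expR_gt0// expRK addrAC subrr add0r.
rewrite -[leLHS]YE; apply: powint_le => // s /andP[s2 _]; apply: ler_powR => //.
by apply: le_trans s2; exact: ltW.
Qed.

(** The u-box reaches down to height exp(-Y). If the condition failed, the pairing i would grow at
    least linearly in Y while the source norm grows only like Y^(1/p), and p > 1. *)
Lemma nec_source_dual : 1 < p -> al + 1 < p * (b + 1).
Proof.
move=> p1; rewrite ltNge; apply/negP => h.
(* The critical power: the source integral becomes exactly that of 1/s, and failure of the condition
   means b + tau <= -1. *)
pose tau := - ((1 + al) / p).
have tE : al + tau * p = -1 by rewrite /tau mulNr divfK ?gt_eqF//; ring.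
have bt : b + tau <= -1.
  have : b + 1 <= (1 + al) / p by rewrite ler_pdivlMr// mulrC [1 + al]addrC.
  by rewrite /tau; lra.
pose l0 := kap * (lowc m c `^ q * 1 `^ (- c * q) * 1 ^+ n * powint (be + a * q) 1 2).
have l00 : 0 < l0.
  by rewrite mulr_gt0// mulr_gt0 ?powint_gt0// !mulr_gt0 ?powR_gt0 ?exprn_gt0.
have i0 : 0 < l0 `^ q^-1 by exact: powR_gt0.
apply: (@powR_superlinear_absurd _ kap p C i0 kap0 p1) => Y Y0.
pose t := expR (- Y); have t0 : 0 < t by exact: expR_gt0.
have t1 : t < 1 by rewrite expR_lt1 oppr_lt0.
have D := @datum_cst R m e d e0 e1 ed b c al p a be q 1 tau t 1 1 2 p0 q0 ltr01 t0 t1 ltr01 lt12.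
have YE : powint (-1) t 1 = Y by rewrite powint_inv// ln1 expRK sub0r opprK.
have tb : 0 < powint (b + tau) t 1 by exact: powint_gt0.
have r1 : 1 <= t + 1 by lra.
have r2 : 1 + 2 <= 4 * 1 :> R by lra.
have ip : 0 < kap * (1 ^+ n * powint (b + tau) t 1) by rewrite expr1n mul1r mulr_gt0.
have := H (D r1 r2) ip; rewrite -/l0 -/kap tE YE expr1n !mul1r.
apply: le_trans; rewrite mulrC ler_wpM2r ?(ltW i0)// ler_wpM2l ?(ltW kap0)//.
rewrite -YE; apply: powint_le => // s /andP[ts s1]; apply: ger_powR => //.
by rewrite (lt_le_trans t0).
Qed.

(** With boxes of scale r at heights from r to 2r, every integral is comparable to a power of r. The
    inequality holds for small and large r alike, so the two sides must have the same degree. *)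
Lemma nec_scaling : c = n%:R + 1 + a + b + ((n%:R + 1 + be) / q - (n%:R + 1 + al) / p).
Proof.
pose mb := Num.min 1 (2 `^ b); pose ml := Num.min 1 (2 `^ (be + a * q)).
pose Ms := Num.max 1 (2 `^ al).
have mb0 : 0 < mb by rewrite lt_min ltr01 powR_gt0.
have ml0 : 0 < ml by rewrite lt_min ltr01 powR_gt0.
have Ms0 : 0 < Ms by rewrite lt_max ltr01.
pose K1 := kap * mb * (kap * lowc m c `^ q * ml) `^ q^-1.
have K10 : 0 < K1 by rewrite !mulr_gt0// powR_gt0// !mulr_gt0// powR_gt0.
(* The excess of the degree in r of i l^(1/q) over that of s^(1/p). *)
pose ga := n%:R + (b + 1) + (- c * q + n%:R + (be + a * q + 1)) / q - (n%:R + (al + 1)) / p.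
suff : ga = 0.
  move=> g0; have cE : - c * q / q = - c by rewrite mulfK ?gt_eqF.
  have : c = c + ga by rewrite g0 addr0.
  by rewrite /ga => ->; field; rewrite !gt_eqF.
apply: (@powR_bounded_exp0 _ (`|C| * (kap * Ms) `^ p^-1 / K1)) => r r0.
have rr : r < 2 * r by rewrite mulrC ltr_pMr.
have rr1 : r <= r + r by rewrite lerDl ltW.
have rr2 : 2 * r + 2 * r <= 4 * r by rewrite -mulrDl ler_wpM2r ?(ltW r0)//; lra.
have D := @datum_cst R m e d e0 e1 ed b c al p a be q r 0 r (2 * r) r (2 * r) p0 q0 r0
  r0 rr r0 rr rr1 rr2.
have rn : r ^+ n = r `^ n%:R by rewrite powR_mulrn// ltW.
have rD x y : r `^ (x + y) = r `^ x * r `^ y by rewrite powRD// (gt_eqF r0) implybT.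
have ip : 0 < kap * (r ^+ n * powint (b + 0) r (2 * r)).
  by rewrite mulr_gt0// mulr_gt0 ?exprn_gt0// powint_gt0.
have /andP[ilo _] := powint_dilate b r0.
have /andP[_ shi] := powint_dilate al r0.
have /andP[llo _] := powint_dilate (be + a * q) r0.
rewrite ler_pdivlMr//; have := H D ip; rewrite -/kap !addr0 mul0r addr0 rn => HH.
have lhs : r `^ (n%:R + (b + 1) + (- c * q + n%:R + (be + a * q + 1)) / q) * K1 <=
   kap * (r `^ n%:R * powint b r (2 * r)) *
   (kap * (lowc m c `^ q * r `^ (- c * q) * r `^ n%:R * powint (be + a * q) r (2 * r))) `^ q^-1.
  have -> : r `^ (n%:R + (b + 1) + (- c * q + n%:R + (be + a * q + 1)) / q) * K1 =
    kap * (r `^ n%:R * (r `^ (b + 1) * mb)) *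
    (kap * (lowc m c `^ q * r `^ (- c * q) * r `^ n%:R * (r `^ (be + a * q + 1) * ml))) `^ q^-1.
    have -> : kap * (lowc m c `^ q * r `^ (- c * q) * r `^ n%:R * (r `^ (be + a * q + 1) * ml)) =
      (kap * lowc m c `^ q * ml) * r `^ (- c * q + n%:R + (be + a * q + 1)).
      by rewrite [r `^ (- c * q + n%:R + _)]rD [r `^ (- c * q + n%:R)]rD; ring.
    rewrite powRM ?powR_ge0//; last by rewrite !mulr_ge0 ?powR_ge0 ?(ltW kap0) ?(ltW ml0).
    by rewrite /K1 -[(r `^ (_ + _ + _)) `^ _]powRrM [r `^ (_ + _ / q)]rD [r `^ (n%:R + _)]rD; ring.
  apply: ler_pM.
  - by rewrite !mulr_ge0 ?powR_ge0 ?(ltW kap0) ?(ltW mb0).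
  - exact: powR_ge0.
  - by rewrite ler_wpM2l ?(ltW kap0)// ler_wpM2l ?powR_ge0.
  apply: ge0_ler_powR; rewrite ?invr_ge0 ?nnegrE ?(ltW q0)//.
  - by rewrite !mulr_ge0 ?powR_ge0 ?(ltW kap0) ?(ltW ml0).
  - by rewrite !mulr_ge0 ?powR_ge0 ?(ltW kap0)// ltW// powint_gt0.
  by rewrite ler_wpM2l ?(ltW kap0)// ler_wpM2l// !mulr_ge0 ?powR_ge0.
have rhs : C * (kap * (r `^ n%:R * powint al r (2 * r))) `^ p^-1 <=
   `|C| * (kap * Ms) `^ p^-1 * r `^ ((n%:R + (al + 1)) / p).
  apply: (@le_trans _ _ (`|C| * (kap * (r `^ n%:R * powint al r (2 * r))) `^ p^-1)).
    by rewrite ler_wpM2r ?powR_ge0// ler_norm.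
  rewrite -mulrA ler_wpM2l// powRrM -powRM ?powR_ge0 ?mulr_ge0 ?(ltW kap0) ?(ltW Ms0)//.
  apply: ge0_ler_powR; rewrite ?invr_ge0 ?nnegrE ?(ltW p0)//.
  - by rewrite !mulr_ge0 ?powR_ge0 ?(ltW kap0)// ltW// powint_gt0.
  - by rewrite !mulr_ge0 ?powR_ge0 ?(ltW kap0) ?(ltW Ms0).
  rewrite rD -mulrA ler_wpM2l ?(ltW kap0)// [leRHS]mulrC -mulrA ler_wpM2l ?powR_ge0//.
have := le_trans lhs (le_trans HH rhs).
rewrite /ga [r `^ (_ - _)]rD powRN => HF.
rewrite mulrAC ler_pdivrMr ?powR_gt0//.
Qed.

End one_variable_necessity.

(** * The kernels of S and T *)

Section kernels.
Context (R : realType) (m : nat).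
Local Notation Rm := (measurableTypeR R).
Local Notation n := m.+1.
Local Notation Cm := (Cn R n).
Local Notation TB2 := (@TB R n `*` @TB R n).

Lemma Re_rho2_gt0 (z u : Cm) : 0 < rho z -> 0 < rho u -> 0 < complex.Re (rho2 z u).
Proof.
move=> z0 u0; rewrite rho2E/= divr_gt0// !ltr_wpDr// ?sumr_ge0//;
  try by move=> j _; exact: sqr_ge0.
- by rewrite mulr_ge0// ltW.
- by rewrite mulr_gt0.
Qed.

Lemma KnE b1 b2 c1 c2 (zw v : Cm * Cm) : TB2 v ->
  Kn b1 b2 c1 c2 zw v = rho v.1 `^ b1 * rho v.2 `^ b2 /
    (kmod zw.1 v.1 `^ c1 * kmod zw.2 v.2 `^ c2).
Proof. by move=> /TB2P[v1 v2]; rewrite /Kn !wgt_pos// !powRN invfM. Qed.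

Lemma SkernelE b1 b2 c1 c2 (zw v : Cm * Cm) : TB2 v ->
  Skernel b1 b2 c1 c2 zw v = realC (Kn b1 b2 c1 c2 zw v).
Proof. by move=> vT; rewrite KnE. Qed.

Lemma Skernel_dominated b1 b2 c1 c2 : kernel_dominated b1 b2 c1 c2 (@Skernel R n b1 b2 c1 c2).
Proof.
move=> zw zwT; split.
- apply: (eq_measurable_fun (fun v => Kn b1 b2 c1 c2 zw v : Rm)).
    by move=> v /set_mem vT; rewrite SkernelE.
  by apply: measurable_funTS; exact: measurable_Kn_l.
- apply: (eq_measurable_fun (cst 0 : _ -> Rm)); last exact: measurable_cst.
  by move=> v /set_mem vT; rewrite SkernelE.
- by move=> v vT; rewrite SkernelE// cmod_realC// Kn_ge0.
Qed.

Lemma Skernel_sector d b1 b2 c1 c2 : kernel_sector d b1 b2 c1 c2 (@Skernel R n b1 b2 c1 c2).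
Proof.
move=> zw v _ vT _ _; rewrite SkernelE//=.
by have := Kn_ge0 b1 b2 c1 c2 zw v; lra.
Qed.

Definition angle (z u : Cm) : R := atan (complex.Im (rho2 z u) / complex.Re (rho2 z u)).

(** The kernel of T is the kernel of S times exp(-i theta), with theta = c1 arg rho(z,u) + c2 arg
    rho(w,eta); the principal argument is an arctangent because the real parts are positive. *)
Lemma TkernelE b1 b2 c1 c2 (zw v : Cm * Cm) : TB2 zw -> TB2 v ->
  Tkernel b1 b2 c1 c2 zw v =
  (Kn b1 b2 c1 c2 zw v * cos (c1 * angle zw.1 v.1 + c2 * angle zw.2 v.2)) +i*
  (- (Kn b1 b2 c1 c2 zw v * sin (c1 * angle zw.1 v.1 + c2 * angle zw.2 v.2))).
Proof.
move=> /TB2P[z0 w0] vT; have [v1 v2] := (TB2P v).1 vT.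
rewrite /Tkernel /cpow -/(angle zw.1 v.1) -/(angle zw.2 v.2).
rewrite -[cmod (rho2 zw.1 v.1)]/(kmod zw.1 v.1) -[cmod (rho2 zw.2 v.2)]/(kmod zw.2 v.2).
rewrite KnE//.
set s := c1 * _; set t := c2 * _; set W := _ `^ b1 * _.
have A0 : 0 < kmod zw.1 v.1 `^ c1 by rewrite powR_gt0// kmod_gt0.
have B0 : 0 < kmod zw.2 v.2 `^ c2 by rewrite powR_gt0// kmod_gt0.
set A := kmod zw.1 v.1 `^ c1 in A0 *; set B := kmod zw.2 v.2 `^ c2 in B0 *.
have -> : (A * cos s +i* (A * sin s)) * (B * cos t +i* (B * sin t)) =
    (A * B * cos (s + t)) +i* (A * B * sin (s + t)).
  simpc; rewrite cosD sinD; apply/eqP; rewrite eq_complex/=.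
  by apply/andP; split; apply/eqP; ring.
have cs := cos2Dsin2 (s + t).
set x := cos (s + t) in cs *; set y := sin (s + t) in cs *.
have AB0 : A * B != 0 by rewrite mulf_neq0 ?gt_eqF.
have P0 : (A * B * x) +i* (A * B * y) != 0.
  apply/eqP => -[/eqP + /eqP]; rewrite !mulf_eq0 -[(A == 0) || _]mulf_eq0 (negbTE AB0)/=.
  by move=> /eqP x0 /eqP y0; move: cs; rewrite x0 y0 expr0n addr0 => /eqP; rewrite eq_sym oner_eq0.
(* Multiplying by the nonzero denominator reduces the claim to cos^2 + sin^2 = 1. *)
apply: (mulIf P0); rewrite divfK//; simpc.
have E1 : W / (A * B) * x * (A * B * x) + W / (A * B) * y * (A * B * y) = W.
  transitivity (W / (A * B) * (A * B) * (x ^+ 2 + y ^+ 2)); first ring.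
  by rewrite cs divfK// mulr1.
have E2 : W / (A * B) * x * (A * B * y) - W / (A * B) * y * (A * B * x) = 0 by ring.
by rewrite /realC; apply/eqP; rewrite eq_complex/= ?mulNr ?opprK E1 E2 !eqxx.
Qed.

Lemma measurable_angle (z : Cm) (f : Cm * Cm -> Cm) : 0 < rho z ->
  measurable_fun setT f -> (forall v, TB2 v -> 0 < rho (f v)) ->
  measurable_fun TB2 (fun v => angle z (f v) : Rm).
Proof.
move=> z0 mf f0.
have mp : measurable_fun setT (fun v : Cm * Cm => (z, f v)) by exact: measurable_fun_pair.
have mI := measurableT_comp (@measurable_rho2_Im R m) mp.
have mR := measurableT_comp (@measurable_rho2_Re R m) mp.
(* The quotient is replaced by a product with the power -1, which is measurable on the whole space
   and agrees with it where the real part is positive. *)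
apply: (eq_measurable_fun (fun v => atan (complex.Im (rho2 z (f v)) *
   complex.Re (rho2 z (f v)) `^ (-1)) : Rm)).
  move=> v /set_mem vT; rewrite powR_inv1// ltW// Re_rho2_gt0//; exact: f0.
have ca : continuous (@atan R) by move=> x; exact: continuous_atan.
apply: measurable_funTS; apply: (measurableT_comp (continuous_measurable_fun ca)).
apply: measurable_funM => //.
exact: (measurableT_comp (measurable_powR _)).
Qed.

Lemma Tkernel_dominated b1 b2 c1 c2 : kernel_dominated b1 b2 c1 c2 (@Tkernel R n b1 b2 c1 c2).
Proof.
move=> zw zwT; have [z0 w0] := (TB2P zw).1 zwT.
have ma : measurable_fun TB2 (fun v : Cm * Cm =>
    c1 * angle zw.1 v.1 + c2 * angle zw.2 v.2 : Rm).
  apply: measurable_funD; apply: measurable_funM => //.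
  - by apply: (@measurable_angle zw.1 fst) => // v /TB2P[].
  - by apply: (@measurable_angle zw.2 snd) => // v /TB2P[].
have mK : measurable_fun TB2 (Kn b1 b2 c1 c2 zw : _ -> Rm).
  by apply: measurable_funTS; exact: measurable_Kn_l.
split.
- apply: (eq_measurable_fun (fun v => Kn b1 b2 c1 c2 zw v *
      cos (c1 * angle zw.1 v.1 + c2 * angle zw.2 v.2) : Rm)).
    by move=> v /set_mem vT; rewrite TkernelE.
  apply: measurable_funM => //.
  exact: (measurableT_comp (continuous_measurable_fun (@continuous_cos R)) ma).
- apply: (eq_measurable_fun (fun v => - (Kn b1 b2 c1 c2 zw v *
      sin (c1 * angle zw.1 v.1 + c2 * angle zw.2 v.2)) : Rm)).
    by move=> v /set_mem vT; rewrite TkernelE.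
  apply: measurableT_comp => //; apply: measurable_funM => //.
  exact: (measurableT_comp (continuous_measurable_fun (@continuous_sin R)) ma).
- move=> v vT; rewrite TkernelE//.
  move: (Kn b1 b2 c1 c2 zw v) (Kn_ge0 b1 b2 c1 c2 zw v) => k k0.
  by rewrite /cmod/= sqrrN !exprMn -mulrDr cos2Dsin2 mulr1 sqrtr_sqr ger0_norm.
Qed.

(** A narrow sector forces both arguments, hence theta, to be so small that cos theta >= 1/2. *)
Lemma Tkernel_sector b1 b2 c1 c2 :
  exists2 d : R, 0 < d & kernel_sector d b1 b2 c1 c2 (@Tkernel R n b1 b2 c1 c2).
Proof.
have [h h0 Hh] : exists2 h : R, 0 < h & forall t, `|t| < h -> 2^-1 <= cos t :> R.
  have /cvgrPdist_lt /(_ 2^-1) := @continuous_cos R 0.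
  rewrite invr_gt0 ltr0n => /(_ isT) /nbhs_ballP[h /= h0 Hh]; exists h => // t th.
  have := Hh t; rewrite /ball/= sub0r normrN cos0 => /(_ th).
  by rewrite ltr_norml => /andP[_]; lra.
(* The bound on each argument that gives |theta| < h; the added 1 keeps the quotient defined when c1
   = c2 = 0. *)
pose k := h / (`|c1| + `|c2| + 1).
have cc : 0 < `|c1| + `|c2| + 1 by rewrite ltr_wpDl// addr_ge0.
have k0 : 0 < k by rewrite divr_gt0.
have [d d0 Hd] : exists2 d : R, 0 < d & forall x, `|x| <= d -> `|atan x| < k :> R.
  have /cvgrPdist_lt /(_ k k0) := @continuous_atan R 0.
  move=> /nbhs_ballP[d /= d0 Hd]; exists (d / 2); first by rewrite divr_gt0.
  move=> x xd; have := Hd x; rewrite /ball/= sub0r normrN atan0 sub0r normrN; apply.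
  by apply: le_lt_trans xd _; rewrite ltr_pdivrMr// ltr_pMr// ltr1n.
exists d => // zw v zwT vT i1 i2.
have [z0 w0] := (TB2P zw).1 zwT; have [v1 v2] := (TB2P v).1 vT.
have an (z u : Cm) : 0 < rho z -> 0 < rho u ->
    `|complex.Im (rho2 z u)| <= d * complex.Re (rho2 z u) -> `|angle z u| < k.
  move=> z' u' H; have r0 := Re_rho2_gt0 z' u'.
  by apply: Hd; rewrite normrM normfV (gtr0_norm r0) ler_pdivrMr.
have a1 := an _ _ z0 v1 i1; have a2 := an _ _ w0 v2 i2.
rewrite TkernelE//= ler_wpM2l ?Kn_ge0//; apply: Hh.
apply: (@le_lt_trans _ _ ((`|c1| + `|c2|) * k)).
  apply: le_trans (ler_normD _ _) _; rewrite !normrM mulrDl.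
  by apply: lerD; rewrite ler_wpM2l// ltW.
by rewrite /k mulrA ltr_pdivrMr// mulrC ltr_pM2l// ltrDl.
Qed.

End kernels.

(** * Assembling the equivalence *)

Section characterization.
Context (R : realType) (m : nat).
Local Notation n := m.+1.
Local Notation Cm := (Cn R n).
Local Notation V := (@dV R n).

(** A fixed test at scale 1 is inserted in one variable, and its positive integrals go into the
    constant. The test inequality becomes [H1] with p = 1 for the first variable and [H2] with p =
    p2 for the second, to which the one-variable conditions apply. *)
Theorem conditions_of_bounded (p2 q1 q2 a1 a2 b1 b2 c1 c2 al1 al2 be1 be2 d : R)
    (K : Cm * Cm -> Cm * Cm -> R[i]) : 0 < d ->
  kernel_dominated b1 b2 c1 c2 K -> kernel_sector d b1 b2 c1 c2 K ->
  1 < p2 -> p2 <= q1 -> p2 <= q2 ->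
  bounded_intop (prefac a1 a2) K 1 p2 al1 al2 q1 q2 be1 be2 ->
  [/\ al1 < b1, al2 + 1 < p2 * (b2 + 1),
    - q1 * a1 < be1 + 1 /\
      c1 = n%:R + 1 + a1 + b1 + ((n%:R + 1 + be1) / q1 - (n%:R + 1 + al1)) &
    - q2 * a2 < be2 + 1 /\
      c2 = n%:R + 1 + a2 + b2 + ((n%:R + 1 + be2) / q2 - (n%:R + 1 + al2) / p2)].
Proof.
move=> d0 domK secK p1 pq1 pq2 [C bdd].
have [q10 q20] : 0 < q1 /\ 0 < q2 by split; lra.
have p0 : 0 < p2 by lra.
have mm : 0 < 2 + 4 * m%:R :> R by rewrite ltr_wpDr// mulr_ge0.
(* The aperture for which [kmod_box] places every pair of box points in the sector of slope d. *)
pose e := Num.min 1 (d / (2 + 4 * m%:R)).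
have e0 : 0 < e by rewrite lt_min ltr01 divr_gt0.
have e1 : e <= 1 by rewrite ge_min lexx.
have ed : (2 + 4 * m%:R) * e <= d.
  by rewrite mulrC -ler_pdivlMr// ge_min lexx orbT.
have lt12 : 1 < 2 :> R by rewrite ltr1n.
have c11 : 1 <= 1 + 1 :> R by lra.
have c22 : 2 + 2 <= 4 * 1 :> R by lra.
have k0 : 0 < (2 * e) ^+ (m + n) by rewrite exprn_gt0// mulr_gt0.
have unit b c al p a be q : 0 < p -> 0 < q -> exists i s l,
    [/\ 0 < i, 0 < s, 0 < l & datum m d b c al p a be q i s l].
  move=> pp qq; have D := @datum_cst R m e d e0 e1 ed b c al p a be q 1 0 1 2 1 2 pp qq ltr01
    ltr01 lt12 ltr01 lt12 c11 c22.
  do 3 eexists; split; last exact: D.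
  - by rewrite mulr_gt0// mulr_gt0 ?exprn_gt0// powint_gt0.
  - by rewrite mulr_gt0// mulr_gt0 ?exprn_gt0// powint_gt0.
  - rewrite mulr_gt0// mulr_gt0 ?powint_gt0//.
    by rewrite !mulr_gt0 ?exprn_gt0 ?powR_gt0// lowc_gt0.
have test i1 s1 l1 i2 s2 l2 : datum m d b1 c1 al1 1 a1 be1 q1 i1 s1 l1 ->
    datum m d b2 c2 al2 p2 a2 be2 q2 i2 s2 l2 -> 0 < i1 -> 0 < i2 ->
    i1 * i2 / 2 * (l1 `^ q1^-1 * l2 `^ q2^-1) <= C * (s1 * s2 `^ p2^-1).
  move=> [M1 [phi1 [k1 [A1 I1 S1 L1]]]] [M2 [phi2 [k2 [A2 I2 S2 L2]]]] i10 i20.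
  apply: (test_inequality domK secK p0 q10 q20 A1 A2 I1 I2 i10 i20 _ S2 L1 L2).
    rewrite -S1; apply: eq_integral => u _; rewrite powRr1//; exact: adm_phi0 A1 _.
  by move=> g /bdd[].
have [i1 [s1 [l1 [i10 s10 l10 D1]]]] := unit b1 c1 al1 1 a1 be1 q1 ltr01 q10.
have [i2 [s2 [l2 [i20 s20 l20 D2]]]] := unit b2 c2 al2 p2 a2 be2 q2 p0 q20.
have lq1 : 0 < l1 `^ q1^-1 by exact: powR_gt0.
have lq2 : 0 < l2 `^ q2^-1 by exact: powR_gt0.
have H1 i s l : datum m d b1 c1 al1 1 a1 be1 q1 i s l -> 0 < i ->
    i * l `^ q1^-1 <= (C * s2 `^ p2^-1 * 2 / (i2 * l2 `^ q2^-1)) * s `^ 1^-1.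
  move=> D i0; have s0 : 0 <= s.
    case: D => M [phi [k [A _ S _]]]; rewrite -lee_fin -S.
    by apply: integral_ge0 => u _; rewrite lee_fin mulr_ge0 ?wgt_ge0 ?powR_ge0.
  rewrite invr1 powRr1// mulrAC ler_pdivlMr ?mulr_gt0//.
  have := test _ _ _ _ _ _ D D2 i0 i20.
  set x := l `^ _; set y := l2 `^ _; set w := s2 `^ _ => T.
  have -> : i * x * (i2 * y) = 2 * (i * i2 / 2 * (x * y)) by field.
  have -> : C * w * 2 * s = 2 * (C * (s * w)) by ring.
  by rewrite ler_pM2l.
have H2 i s l : datum m d b2 c2 al2 p2 a2 be2 q2 i s l -> 0 < i ->
    i * l `^ q2^-1 <= (C * s1 * 2 / (i1 * l1 `^ q1^-1)) * s `^ p2^-1.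
  move=> D i0; rewrite mulrAC ler_pdivlMr ?mulr_gt0//.
  have := test _ _ _ _ _ _ D1 D i10 i0.
  set x := l `^ _; set y := l1 `^ _; set w := s `^ _ => T.
  have -> : i * x * (i1 * y) = 2 * (i1 * i / 2 * (y * x)) by field.
  have -> : C * s1 * 2 * w = 2 * (C * (s1 * w)) by ring.
  by rewrite ler_pM2l.
have T1 := nec_target_integrable e0 e1 ed ltr01 q10 H1.
have T2 := nec_target_integrable e0 e1 ed p0 q20 H2.
have c1E := nec_scaling e0 e1 ed ltr01 q10 H1.
have c2E := nec_scaling e0 e1 ed p0 q20 H2.
have inf := nec_infinity e0 e1 ed ltr01 q10 H1.
rewrite divr1 in c1E.
split.
(* After substituting the formula for c1, [nec_infinity] says exactly that (b1 - al1) q1 > 0. *)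
- have cq : c1 * q1 = (a1 + b1 - al1) * q1 + n%:R + 1 + be1.
    by rewrite c1E; field; rewrite gt_eqF.
  have : 0 < (b1 - al1) * q1 by move: inf; rewrite cq !mulrDl !mulNr; lra.
  by rewrite pmulr_lgt0// subr_gt0.
- exact: (nec_source_dual e0 e1 ed p0 q20 H2).
- by split => //; lra.
- by split => //; lra.
Qed.

Theorem bounded_iff (p2 q1 q2 a1 a2 b1 b2 c1 c2 al1 al2 be1 be2 d : R)
    (K : Cm * Cm -> Cm * Cm -> R[i]) : 0 < d ->
  kernel_dominated b1 b2 c1 c2 K -> kernel_sector d b1 b2 c1 c2 K ->
  1 < p2 -> p2 <= q1 -> p2 <= q2 ->
  bounded_intop (prefac a1 a2) K 1 p2 al1 al2 q1 q2 be1 be2 <->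
  [/\ al1 < b1, al2 + 1 < p2 * (b2 + 1),
    - q1 * a1 < be1 + 1 /\
      c1 = n%:R + 1 + a1 + b1 + ((n%:R + 1 + be1) / q1 - (n%:R + 1 + al1)) &
    - q2 * a2 < be2 + 1 /\
      c2 = n%:R + 1 + a2 + b2 + ((n%:R + 1 + be2) / q2 - (n%:R + 1 + al2) / p2)].
Proof.
move=> d0 domK secK p1 pq1 pq2; split; first exact: (conditions_of_bounded d0).
move=> [ab1 ab2 [qa1 c1E] [qa2 c2E]].
exact: (bounded_of_conditions domK p1 pq1 pq2 ab1 ab2 qa1 qa2 c1E c2E).
Qed.

End characterization.

(* p = (1, p2), q = (q1, q2), a = (a1, a2), b = (b1, b2), c = (c1, c2),
   alpha = (al1, al2), beta = (be1, be2). *)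
Theorem theorem6p4 (R : realType) (n : nat)
    (p2 q1 q2 a1 a2 b1 b2 c1 c2 al1 al2 be1 be2 : R) :
  (0 < n)%N ->
  1 < p2 -> p2 <= Num.min q1 q2 ->
  -1 < al1 -> -1 < al2 -> -1 < be1 -> -1 < be2 ->
  let lam1 := (n%:R + 1 + be1) / q1 - (n%:R + 1 + al1) in
  let lam2 := (n%:R + 1 + be2) / q2 - (n%:R + 1 + al2) / p2 in
  (bounded_intop (prefac (n:=n) a1 a2) (Skernel b1 b2 c1 c2) 1 p2 al1 al2 q1 q2 be1 be2
   <-> bounded_intop (prefac (n:=n) a1 a2) (Tkernel b1 b2 c1 c2) 1 p2 al1 al2 q1 q2 be1 be2)
  /\
  (bounded_intop (prefac (n:=n) a1 a2) (Tkernel b1 b2 c1 c2) 1 p2 al1 al2 q1 q2 be1 be2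
   <-> [/\ al1 < b1, al2 + 1 < p2 * (b2 + 1),
          - q1 * a1 < be1 + 1 /\ c1 = n%:R + 1 + a1 + b1 + lam1 &
          - q2 * a2 < be2 + 1 /\ c2 = n%:R + 1 + a2 + b2 + lam2]).
Proof.
case: n => [|m] n0; first by rewrite ltnn in n0.
move=> p1; rewrite le_min => /andP[pq1 pq2] _ _ _ _ lam1 lam2.
have [d d0 sT] := @Tkernel_sector R m b1 b2 c1 c2.
have HT := bounded_iff a1 a2 al1 al2 be1 be2 d0 (@Tkernel_dominated R m b1 b2 c1 c2) sT p1 pq1 pq2.
have HS := bounded_iff a1 a2 al1 al2 be1 be2 d0 (@Skernel_dominated R m b1 b2 c1 c2)
  (@Skernel_sector R m d b1 b2 c1 c2) p1 pq1 pq2.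
by split; [exact: iff_trans HS (iff_sym HT)|exact: HT].
Qed.
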